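(* Let $\mathcal{A}$ be a $W^{*}$-algebra and let $F \in B^{a}(H_{\mathcal{A}})$. Then $F \in \mathcal{M}\Phi_{+}(H_{\mathcal{A}})$ if and only if $\ker(F-K)$ is finitely generated for all $K \in K^{*}(H_{\mathcal{A}})$.
   Context: $H_{\mathcal{A}}=l_{2}(\mathcal{A})$ is the standard (right) Hilbert $C^{*}$-module over $\mathcal{A}$ of sequences $(a_i)_{i\in\mathbb{N}}$ in $\mathcal{A}$ with $\sum_i a_i^{*}a_i$ norm-convergent. $B^{a}(H_{\mathcal{A}})$ is the set of bounded adjointable $\mathcal{A}$-linear operators on $H_{\mathcal{A}}$. $K^{*}(H_{\mathcal{A}})\subseteq B^{a}(H_{\mathcal{A}})$ is the set of adjointable compact operators, i.e. the norm closure of the linear span of the operators $z\mapsto x\langle y,z\rangle$, $x,y\in H_{\mathcal{A}}$. A Hilbert module is finitely generated if it is the linear span (over $\mathbb{C}$ and $\mathcal{A}$) of a finite subset. $\tilde\oplus$ denotes the direct sum of closed submodules, not necessarily orthogonal. $\mathcal{M}\Phi_{+}(H_{\mathcal{A}})$ (upper semi-$\mathcal{A}$-Fredholm operators) is the set of $F\in B^{a}(H_{\mathcal{A}})$ for which there are closed submodules $M_1,N_1,M_2,N_2$ with $H_{\mathcal{A}}=M_1\tilde\oplus N_1=M_2\tilde\oplus N_2$ such that $F(M_1)\subseteq M_2$, $F(N_1)\subseteq N_2$, $F|_{M_1}:M_1\to M_2$ is an isomorphism (bounded $\mathcal{A}$-linear bijection), and $N_1$ is finitely generated. *)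

(* Defs.v *)
From HB Require Import structures.
From mathcomp Require Import all_boot all_order all_algebra.
From mathcomp Require Import complex.
From mathcomp Require Import all_classical all_reals all_analysis.

Set Implicit Arguments.
Unset Strict Implicit.
Unset Printing Implicit Defensive.

Import Order.TTheory GRing.Theory Num.Theory.
Import numFieldNormedType.Exports.

Local Open Scope classical_set_scope.
Local Open Scope ring_scope.
Local Open Scope complex_scope.

(* Unital C*-algebras.  The product is part of the mixin because HB does not
   allow the join of the ring and normed-module hierarchies: NumDomain already
   inherits from both.  The zero algebra (cone = 0) is allowed. *)
HB.mixin Record isCStarAlgebra (R : realType) A
    & CompleteNormedModule R[i] A := {
  cmul : A -> A -> A;
  cone : A;
  cstar : A -> A;
  cmulA : associative cmul;
  cmul1a : left_id cone cmul;
  cmula1 : right_id cone cmul;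
  cmulDl : left_distributive cmul +%R;
  cmulDr : right_distributive cmul +%R;
  cmulZl : forall (c : R[i]) (a b : A), cmul (c *: a) b = c *: cmul a b;
  cmulZr : forall (c : R[i]) (a b : A), cmul a (c *: b) = c *: cmul a b;
  cmul_norm : forall a b : A, `|cmul a b| <= `|a| * `|b|;
  cstarK : involutive cstar;
  cstarD : {morph cstar : a b / a + b};
  cstarZ : forall (c : R[i]) (a : A), cstar (c *: a) = c^* *: cstar a;
  cstarM : forall a b : A, cstar (cmul a b) = cmul (cstar b) (cstar a);
  cstar_norm : forall a : A, `|cmul (cstar a) a| = `|a| ^+ 2
}.

#[short(type="cstarAlgType")]
HB.structure Definition CStarAlgebra (R : realType) :=
  { A of isCStarAlgebra R A & CompleteNormedModule R[i] A }.

(* The operator norm of f is c.  Norms take values in R[i] here, hence the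
   formulation as a least bound. *)
Definition has_opnorm (R : realType) (V W : normedModType R[i])
    (f : V -> W) (c : R[i]) : Prop :=
  [/\ 0 <= c, forall v, `|f v| <= c * `|v| &
      forall d : R[i], 0 <= d -> (forall v, `|f v| <= d * `|v|) -> c <= d].

(* Sakai: a W*-algebra is a C*-algebra that is isometrically isomorphic to the
   dual of some Banach space V, here through a |-> phi a. *)
Definition is_Wstar_algebra (R : realType) (A : cstarAlgType R) : Prop :=
  exists (V : completeNormedModType R[i]) (phi : A -> {linear V -> R[i]^o}),
    [/\ forall (c : R[i]) (a b : A) v,
          phi (c *: a + b) v = c * phi a v + phi b v,
        forall a : A, has_opnorm (phi a) `|a| &
        forall f : {linear V -> R[i]^o}, continuous f ->
          exists a : A, forall v, phi a v = f v].

(* H_A is a subset of nat -> A, which supplies the pointwise operations.  Maps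
   on H_A are total functions on nat -> A; every notion below depends only on
   their values on H_A. *)
Section HilbertModule.
Variables (R : realType) (A : cstarAlgType R).
Local Notation C := R[i].
Local Notation seqA := (nat -> A).

Definition HA : set seqA :=
  [set x | cvgn (series (fun i => cmul (cstar (x i)) (x i)))].

Definition hdot (x y : seqA) : A :=
  limn (series (fun i => cmul (cstar (x i)) (y i))).

Definition hnorm (x : seqA) : C := sqrtC `|hdot x x|.

Definition hact (x : seqA) (a : A) : seqA := fun i => cmul (x i) a.

Definition hclosed (M : set seqA) : Prop :=
  forall x, HA x ->
    (forall e : C, 0 < e -> exists2 y, M y & hnorm (x - y) < e) -> M x.

Definition closed_submodule (M : set seqA) : Prop :=
  [/\ M `<=` HA, M 0,
      forall (c : C) x y, M x -> M y -> M (c *: x + y),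
      forall x a, M x -> M (hact x a) &
      hclosed M].

Definition direct_sum (M N : set seqA) : Prop :=
  M `&` N = [set 0] /\ HA = [set z | exists x y, [/\ M x, N y & z = x + y]].

Definition finitely_generated (M : set seqA) : Prop :=
  exists (n : nat) (s : 'I_n -> seqA), (forall i, M (s i)) /\
    M = [set x | exists (c : 'I_n -> C) (a : 'I_n -> A),
           x = \sum_(i < n) (c i *: s i + hact (s i) (a i))].

Definition bounded_Alinear (M N : set seqA) (F : seqA -> seqA) : Prop :=
  [/\ forall x, M x -> N (F x),
      forall (c : C) x y, M x -> M y -> F (c *: x + y) = c *: F x + F y,
      forall x a, M x -> F (hact x a) = hact (F x) a &
      exists2 m : C, 0 <= m & forall x, M x -> hnorm (F x) <= m * hnorm x].

Definition module_iso (M N : set seqA) (F : seqA -> seqA) : Prop :=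
  bounded_Alinear M N F /\ set_bij M N F.

(* B^a(H_A) *)
Definition adjointable (F : seqA -> seqA) : Prop :=
  bounded_Alinear HA HA F /\
  exists2 G, bounded_Alinear HA HA G &
    forall x y, HA x -> HA y -> hdot (F x) y = hdot x (G y).

Definition rank_one (x y : seqA) : seqA -> seqA := fun z => hact x (hdot y z).

(* K^*(H_A): approximable, in operator norm on H_A, by elements of the linear
   span of the rank one operators. *)
Definition compact_adjointable (K : seqA -> seqA) : Prop :=
  adjointable K /\
  forall e : C, 0 < e ->
    exists (n : nat) (c : 'I_n -> C) (x y : 'I_n -> seqA),
      [/\ forall i, HA (x i), forall i, HA (y i) &
          forall z, HA z ->
            hnorm (K z - \sum_(i < n) c i *: rank_one (x i) (y i) z)
            <= e * hnorm z].

(* MPhi_+(H_A) *)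
Definition upper_semi_Fredholm (F : seqA -> seqA) : Prop :=
  adjointable F /\
  exists M1 N1 M2 N2 : set seqA,
    [/\ [/\ closed_submodule M1, closed_submodule N1,
            closed_submodule M2 & closed_submodule N2],
        direct_sum M1 N1 /\ direct_sum M2 N2,
        (forall x, M1 x -> M2 (F x)) /\ (forall x, N1 x -> N2 (F x)),
        module_iso M1 M2 F &
        finitely_generated N1].

Definition hker (T : seqA -> seqA) : set seqA := [set x | HA x /\ T x = 0].

End HilbertModule.

(* Main.v *)
Require Import Defs.
From HB Require Import structures.
From mathcomp Require Import all_boot all_order all_algebra.
From mathcomp Require Import complex.
From mathcomp Require Import all_classical all_reals all_analysis.
From mathcomp Require Import ring lra.

Set Implicit Arguments.
Unset Strict Implicit.
Unset Printing Implicit Defensive.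

Import Order.TTheory GRing.Theory Num.Theory.
Import numFieldNormedType.Exports.

Local Open Scope classical_set_scope.
Local Open Scope ring_scope.

(** Forward direction.  Let [G] be the projection onto [M2] followed by the inverse of
    [F : M1 -> M2]; it is bounded by the closed graph theorem, and [x = G (F x) + n]
    with [n] in [N1] for all [x].  On [ker (F - K)] this reads [x = G (K x) + n].  For
    a finite rank [T] close to [K], solving for [x] with the invertible map
    [1 - G (K - T)] places [ker (F - K)] in a finitely generated module, so that it
    is an image of the kernel of a map from some [A^p] to [H_A].  With [B] the Gram
    matrix of that map, the Cesaro means of the powers of the contraction [1 - rho B]
    tend weak-* to a matrix whose columns generate the kernel.  This needs weak-*
    limits to commute with multiplication by elements of [A]; they do, because an
    ultrafilter limit of bounded sequences is a contractive projection of
    [l^oo(A)] onto [A] (Tomiyama's theorem).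

    Backward direction.  If [F] is bounded below on the sequences supported in
    [n, oo), their orthogonal decompositions exhibit [F] as upper semi-Fredholm.
    Otherwise there are disjointly supported unit vectors on which [F] is summably
    small; functional calculus turns them into vectors on which [F] agrees with a
    compact operator [K], and then [ker (F - K)] is not finitely generated. *)

(** The predual in Sakai's definition comes with no continuity of the product, so a weak-* limit of
    approximate kernel projections is not at once compatible with the Gram matrix; this obstacle
    shapes the forward direction. Tomiyama's theorem is usually proved in the bidual with spectral
    projections. Here a unitary [u] gets approximate spectral projections [F_j^# F_j], where [F_j]
    is a mean of powers of [u] rotated by the j-th power of a root of unity. The limit of
    [(u - w^j) y_n] is small after multiplication by the j-th of them, and by Parseval's identity
    their squares add up to a scalar that is at least 1. In the backward direction the obstacle is
    that [<xi, xi>] has norm 1 but may fail to be invertible, so that [xi] cannot be normalised in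
    the sense of [A]. Keeping only the part of [<xi, xi>] above 1/2 repairs this, at the price of a
    factor 2 in the norms. The final contradiction weighs coefficients [2^-j] against pairings that
    are [O(4^-j)]. *)

Local Notation "x ** y" := (cmul x y) (at level 40, left associativity).
Local Notation "x ^#" := (cstar x) (at level 2, format "x ^#").
Local Notation "t *:: x" := (real_complex _ t *: x) (at level 40).

(** * Norm, involution and finite sums in a C*-algebra *)

Section CStarBasics.
Variables (R : realType) (A : cstarAlgType R).
Implicit Types (a b c x y : A) (s t : R).

(** Norms take values in [R[i]]; [nm] is the same number in [R], where [lra] and [nra] apply. *)
Definition nm a : R := complex.Re `|a|.

Lemma nmE a : `|a| = (nm a)%:C%C.
Proof. by rewrite /nm RRe_real ?normr_real. Qed.

Lemma nm_ge0 a : 0 <= nm a.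
Proof. by have := normr_ge0 a; rewrite nmE lecR. Qed.

Lemma nm_eq0 a : nm a = 0 -> a = 0.
Proof. by move=> h; apply/eqP; rewrite -normr_eq0 nmE h. Qed.

Lemma nm0 : nm 0 = 0.
Proof. by apply: complexI; rewrite -nmE normr0. Qed.

Lemma nmD a b : nm (a + b) <= nm a + nm b.
Proof. by have := ler_normD a b; rewrite !nmE -rmorphD lecR. Qed.

Lemma nmN a : nm (- a) = nm a.
Proof. by apply: complexI; rewrite -!nmE normrN. Qed.

Lemma nmB a b : nm (a - b) <= nm a + nm b.
Proof. by rewrite -(nmN b) nmD. Qed.

Lemma nmBC a b : nm (a - b) = nm (b - a).
Proof. by rewrite -nmN opprB. Qed.

Lemma nmZ (l : R[i]) a : nm (l *: a) = complex.Re `|l| * nm a.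
Proof.
apply: complexI; rewrite -nmE normrZ nmE rmorphM /=.
by congr (_ * _); rewrite RRe_real ?normr_real.
Qed.

Lemma nmZr t a : nm (t *:: a) = `|t| * nm a.
Proof.
rewrite nmZ; congr (_ * _).
by rewrite normc_def /= expr0n /= addr0 sqrtr_sqr.
Qed.

Lemma nmZi a : nm ('i%C *: a) = nm a.
Proof. by rewrite nmZ normc_def /= expr0n add0r expr1n sqrtr1 mul1r. Qed.

Lemma nmM a b : nm (a ** b) <= nm a * nm b.
Proof. by have := cmul_norm a b; rewrite !nmE -rmorphM lecR. Qed.

Lemma nm_star_mul a : nm (a^# ** a) = nm a ^+ 2.
Proof. by apply: complexI; rewrite -nmE cstar_norm nmE rmorphXn. Qed.

Lemma cmul0l a : 0 ** a = 0 :> A.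
Proof. by have := cmulZl 0 0 a; rewrite !scale0r. Qed.

Lemma cmul0r a : a ** 0 = 0 :> A.
Proof. by have := cmulZr 0 a 0; rewrite !scale0r. Qed.

Lemma cmulNl a b : (- a) ** b = - (a ** b).
Proof. by rewrite -scaleN1r cmulZl scaleN1r. Qed.

Lemma cmulNr a b : a ** (- b) = - (a ** b).
Proof. by rewrite -scaleN1r cmulZr scaleN1r. Qed.

Lemma cstar0 : (0 : A)^# = 0.
Proof. by have := cstarZ 0 (0 : A); rewrite scale0r conjC0 scale0r. Qed.

Lemma cstarN a : (- a)^# = - a^#.
Proof. by rewrite -scaleN1r cstarZ rmorphN rmorph1 scaleN1r. Qed.

Lemma cstarZr t a : (t *:: a)^# = t *:: a^#.
Proof. by rewrite cstarZ; congr (_ *: _); apply: (conjc_real t). Qed.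

Lemma cstar1 : (cone : A)^# = cone.
Proof. by rewrite -[LHS]cmul1a -{1}(cstarK cone) -cstarM cmul1a cstarK. Qed.

Lemma nm_star a : nm a^# = nm a.
Proof.
suff H b : nm b <= nm b^#.
  by apply/eqP; rewrite eq_le H andbT -{2}(cstarK a) H.
have [->|b0] := eqVneq b 0; first by rewrite cstar0.
have: nm b ^+ 2 <= nm b^# * nm b by rewrite -nm_star_mul nmM.
rewrite expr2 ler_pM2r // lt_neqAle nm_ge0 andbT eq_sym.
by apply: contra_neq b0 => /nm_eq0.
Qed.

(** Only an inequality, since the unit of the zero algebra has norm 0. *)
Lemma nm1_le1 : nm (cone : A) <= 1.
Proof.
have := nm_star_mul (cone : A); rewrite cstar1 cmul1a.
have := nm_ge0 (cone : A); nra.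
Qed.

Lemma nmR t : nm (t *:: (cone : A)) <= `|t|.
Proof. by rewrite nmZr ler_piMr // nm1_le1. Qed.

Lemma cmul_suml (I : Type) (r : seq I) (P : pred I) (F : I -> A) b :
  (\sum_(i <- r | P i) F i) ** b = \sum_(i <- r | P i) F i ** b.
Proof.
by apply: (big_morph (fun x : A => x ** b)) => [x y|]; rewrite ?cmulDl ?cmul0l.
Qed.

Lemma cmul_sumr (I : Type) (r : seq I) (P : pred I) (F : I -> A) b :
  b ** (\sum_(i <- r | P i) F i) = \sum_(i <- r | P i) b ** F i.
Proof.
by apply: (big_morph (fun x : A => b ** x)) => [x y|]; rewrite ?cmulDr ?cmul0r.
Qed.

Lemma cstar_sum (I : Type) (r : seq I) (P : pred I) (F : I -> A) :
  (\sum_(i <- r | P i) F i)^# = \sum_(i <- r | P i) (F i)^#.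
Proof. by apply: (big_morph cstar) => [x y|]; rewrite ?cstarD ?cstar0. Qed.

Lemma nm_sum (I : Type) (r : seq I) (P : pred I) (F : I -> A) :
  nm (\sum_(i <- r | P i) F i) <= \sum_(i <- r | P i) nm (F i).
Proof.
elim/big_rec2: _ => [|i y x _ h]; first by rewrite nm0.
by apply: le_trans (nmD _ _) _; rewrite lerD2l.
Qed.

End CStarBasics.

(** * Deciding identities in *-algebras *)

Section Reflection.
Variables (R : realType) (A : cstarAlgType R).

(** Scalars enter as real multiples and as multiplication by ['i], so that comparing normal forms
    leaves identities in [R] only. *)
Inductive sexpr : Type :=
  | SV of nat | S0 | S1 | SAdd of sexpr & sexpr | SOpp of sexpr
  | SMul of sexpr & sexpr | SStar of sexpr | SR of R & sexpr | SI of sexpr.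

Variable env : seq A.

Fixpoint sval (e : sexpr) : A :=
  match e with
  | SV n => nth 0 env n
  | S0 => 0
  | S1 => cone
  | SAdd e f => sval e + sval f
  | SOpp e => - sval e
  | SMul e f => sval e ** sval f
  | SStar e => (sval e)^#
  | SR t e => t *:: sval e
  | SI e => 'i%C *: sval e
  end.

(* A monomial is [(re, im, w)], where [w] lists the letters of a word, a letter
   [(n, true)] standing for the adjoint of the n-th variable. *)
Definition smono : Type := (R * R * seq (nat * bool))%type.

Definition letter_val (l : nat * bool) : A :=
  if l.2 then (nth 0 env l.1)^# else nth 0 env l.1.

Fixpoint word_val (w : seq (nat * bool)) : A :=
  if w is l :: w' then letter_val l ** word_val w' else cone.

Definition mono_val (m : smono) : A :=
  (m.1.1 +i* m.1.2)%C *: word_val m.2.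

Fixpoint monos_val (p : seq smono) : A :=
  if p is m :: p' then mono_val m + monos_val p' else 0.

(** With separate copies of concatenation, mapping and equality tests, [star_ring_with] can unfold
    exactly these names and leave the real coefficients folded. *)
Fixpoint sapp (T : Type) (p q : seq T) : seq T :=
  if p is m :: p' then m :: sapp p' q else q.

Fixpoint smap (S T : Type) (f : S -> T) (p : seq S) : seq T :=
  if p is m :: p' then f m :: smap f p' else [::].

Definition mono_mul (m n : smono) : smono :=
  match m, n with
  | (a, b, v), (c, d, w) => (a * c - b * d, a * d + b * c, sapp v w)
  end.

Fixpoint monos_mul (p q : seq smono) : seq smono :=
  if p is m :: p' then sapp (smap (mono_mul m) q) (monos_mul p' q) else [::].

Fixpoint word_star (w : seq (nat * bool)) : seq (nat * bool) :=
  if w is (n, b) :: w' then sapp (word_star w') [:: (n, if b then false else true)]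
  else [::].

Definition mono_star (m : smono) : smono :=
  match m with (a, b, w) => (a, - b, word_star w) end.

Definition mono_opp (m : smono) : smono :=
  match m with (a, b, w) => (- a, - b, w) end.

Definition mono_R (t : R) (m : smono) : smono :=
  match m with (a, b, w) => (t * a, t * b, w) end.

Definition mono_I (m : smono) : smono :=
  match m with (a, b, w) => (- b, a, w) end.

Fixpoint snorm (e : sexpr) : seq smono :=
  match e with
  | SV n => [:: (1, 0, [:: (n, false)])]
  | S0 => [::]
  | S1 => [:: (1, 0, [::])]
  | SAdd e f => sapp (snorm e) (snorm f)
  | SOpp e => smap mono_opp (snorm e)
  | SMul e f => monos_mul (snorm e) (snorm f)
  | SStar e => smap mono_star (snorm e)
  | SR t e => smap (mono_R t) (snorm e)
  | SI e => smap mono_I (snorm e)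
  end.

Fixpoint nat_eqb (m n : nat) : bool :=
  match m, n with
  | 0%N, 0%N => true
  | S m, S n => nat_eqb m n
  | _, _ => false
  end.

Definition bool_eqb (b c : bool) : bool :=
  match b, c with true, true => true | false, false => true | _, _ => false end.

Fixpoint word_eqb (v w : seq (nat * bool)) : bool :=
  match v, w with
  | [::], [::] => true
  | (m, b) :: v, (n, c) :: w =>
      if nat_eqb m n then if bool_eqb b c then word_eqb v w else false else false
  | _, _ => false
  end.

Fixpoint mono_insert (m : smono) (p : seq smono) : seq smono :=
  match p with
  | [::] => [:: m]
  | n :: p' =>
      match m, n with
      | (a, b, v), (c, d, w) =>
          if word_eqb v w then (a + c, b + d, w) :: p' else n :: mono_insert m p'
      end
  end.

Fixpoint collect (p : seq smono) : seq smono :=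
  if p is m :: p' then mono_insert m (collect p') else [::].

Fixpoint coefs_zero (p : seq smono) : Prop :=
  match p with
  | [::] => True
  | (a, b, _) :: p' => (a = 0 /\ b = 0) /\ coefs_zero p'
  end.

Lemma monos_val_app p q : monos_val (sapp p q) = monos_val p + monos_val q.
Proof. by elim: p => [|m p IH] /=; rewrite ?add0r // IH addrA. Qed.

Lemma word_val_app v w : word_val (sapp v w) = word_val v ** word_val w.
Proof. by elim: v => [|m p IH] /=; rewrite ?cmul1a // IH cmulA. Qed.

Lemma mono_val_mul m n : mono_val (mono_mul m n) = mono_val m ** mono_val n.
Proof.
case: m n => [[a b] v] [[c d] w].
rewrite /mono_val /= word_val_app cmulZl cmulZr scalerA; congr (_ *: _).
Qed.

Lemma monos_val_mul p q : monos_val (monos_mul p q) = monos_val p ** monos_val q.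
Proof.
elim: p => [|m p IH] /=; first by rewrite cmul0l.
rewrite monos_val_app IH cmulDl; congr (_ + _).
by elim: q {IH} => [|n q IH] /=; rewrite ?cmul0r // IH cmulDr mono_val_mul.
Qed.

Lemma monos_val_map (f : smono -> smono) (g : A -> A) p :
  g 0 = 0 -> {morph g : x y / x + y} ->
  (forall m, mono_val (f m) = g (mono_val m)) ->
  monos_val (smap f p) = g (monos_val p).
Proof. by move=> g0 gD fg; elim: p => [|m p IH] //=; rewrite IH gD fg. Qed.

Lemma word_val_star w : word_val (word_star w) = (word_val w)^#.
Proof.
elim: w => [|[n b] w IH] /=; first by rewrite cstar1.
rewrite word_val_app IH cstarM; congr (_ ** _).
by rewrite /= cmula1 /letter_val; case: b => /=; rewrite ?cstarK.
Qed.

Lemma mono_val_star m : mono_val (mono_star m) = (mono_val m)^#.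
Proof. by case: m => [[a b] w]; rewrite /mono_val /= cstarZ word_val_star. Qed.

Lemma mono_val_opp m : mono_val (mono_opp m) = - mono_val m.
Proof. by case: m => [[a b] w]; rewrite /mono_val /= -scaleNr. Qed.

Lemma mono_val_R t m : mono_val (mono_R t m) = t *:: mono_val m.
Proof.
case: m => [[a b] w]; rewrite /mono_val /= scalerA; congr (_ *: _).
by apply/eqP; rewrite eq_complex /= !mul0r subr0 addr0 !eqxx.
Qed.

Lemma mono_val_I m : mono_val (mono_I m) = 'i%C *: mono_val m.
Proof.
case: m => [[a b] w]; rewrite /mono_val /= scalerA; congr (_ *: _).
by apply/eqP; rewrite eq_complex /= !mul0r !mul1r sub0r add0r !eqxx.
Qed.

Lemma monos_val_norm e : monos_val (snorm e) = sval e.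
Proof.
elim: e => [n||| e IHe f IHf | e IH | e IHe f IHf | e IH | t e IH | e IH] /=.
- by rewrite /mono_val /= cmula1 addr0 [X in X *: _](_ : _ = 1) // scale1r.
- by [].
- by rewrite /mono_val /= addr0 [X in X *: _](_ : _ = 1) // scale1r.
- by rewrite monos_val_app IHe IHf.
- rewrite -IH; apply: monos_val_map; [exact: oppr0|exact: opprD|exact: mono_val_opp].
- by rewrite monos_val_mul IHe IHf.
- rewrite -IH; apply: monos_val_map; [exact: cstar0|exact: cstarD|exact: mono_val_star].
- rewrite -IH; apply: monos_val_map;
    [exact: scaler0|exact: scalerDr|exact: mono_val_R].
- rewrite -IH; apply: monos_val_map;
    [exact: scaler0|exact: scalerDr|exact: mono_val_I].
Qed.

Lemma word_eqbP v w : word_eqb v w -> v = w.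
Proof.
elim: v w => [|[m b] v IH] [|[n c] w] //=.
have natP k l : nat_eqb k l -> k = l.
  by elim: k l => [|k IHk] [|l] //= /IHk ->.
by case E: (nat_eqb m n) => //; rewrite (natP _ _ E); case: b c => [] [] //= /IH ->.
Qed.

Lemma mono_insert_val m p : monos_val (mono_insert m p) = mono_val m + monos_val p.
Proof.
elim: p => [|n p IH] //=; case: m IH => [[a b] v]; case: n => [[c d] w] IH.
case E: (word_eqb v w) => /=; last by rewrite IH addrCA.
rewrite -(word_eqbP E) addrA; congr (_ + _).
by rewrite /mono_val /= -scalerDl.
Qed.

Lemma collect_val p : monos_val (collect p) = monos_val p.
Proof. by elim: p => [|m p IH] //=; rewrite mono_insert_val IH. Qed.

Lemma coefs_zeroP p : coefs_zero p -> monos_val p = 0.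
Proof.
elim: p => [|[[a b] w] p IH] //= [[-> ->] /IH ->]; rewrite addr0 /mono_val /=.
by rewrite [X in X *: _](_ : _ = 0) // scale0r.
Qed.

Lemma star_ring_correct e f :
  coefs_zero (collect (snorm (SAdd e (SOpp f)))) -> sval e = sval f.
Proof.
move=> /coefs_zeroP; rewrite collect_val monos_val_norm /= => /eqP.
by rewrite subr_eq0 => /eqP.
Qed.

End Reflection.

Ltac sr_add x l :=
  match l with
  | nil => constr:(x :: l)
  | x :: _ => l
  | ?y :: ?l' => let r := sr_add x l' in constr:(y :: r)
  end.
Ltac sr_idx x l :=
  match l with
  | x :: _ => constr:(0%N)
  | _ :: ?l' => let n := sr_idx x l' in constr:(S n)
  end.
Ltac sr_env l e :=
  match e with
  | cmul ?a ?b => let l := sr_env l a in sr_env l b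
  | (?a + ?b)%R => let l := sr_env l a in sr_env l b
  | (- ?a)%R => sr_env l a
  | cstar ?a => sr_env l a
  | (real_complex_def _ _) *: ?a => sr_env l a
  | ('i)%C *: ?a => sr_env l a
  | cone => l
  | 0%R => l
  | _ => sr_add e l
  end.
Ltac sr_reify R l e :=
  match e with
  | cmul ?a ?b => let u := sr_reify R l a in let v := sr_reify R l b in
                  constr:(@SMul R u v)
  | (?a + ?b)%R => let u := sr_reify R l a in let v := sr_reify R l b in
                  constr:(@SAdd R u v)
  | (- ?a)%R => let u := sr_reify R l a in constr:(@SOpp R u)
  | cstar ?a => let u := sr_reify R l a in constr:(@SStar R u)
  | (real_complex_def _ ?t) *: ?a => let u := sr_reify R l a in constr:(@SR R t u)
  | ('i)%C *: ?a => let u := sr_reify R l a in constr:(@SI R u)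
  | cone => constr:(@S1 R)
  | 0%R => constr:(@S0 R)
  | _ => let n := sr_idx e l in constr:(@SV R n)
  end.
(* Proves an identity between *-polynomials in noncommuting variables, leaving
   to [ring] the identities between the real coefficients. *)
Ltac star_ring_with tac :=
  match goal with
  | |- @eq ?T ?x ?y =>
    let R := match type of (@nm _ _ x) with ?R0 => constr:(R0) end in
    let RR := match constr:(@nm _ _ x) with @nm ?R0 _ _ => constr:(R0) end in
    let AA := match constr:(@nm _ _ x) with @nm _ ?A0 _ => constr:(A0) end in
    let l0 := constr:(@nil (CStarAlgebra.sort AA)) in
    let l := sr_env l0 x in
    let l := sr_env l y in
    let e := sr_reify RR l x in
    let f := sr_reify RR l y in
    apply: (@star_ring_correct RR AA l e f);
    cbv [collect snorm mono_insert coefs_zero monos_mul mono_mul mono_star mono_opp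
         mono_R mono_I smap sapp word_star word_eqb nat_eqb bool_eqb];
    repeat (split; [split; tac|]); exact: Logic.I
  end.
Ltac star_ring := star_ring_with ltac:(ring).
Ltac star_field :=
  star_ring_with ltac:(first [ring | by field | by field; rewrite ?gt_eqF]).

(** * Convergence *)

Section Convergence.
Variables (R : realType) (A : cstarAlgType R).
Implicit Types (a b c x y l : A) (u v : nat -> A) (s t : R).

Definition cvA u l : Prop :=
  forall e : R, 0 < e -> exists N, forall n, (N <= n)%N -> nm (u n - l) <= e.

Lemma cvAP u l : u @ \oo --> l <-> cvA u l.
Proof.
split=> [/cvgrPdist_le h e e0|h].
  have e0' : (0 : R[i]) < e%:C%C by rewrite ltcR.
  have [N _ HN] := h _ e0'; exists N => n /HN /=.
  by rewrite nmE lecR nmBC.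
apply/cvgrPdist_le => /= e; rewrite ltcE /= => /andP[/eqP ei er].
have [N HN] := h _ er; exists N => // n /= /HN.
by rewrite distrC nmE lecE /= ei eqxx.
Qed.

Lemma cauchy_cvA u :
  (forall e : R, 0 < e -> exists N, forall m n, (N <= m)%N -> (N <= n)%N ->
    nm (u m - u n) <= e) -> exists l, cvA u l.
Proof.
move=> h; suff /cauchy_cvgP/cvg_ex[l /cvAP hl] : cauchy (u @ \oo) by exists l.
apply: cauchy_exP => /= e; rewrite ltcE /= => /andP[/eqP ei er].
have [N HN] := h _ (divr_gt0 er (ltr0Sn _ 1)); exists (u N); exists N => //= n Nn.
rewrite -ball_normE /= nmE ltcE /= ei eqxx /=.
by apply: le_lt_trans (HN _ _ (leqnn _) Nn) _; lra.
Qed.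

Lemma cvA_unique u l m : cvA u l -> cvA u m -> l = m.
Proof.
move=> hl hm; apply/eqP; rewrite -subr_eq0; apply/eqP/nm_eq0/eqP.
rewrite eq_le nm_ge0 andbT; apply/ler_addgt0Pr => e e0; rewrite add0r.
have [N HN] := hl _ (divr_gt0 e0 (ltr0Sn _ 1)).
have [M HM] := hm _ (divr_gt0 e0 (ltr0Sn _ 1)).
have := HN _ (leq_maxl N M); have := HM _ (leq_maxr N M).
rewrite [X in _ -> X <= _ -> _]nmBC => h1 h2.
have -> : l - m = (l - u (maxn N M)) + (u (maxn N M) - m) by rewrite addrA subrK.
by apply: le_trans (nmD _ _) _; lra.
Qed.

Lemma cvA_cst a : cvA (fun=> a) a.
Proof. by move=> e e0; exists 0%N => n _; rewrite subrr nm0 ltW. Qed.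

Lemma cvA_eq u v l : u =1 v -> cvA u l -> cvA v l.
Proof. by move=> /funext ->. Qed.

Lemma cvA_shift u l : cvA u l -> cvA (fun n => u n.+1) l.
Proof. by move=> h e /h[N HN]; exists N => n Nn; apply/HN/leqW. Qed.

Lemma cvAD u v l m : cvA u l -> cvA v m -> cvA (fun n => u n + v n) (l + m).
Proof. by move=> /cvAP hl /cvAP hm; apply/cvAP; exact: (cvgD hl hm). Qed.

Lemma cvAZ (c : R[i]) u l : cvA u l -> cvA (fun n => c *: u n) (c *: l).
Proof.
move=> hl e e0; set k := complex.Re `|c|.
have k0 : 0 <= k by have := normr_ge0 c; rewrite lecE => /andP[].
have [N HN] := hl _ (divr_gt0 e0 (ltr_wpDl k0 ltr01)).
exists N => n /HN; rewrite ler_pdivlMr ?ltr_wpDl // -scalerBr nmZ -/k.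
by have := nm_ge0 (u n - l); nra.
Qed.

Lemma cvA_star u l : cvA u l -> cvA (fun n => (u n)^#) l^#.
Proof.
move=> h e /h[N HN]; exists N => n /HN.
by rewrite -(nm_star (u n - l)) cstarD cstarN.
Qed.

Lemma cvAM u v l m : cvA u l -> cvA v m -> cvA (fun n => u n ** v n) (l ** m).
Proof.
move=> hl hm e e0.
have K0 : 0 < 1 + nm l + nm m by have := nm_ge0 l; have := nm_ge0 m; lra.
(* The bound [d <= 1] absorbs the quadratic error [d^2] into [d], for a total of
   [d (1 + |l| + |m|) <= e]. *)
set d := Num.min 1 (e / (1 + nm l + nm m)).
have d0 : 0 < d by rewrite lt_min ltr01 divr_gt0.
have [N HN] := hl _ d0; have [M HM] := hm _ d0.
exists (maxn N M) => n; rewrite geq_max => /andP[/HN h1 /HM h2].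
have -> : u n ** v n - l ** m =
    (u n - l) ** (v n - m) + l ** (v n - m) + (u n - l) ** m by star_ring.
have d1 : d <= 1 by rewrite ge_min lexx.
have de : d * (1 + nm l + nm m) <= e by rewrite -ler_pdivlMr // ge_min lexx orbT.
apply: le_trans (nmD _ _) _; apply: le_trans (lerD (nmD _ _) (lexx _)) _.
have := nmM (u n - l) (v n - m); have := nmM l (v n - m); have := nmM (u n - l) m.
move: h1 h2 de (nm_ge0 l) (nm_ge0 m) (nm_ge0 (u n - l)) (nm_ge0 (v n - m)) d1.
move: (nm _) (nm (u n - l)) (nm (v n - m)) (nm m) (nm l) => p q r m' l'.
move=> *; nra.
Qed.

Lemma cvA_nm u l (c : R) : cvA u l -> (exists N, forall n, (N <= n)%N -> nm (u n) <= c) ->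
  nm l <= c.
Proof.
move=> hl [M HM]; apply/ler_addgt0Pr => e /hl[N HN].
have := HN _ (leq_maxl N M); rewrite nmBC; have := HM _ (leq_maxr N M).
set w := u _ => h1 h2; rewrite -(subrK w l).
by apply: le_trans (nmD _ _) _; lra.
Qed.

End Convergence.

Lemma bounded_incr_cauchy (R : realType) (r : nat -> R) (B : R) :
  (forall n, r n <= r n.+1) -> (forall n, r n <= B) ->
  forall e, 0 < e -> exists N, forall m n, (N <= m)%N -> (N <= n)%N ->
    `|r m - r n| <= e.
Proof.
move=> hi hB e e0.
have hm : {homo r : m n / (m <= n)%N >-> m <= n}.
  exact: homo_leq (lexx) le_trans hi.
have hs : has_sup (range r) by split; [exists (r 0%N), 0%N|exists B => _ [n _ <-]].
have [_ [N _ <-] hN] := sup_adherent e0 hs.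
have up n : r n <= sup (range r) by apply: sup_upper_bound => //; exists n.
exists N => m n /hm h1 /hm h2.
by rewrite ler_norml; have := up m; have := up n; lra.
Qed.

(** * Positive elements: square roots, order and inverses *)

Section CStarPositive.
Variables (R : realType) (A : cstarAlgType R).
Implicit Types (a b c h l v w x y : A) (u : nat -> A) (r t : R).

(** Majorant method: the increments of [u] telescope against those of [r], and letting the later
    index grow turns [r m - r n] into [B - r n]. It serves both the square root iteration and the
    Neumann series. *)
Lemma dominated_cvA u (r : nat -> R) B :
  (forall n, nm (u n.+1 - u n) <= r n.+1 - r n) -> (forall n, r n <= B) ->
  exists2 l, cvA u l & forall n, nm (l - u n) <= B - r n.
Proof.
move=> hu hB.
have hr n : r n <= r n.+1 by rewrite -subr_ge0 (le_trans _ (hu n)) // nm_ge0.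
have key n k : nm (u (n + k)%N - u n) <= r (n + k)%N - r n.
  elim: k => [|k IH]; first by rewrite addn0 subrr nm0 subrr.
  rewrite addnS -(subrK (u (n + k)%N) (u _.+1)) -addrA.
  apply: le_trans (nmD _ _) _.
  by have := hu (n + k)%N; move: IH; lra.
have key2 m n : nm (u m - u n) <= `|r m - r n|.
  wlog mn : m n / (n <= m)%N.
    by move=> h; case/orP: (leq_total n m) => /h //; rewrite nmBC distrC.
  by rewrite -(subnKC mn); apply: le_trans (key _ _) _; apply: ler_norm.
have [l hl] : exists l, cvA u l.
  apply: cauchy_cvA => e /(bounded_incr_cauchy hr hB)[N HN].
  by exists N => m n /HN h /h; apply: le_trans (key2 _ _).
exists l => // n; apply: (@cvA_nm _ _ (fun k => u k - u n)).
  by apply: cvAD => //; apply: cvA_cst.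
exists n => k nk; rewrite -(subnKC nk); apply: le_trans (key _ _) _.
by have := hB (n + (k - n))%N; lra.
Qed.

Definition sa a := a^# = a.
Definition comm a b := a ** b = b ** a.

Lemma comm1 a : comm a cone. Proof. by rewrite /comm cmul1a cmula1. Qed.
Lemma comm_sym a b : comm a b -> comm b a. Proof. by []. Qed.
Lemma commD a b c : comm a b -> comm a c -> comm a (b + c).
Proof. by rewrite /comm => h1 h2; rewrite cmulDr cmulDl h1 h2. Qed.
Lemma commZ a b (k : R[i]) : comm a b -> comm a (k *: b).
Proof. by rewrite /comm => h1; rewrite cmulZr cmulZl h1. Qed.
Lemma commN a b : comm a b -> comm a (- b).
Proof. by rewrite /comm => h1; rewrite cmulNr cmulNl h1. Qed.
Lemma commM a b c : comm a b -> comm a c -> comm a (b ** c).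
Proof. by rewrite /comm => h1 h2; rewrite cmulA h1 -!cmulA h2. Qed.
Lemma saM a b : comm a b -> sa a -> sa b -> sa (a ** b).
Proof. by rewrite /sa cstarM => -> -> ->. Qed.
Lemma saD a b : sa a -> sa b -> sa (a + b).
Proof. by rewrite /sa cstarD => -> ->. Qed.
Lemma saN a : sa a -> sa (- a).
Proof. by rewrite /sa cstarN => ->. Qed.
Lemma saZ t a : sa a -> sa (t *:: a).
Proof. by rewrite /sa cstarZr => ->. Qed.
Lemma sa1 : sa cone. Proof. exact: cstar1. Qed.
Lemma sa_star_mul a : sa (a^# ** a).
Proof. by rewrite /sa cstarM cstarK. Qed.

Lemma nm_sqr a : sa a -> nm (a ** a) = nm a ^+ 2.
Proof. by move=> h; rewrite -nm_star_mul h. Qed.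

Fixpoint sqrt_seq x n : A :=
  if n is n'.+1 then 2^-1 *:: (x + sqrt_seq x n' ** sqrt_seq x n') else 0.

Fixpoint sqrt_dom n : R :=
  if n is n'.+1 then 2^-1 * (1 + sqrt_dom n' * sqrt_dom n') else 0.

Lemma sqrt_dom_bound n : 0 <= sqrt_dom n <= 1.
Proof. by elim: n => /= [|n]; [|set r := sqrt_dom n => IH]; nra. Qed.

(* [1 - x] has a square root [1 - l], where [l] is the limit of the iteration
   [l := (x + l^2) / 2]; it is dominated by the same iteration at [x = 1]. *)
Lemma sqrt_one_sub x : sa x -> nm x <= 1 ->
  exists y, [/\ sa y, y ** y = cone - x, nm (cone - y) <= 1 &
    forall w, comm w x -> comm w y].
Proof.
move=> sx nx.
have nb n : nm (sqrt_seq x n) <= sqrt_dom n.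
  elim: n => [|n IH] /=; first by rewrite nm0.
  rewrite nmZr ger0_norm ?invr_ge0 // ler_pM2l ?invr_gt0 //.
  apply: le_trans (nmD _ _) _; apply: lerD => //.
  apply: le_trans (nmM _ _) _.
  by move: IH (nm_ge0 (sqrt_seq x n)) (sqrt_dom_bound n); nra.
have hd n : nm (sqrt_seq x n.+1 - sqrt_seq x n) <= sqrt_dom n.+1 - sqrt_dom n.
  elim: n => [|n IH].
    rewrite /= cmul0l addr0 subr0 mulr0 addr0 subr0 nmZr ger0_norm ?invr_ge0 //.
    by rewrite ler_pM2l ?invr_gt0.
  set p := sqrt_seq x n.+1 in IH *; set q := sqrt_seq x n in IH *.
  have -> : sqrt_seq x n.+2 - p = 2^-1 *:: ((p - q) ** p + q ** (p - q)).
    have -> : sqrt_seq x n.+2 = 2^-1 *:: (x + p ** p) by [].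
    have ep : p = 2^-1 *:: (x + q ** q) by [].
    by rewrite [X in _ - X]ep; star_ring.
  rewrite nmZr ger0_norm ?invr_ge0 //.
  have := nb n.+1; have := nb n; rewrite -/p -/q => h1 h2.
  have -> : sqrt_dom n.+2 - sqrt_dom n.+1 =
    2^-1 * ((sqrt_dom n.+1 - sqrt_dom n) * (sqrt_dom n.+1 + sqrt_dom n)).
    by rewrite /=; ring.
  rewrite ler_pM2l ?invr_gt0 //; apply: le_trans (nmD _ _) _.
  have := nmM (p - q) p; have := nmM q (p - q).
  move: IH h1 h2 (nm_ge0 p) (nm_ge0 q) (nm_ge0 (p - q)).
  move: (nm _) (nm (_ ** p)) (nm (p - q)) (nm p) (nm q) (sqrt_dom n.+1) (sqrt_dom n).
  by move=> *; nra.
have hb n : sqrt_dom n <= 1 by case/andP: (sqrt_dom_bound n).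
have [l hl nl] := dominated_cvA hd hb.
have el : l = 2^-1 *:: (x + l ** l).
  apply: (cvA_unique (cvA_shift hl)); apply: cvAZ.
  by apply: cvAD; [apply: cvA_cst|apply: cvAM].
have e2 : l ** l = 2 *:: l - x.
  by rewrite {3}el; star_field.
exists (cone - l); split.
- apply: saD; first exact: sa1; apply: saN.
  apply: (cvA_unique (cvA_star hl)); apply: cvA_eq hl => n.
  elim: n => [|n IH] /=; first by rewrite cstar0.
  by rewrite cstarZr cstarD cstarM -IH sx.
- have -> : (cone - l) ** (cone - l) = cone - 2 *:: l + l ** l by star_ring.
  by rewrite e2; star_ring.
- by have := nl 0%N; rewrite /= !subr0 opprB addrC subrK.
- move=> w hw; apply: commD; first exact: comm1; apply: commN.
  have hc n : comm w (sqrt_seq x n).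
    elim: n => [|n IH] /=; first by rewrite /comm cmul0l cmul0r.
    by apply: commZ; apply: commD => //; apply: commM.
  apply: (cvA_unique (u := fun n => w ** sqrt_seq x n)).
    by apply: cvAM => //; apply: cvA_cst.
  apply: (@cvA_eq _ _ (fun n => sqrt_seq x n ** w)) => [n|]; first by rewrite -hc.
  by apply: cvAM => //; apply: cvA_cst.
Qed.

(* [w + i v] is [r] times a unitary, and [w] is its real part. *)
Lemma nm_le_of_sqr_sum w v r : sa w -> sa v -> comm w v -> 0 <= r ->
  w ** w + v ** v = (r ^+ 2) *:: cone -> nm w <= r.
Proof.
move=> sw sv cwv r0 h; set z := w + 'i%C *: v.
have nz : nm z <= r.
  have h2 : nm z ^+ 2 <= r ^+ 2.
    rewrite -nm_star_mul.
    have -> : z^# ** z = w ** w + v ** v.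
      rewrite /z -{3}sw -{3}sv.
      have := cwv; rewrite /comm => e.
      transitivity (w^# ** w + v^# ** v + 'i%C *: (w^# ** v - v^# ** w)); first by star_ring.
      by rewrite sw sv e subrr scaler0 addr0.
    by rewrite h; apply: le_trans (nmR _ _) _; rewrite ger0_norm // sqr_ge0.
  by rewrite -(ler_pXn2r (n:=2)) // nnegrE nm_ge0.
have zs : z^# = w - 'i%C *: v.
  by rewrite /z -[X in _ = X - _]sw -[X in _ = _ - _ *: X]sv; star_ring.
have -> : w = 2^-1 *:: (z + z^#) by rewrite zs /z; star_field.
rewrite nmZr ger0_norm ?invr_ge0 //.
by have := nmD z z^#; rewrite nm_star; lra.
Qed.

(** Being a self-adjoint square avoids any mention of the spectrum. That every [a^# ** a] is of this
    form is the content of [pos_star_mul]. *)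
Definition pos a := exists2 b, sa b & a = b ** b.

Lemma pos_sa a : pos a -> sa a.
Proof. by case=> b sb ->; apply: saM. Qed.

Lemma pos0 : pos 0.
Proof. by exists 0; rewrite ?cmul0l // /sa cstar0. Qed.

(** With [x = 1 - a/t] of norm at most 1, the root of [1 - x = a/t] times [sqrt t] squares to [a].
    The bound on [v] is the same norm criterion at [sqrt t], so that the root is itself positive. *)
Lemma pos_sqrtP a t : sa a -> 0 < t -> nm (t *:: cone - a) <= t ->
  exists v, [/\ sa v, a = v ** v, nm (Num.sqrt t *:: cone - v) <= Num.sqrt t &
    forall w, comm w a -> comm w v].
Proof.
move=> sa_a t0 h; set x := cone - t^-1 *:: a.
have sx : sa x by apply: saD; [exact: sa1|apply/saN/saZ].
have nx : nm x <= 1.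
  have -> : x = t^-1 *:: (t *:: cone - a).
    by rewrite /x; star_field.
  by rewrite nmZr ger0_norm ?invr_ge0 ?(ltW t0) // -(mulVf (lt0r_neq0 t0)) ler_pM2l ?invr_gt0.
have [y [sy ey ny cy]] := sqrt_one_sub sx nx.
exists (Num.sqrt t *:: y); split.
- exact: saZ.
- have -> : (Num.sqrt t *:: y) ** (Num.sqrt t *:: y) = (Num.sqrt t ^+ 2) *:: (y ** y).
    by star_ring.
  rewrite sqr_sqrtr ?(ltW t0) // ey /x.
  by star_field.
- rewrite -scalerBr nmZr ger0_norm ?sqrtr_ge0 //.
  by rewrite -[leRHS]mulr1 ler_wpM2l // sqrtr_ge0.
- move=> w hw; apply/commZ/cy; apply: commD; first exact: comm1.
  exact/commN/commZ.
Qed.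

(** Converse of the norm criterion. With [c = b / sqrt t] and [s] the root of [1 - c^2], the element
    [s + i c] is unitary, so [|s| <= 1], and [t - b^2 = t s^2]. *)
Lemma pos_nm_sub a t : pos a -> nm a <= t -> nm (t *:: cone - a) <= t.
Proof.
case=> b sb ->; rewrite nm_sqr // => hbt.
have t0 : 0 <= t by apply: le_trans hbt; apply: sqr_ge0.
have [t00|tp] := eqVneq t 0.
  have -> : b = 0.
    by apply: nm_eq0; move: hbt (nm_ge0 b); rewrite t00; nra.
  by rewrite cmul0l t00 scale0r subr0 nm0.
have {tp}tp : 0 < t by rewrite lt_neqAle eq_sym tp.
set x := t^-1 *:: (b ** b).
have sx : sa x by apply/saZ/saM.
have nx : nm x <= 1.
  by rewrite nmZr ger0_norm ?invr_ge0 // nm_sqr // -(mulVf (lt0r_neq0 tp)) ler_pM2l ?invr_gt0.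
have [s [ss es _ cs]] := sqrt_one_sub sx nx.
set c := (Num.sqrt t)^-1 *:: b.
have st0 : Num.sqrt t != 0 by rewrite gt_eqF // sqrtr_gt0.
have xc : c ** c = x.
  rewrite /c /x; transitivity (((Num.sqrt t) ^+ 2)^-1 *:: (b ** b)); last by rewrite sqr_sqrtr.
  by star_field.
have cc : comm s c.
  apply: comm_sym; apply: cs; rewrite -xc; apply: commM; rewrite /comm //.
have hs : nm s <= 1.
  apply: (@nm_le_of_sqr_sum s c) => //; first exact: saZ.
  by rewrite es xc subrK expr1n scale1r.
have -> : t *:: cone - b ** b = t *:: (s ** s).
  rewrite es /x; star_field.
rewrite nmZr ger0_norm // nm_sqr // -[leRHS]mulr1 ler_pM2l //.
by have := nm_ge0 s; nra.
Qed.

Lemma posP a t : sa a -> 0 < t -> nm (t *:: cone - a) <= t -> pos a.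
Proof. by move=> s t0 h; have [v [sv -> _ _]] := pos_sqrtP s t0 h; exists v. Qed.

Lemma pos_sqrt a : pos a ->
  exists v, [/\ pos v, a = v ** v & forall w, comm w a -> comm w v].
Proof.
move=> pa; have t0 : 0 < nm a + 1 by have := nm_ge0 a; lra.
have [|v [sv ev nv cv]] := pos_sqrtP (pos_sa pa) t0.
  by apply: pos_nm_sub => //; lra.
by exists v; split=> //; apply: posP nv; rewrite // sqrtr_gt0.
Qed.

(** The criterion [|t - a| <= t] is additive in the pair of [t] and [a], by the triangle inequality;
    the [+ 1] keeps the parameter positive. *)
Lemma posD a b : pos a -> pos b -> pos (a + b).
Proof.
move=> pa pb; apply: (@posP _ (nm a + nm b + 1)).
- by apply: saD; apply: pos_sa.
- by have := nm_ge0 a; have := nm_ge0 b; lra.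
have -> : (nm a + nm b + 1) *:: cone - (a + b) =
  ((nm a + 1) *:: cone - a) + (nm b *:: cone - b) by star_ring.
have := pos_nm_sub pa (_ : nm a <= nm a + 1); have := pos_nm_sub pb (lexx _).
move=> h1 h2; apply: le_trans (nmD _ _) _.
by have := h2 ltac:(lra); lra.
Qed.

Lemma posZ t a : 0 <= t -> pos a -> pos (t *:: a).
Proof.
move=> t0 [b sb ->]; exists (Num.sqrt t *:: b); first exact: saZ.
transitivity ((Num.sqrt t ^+ 2) *:: (b ** b)); first by rewrite sqr_sqrtr.
by star_ring.
Qed.

Lemma pos1 : pos cone.
Proof. by exists cone; [exact: sa1|rewrite cmul1a]. Qed.

Lemma pos_R t : 0 <= t -> pos (t *:: cone). Proof. by move/posZ; apply; apply: pos1. Qed.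

Lemma posM_comm a b : comm a b -> pos a -> pos b -> pos (a ** b).
Proof.
move=> cab /pos_sqrt[v [/pos_sa sv ev cv]] /pos_sqrt[w [/pos_sa sw ew cw]].
have cvb : comm b v by apply: cv; apply: comm_sym.
have cvw : comm v w by apply: cw; apply: comm_sym.
exists (v ** w); first exact: saM.
by rewrite ev ew !cmulA -(cmulA v w v) -cvw !cmulA.
Qed.

Lemma pos_nm_subr a t : pos a -> nm a <= t -> pos (t *:: cone - a).
Proof.
move=> pa h; have t0 : 0 <= t by apply: le_trans h; apply: nm_ge0.
have [t00|tp] := eqVneq t 0.
  have -> : a = 0 by apply: nm_eq0; move: h (nm_ge0 a); rewrite t00; lra.
  by rewrite subr0; apply: pos_R.
apply: (@posP _ t).
- by apply: saD; [apply/saZ/sa1|apply/saN/pos_sa].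
- by rewrite lt_neqAle eq_sym tp.
- by rewrite opprB addrC subrK.
Qed.

(** The commuting roots of [a = c^2] and [t - a = v^2] satisfy [c^2 + v^2 = t], so [c] is the real
    part of [sqrt t] times a unitary. *)
Lemma nm_le_R a t : pos a -> 0 <= t -> pos (t *:: cone - a) -> nm a <= t.
Proof.
move=> /pos_sqrt[c [/pos_sa sc ec cc]] t0 /pos_sqrt[v [/pos_sa sv ev cv]].
have cv' : comm c v.
  apply: cv; apply: commD; first exact/commZ/comm1.
  by apply: commN; rewrite ec; apply: commM.
have : nm c <= Num.sqrt t.
  apply: (nm_le_of_sqr_sum sc sv cv'); first by rewrite sqrtr_ge0.
  by rewrite -ev -ec sqr_sqrtr // addrC subrK.
rewrite ec nm_sqr // => h; rewrite -(sqr_sqrtr t0).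
by rewrite ler_pXn2r // nnegrE ?nm_ge0 // sqrtr_ge0.
Qed.

Definition leA a b := pos (b - a).

Lemma leA_trans b a c : leA a b -> leA b c -> leA a c.
Proof. by rewrite /leA => h1 h2; rewrite -(subrK b c) -addrA; apply: posD. Qed.

Lemma leA_refl a : leA a a.
Proof. by rewrite /leA subrr; apply: pos0. Qed.

Lemma nm_le a b : pos a -> leA a b -> nm a <= nm b.
Proof.
move=> pa ab; apply: nm_le_R => //; first exact: nm_ge0.
have pb : pos b by have := posD pa ab; rewrite addrC subrK.
have := posD (pos_nm_subr pb (lexx _)) ab.
by rewrite addrA subrK.
Qed.

(** [t^2 - h^2] is the product of the commuting positive elements [t - h] and [t + h], which bounds
    [|h^2| = |h|^2]. *)
Lemma nm_sa_le h t : sa h -> 0 <= t -> leA h (t *:: cone) -> leA (- h) (t *:: cone) ->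
  nm h <= t.
Proof.
rewrite /leA opprK => sh t0 h1 h2.
have c12 : comm (t *:: cone - h) (t *:: cone + h) by rewrite /comm; star_ring.
have : nm (h ** h) <= t ^+ 2.
  apply: nm_le_R; [by exists h|exact: sqr_ge0|].
  by have := posM_comm c12 h1 h2; rewrite [X in pos X](_ : _ = (t^+2) *:: cone - h ** h); last by star_ring.
by rewrite nm_sqr // => h3; rewrite -(ler_pXn2r (n := 2)) // nnegrE nm_ge0.
Qed.

(** The norm criterion is a closed condition once [t] is uniform, and [|l| + 1] eventually bounds
    [|u n|]. *)
Lemma pos_lim u l : (forall n, pos (u n)) -> cvA u l -> pos l.
Proof.
move=> pu hl.
have [N HN] := hl _ (ltr01 : 0 < 1 :> R).
set t := nm l + 1 + 1.
apply: (@posP _ t).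
- apply: (cvA_unique (cvA_star hl)); apply: cvA_eq hl => n; exact/esym/pos_sa.
- by rewrite /t; have := nm_ge0 l; lra.
apply: (@cvA_nm _ _ (fun n => t *:: cone - u n)).
  apply: cvAD; first exact: cvA_cst.
  apply: (@cvA_eq _ _ (fun n => -1 *: u n)) => [n|]; first by rewrite scaleN1r.
  by rewrite -(scaleN1r l); apply: cvAZ.
exists N => n /HN h; apply: pos_nm_sub => //.
rewrite -(subrK l (u n)); apply: le_trans (nmD _ _) _; rewrite /t; lra.
Qed.

Lemma pos_abs h : sa h ->
  exists k, [/\ pos k, k ** k = h ** h & forall w, comm w h -> comm w k].
Proof.
move=> sh; have [|k [pk ek ck]] := @pos_sqrt (h ** h); first by exists h.
by exists k; split=> // w hw; apply/ck/commM.
Qed.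

(* With [h = a^* a], [k = |h|], [y] the negative part of [h] and [c = a y k^(1/2)],
   one has [c^* c = - y^4 <= 0].  Since [c^* c + c c^* >= 0], also [B = c c^* >= 0],
   and [c (s + c^* c)^2 c^* = (s + B)^2 B >= 2 s B^2] with [s = |c|^2] forces [c = 0]. *)
Lemma pos_star_mul a : pos (a^# ** a).
Proof.
set h := a^# ** a; have sh : sa h by exact: sa_star_mul.
have [k [pk ek ck]] := pos_abs sh; have sk := pos_sa pk.
have [m [/pos_sa sm em cm]] := pos_sqrt pk.
have hk : h ** k = k ** h by apply: ck.
have kh : k ** h = h ** k by [].
have hm : h ** m = m ** h by apply: cm.
have km : k ** m = m ** k by apply: cm.
set y := 2^-1 *:: (k - h).
have sy : sa y by apply/saZ/saD => //; apply: saN.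
have hy : h ** y = - (k ** y).
  by rewrite /y !cmulZr !cmulDr !cmulNr hk ek -scalerN opprB.
have yk : y ** k = k ** y by rewrite /y cmulZl cmulZr cmulDl cmulDr cmulNl cmulNr hk.
have ym : y ** m = m ** y by rewrite /y cmulZl cmulZr cmulDl cmulDr cmulNl cmulNr hm km.
have yy : y ** y = k ** y.
  transitivity (4^-1 *:: (k ** k - k ** h - h ** k + h ** h)); first by rewrite /y; star_field.
  by rewrite hk -ek /y; star_field.
set q := k ** y; have sq : sa q by apply: saM => //; rewrite /comm yk.
set c := a ** y ** m.
have cc : c^# ** c = - (q ** q).
  have -> : c^# ** c = m ** (y ** (h ** y)) ** m by rewrite /c !cstarM sm sy /h !cmulA.
  rewrite hy cmulNr cmulNr cmulNl; congr (- _).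
  have mP : comm m (y ** (k ** y)) by do 2![apply: commM => //].
  by rewrite mP -cmulA -em -!cmulA yk (cmulA y k) yk -cmulA.
(* Real and imaginary parts of [c]: [c^# c + c c^# = 2 (c1^2 + c2^2)], and [c^# c = - q^2], so [B]
   is a sum of positive elements. *)
set c1 := 2^-1 *:: (c + c^#); set c2 := 'i%C *: (- 2^-1 *:: (c - c^#)).
have s1 : sa c1 by rewrite /sa /c1; star_ring.
have s2 : sa c2 by rewrite /sa /c2; star_ring.
set B := c ** c^#.
have eB : B = 2 *:: (c1 ** c1 + c2 ** c2) + q ** q.
  have -> : q ** q = - (c^# ** c) by rewrite cc opprK.
  by rewrite /c1 /c2 /B; star_field.
have pB : pos B.
  rewrite eB; apply: posD; last by exists q.
  by apply: posZ => //; apply: posD; [exists c1|exists c2].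
set s := nm c ^+ 2; have s0 : 0 <= s by apply: sqr_ge0.
have nq : nm (q ** q) = s by rewrite -nmN -cc nm_star_mul.
have nX : nm (s *:: cone + c^# ** c) <= s.
  by rewrite cc; apply: pos_nm_sub; [exists q|rewrite nq].
have nB : nm B = s by rewrite /B -{1}(cstarK c) nm_star_mul nm_star.
have sB := pos_sa pB.
have le1 : leA (2 * s *:: (B ** B))
    (c ** (s *:: cone + c^# ** c) ** (s *:: cone + c^# ** c) ** c^#).
  rewrite /leA; have -> : c ** (s *:: cone + c^# ** c) ** (s *:: cone + c^# ** c) ** c^#
     - 2 * s *:: (B ** B) = s ^+ 2 *:: B + B ** B ** B by rewrite /B; star_ring.
  apply: posD; first by apply: posZ => //; apply: sqr_ge0.
  by apply: posM_comm => //; [rewrite /comm cmulA|exists B].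
have p1 : pos (2 * s *:: (B ** B)) by apply: posZ; [rewrite mulr_ge0|exists B].
have h1 := nm_le p1 le1.
(* In [le1] the left side has norm [2 s^3], the right side at most [|c| s s |c| = s^3]. *)
have s3 : s = 0.
  have s20 : 0 <= 2 * s := mulr_ge0 (ler0n _ 2) s0.
  move: h1; rewrite nmZr (ger0_norm s20) nm_sqr // nB => h1.
  have h2 := nmM (c ** (s *:: cone + c^# ** c) ** (s *:: cone + c^# ** c)) c^#.
  have h3 := nmM (c ** (s *:: cone + c^# ** c)) (s *:: cone + c^# ** c).
  have h4 := nmM c (s *:: cone + c^# ** c).
  rewrite nm_star in h2; have nc := nm_ge0 c; have nX0 := nm_ge0 (s *:: cone + c^# ** c).
  have b1 : nm (c ** (s *:: cone + c^# ** c)) <= nm c * s.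
    by apply: le_trans h4 _; rewrite ler_wpM2l.
  have b2 : nm (c ** (s *:: cone + c^# ** c) ** (s *:: cone + c^# ** c)) <= nm c * s * s.
    by apply: le_trans h3 _; apply: ler_pM; rewrite ?nm_ge0.
  have {h1 h2} : 2 * s * s ^+ 2 <= nm c * s * s * nm c.
    by apply: le_trans h1 _; apply: le_trans h2 _; rewrite ler_wpM2r.
  have -> : nm c * s * s * nm c = s ^+ 3 by rewrite /s; ring.
  rewrite (_ : 2 * s * s ^+ 2 = 2 * s ^+ 3); last by ring.
  move=> h5; have s3 : 0 <= s ^+ 3 by rewrite exprn_ge0.
  have /eqP : s ^+ 3 = 0 by lra.
  by rewrite expf_eq0 => /andP[_ /eqP].
have q0 : q = 0 by apply: nm_eq0; move: nq; rewrite nm_sqr // s3 => /eqP; rewrite sqrf_eq0 => /eqP.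
have y0 : y = 0.
  by apply: nm_eq0; have := nm_sqr sy; rewrite yy -/q q0 nm0 => /esym/eqP; rewrite sqrf_eq0 => /eqP.
have -> : h = k - 2 *:: y by rewrite /y; star_field.
by rewrite y0 scaler0 subr0.
Qed.

Lemma pos_conj a p : pos p -> pos (a^# ** p ** a).
Proof.
case=> b sb ->; have -> : a^# ** (b ** b) ** a = (b ** a)^# ** (b ** a).
  by rewrite cstarM sb !cmulA.
exact: pos_star_mul.
Qed.

Lemma leA_conj a p q : leA p q -> leA (a^# ** p ** a) (a^# ** q ** a).
Proof. by rewrite /leA -cmulNl -cmulNr -cmulDl -cmulDr => /(pos_conj a). Qed.

Lemma leA_R s t : s <= t -> leA (s *:: cone) (t *:: cone).
Proof. by rewrite /leA -scalerBl -rmorphB -subr_ge0; apply: pos_R. Qed.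

Lemma leA_nm a : pos a -> leA a (nm a *:: cone).
Proof. by move=> pa; apply: pos_nm_subr. Qed.

Lemma pos_eps a : (forall e, 0 < e -> pos (a + e *:: cone)) -> pos a.
Proof.
move=> h; apply: (@pos_lim (fun n => a + (n.+1%:R)^-1 *:: cone)) => [n|].
  by apply: h; rewrite invr_gt0.
rewrite -[X in cvA _ X]addr0; apply: cvAD; first exact: cvA_cst.
move=> e e0; have e1 : 0 < e^-1 by rewrite invr_gt0.
exists (Num.truncn e^-1) => n hn; rewrite subr0; apply: le_trans (nmR _ _) _.
rewrite ger0_norm ?invr_ge0 // invf_ple ?posrE //.
apply: ltW; apply: lt_le_trans (truncnS_gt _) _; by rewrite ler_nat ltnS.
Qed.

Fixpoint neumann_seq x n : A := if n is n'.+1 then cone + x ** neumann_seq x n' else 0.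

Lemma inv_one_sub x : nm x < 1 ->
  exists i, [/\ (cone - x) ** i = cone, i ** (cone - x) = cone,
    nm i <= (1 - nm x)^-1 & forall w, comm w x -> comm w i].
Proof.
move=> nx; set r := nm x; have r0 : 0 <= r by exact: nm_ge0.
have r1 : 0 < 1 - r by rewrite subr_gt0.
pose d n := (1 - r ^+ n) / (1 - r).
have hd n : nm (neumann_seq x n.+1 - neumann_seq x n) <= d n.+1 - d n.
  have -> : d n.+1 - d n = r ^+ n by rewrite /d exprS; field; rewrite gt_eqF.
  elim: n => [|n IH]; first by rewrite /= cmul0r addr0 subr0 expr0 nm1_le1.
  have -> : neumann_seq x n.+2 - neumann_seq x n.+1 =
      x ** (neumann_seq x n.+1 - neumann_seq x n).
    set p := neumann_seq x n.+1; have ep : p = cone + x ** neumann_seq x n by [].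
    transitivity ((cone + x ** p) - (cone + x ** neumann_seq x n)).
      by rewrite -ep.
    by star_ring.
  by apply: le_trans (nmM _ _) _; rewrite exprS ler_wpM2l.
have hb n : d n <= (1 - r)^-1.
  by rewrite /d ler_piMl ?invr_ge0 ?(ltW r1) // gerBl exprn_ge0.
have [i hi ni] := dominated_cvA hd hb.
have ei : i = cone + x ** i.
  apply: (cvA_unique (cvA_shift hi)); apply: cvAD; first exact: cvA_cst.
  by apply: cvAM => //; apply: cvA_cst.
have ci w : comm w x -> comm w i.
  move=> hw; have hc n : comm w (neumann_seq x n).
    elim: n => [|n IH] /=; first by rewrite /comm cmul0l cmul0r.
    by apply: commD; [exact: comm1|apply: commM].
  apply: (cvA_unique (u := fun n => w ** neumann_seq x n)).
    by apply: cvAM => //; apply: cvA_cst.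
  apply: (@cvA_eq _ _ (fun n => neumann_seq x n ** w)) => [n|]; first by rewrite -hc.
  by apply: cvAM => //; apply: cvA_cst.
have e1 : (cone - x) ** i = cone by rewrite cmulDl cmul1a cmulNl {1}ei addrK.
exists i; split=> //.
  rewrite cmulDr cmula1 cmulNr -(ci x); last by [].
  by rewrite -[in X in X - _](cmul1a i) -cmulNl -cmulDl.
by have := ni 0%N; rewrite /= subr0 /d expr0 subrr mul0r subr0.
Qed.

(** Dividing by [T = |q| + e] gives [(q + e)/T = 1 - x] with [|x| <= |q|/T = 1 - e/T]. The Neumann
    series then has norm at most [T/e], which rescales to the sharp bound [1/e]. *)
Lemma inv_pos q e : pos q -> 0 < e ->
  exists i, [/\ sa i, (q + e *:: cone) ** i = cone, i ** (q + e *:: cone) = cone,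
    nm i <= e^-1 & forall w, comm w q -> comm w i].
Proof.
move=> pq e0; set T := nm q + e; have T0 : 0 < T by rewrite ltr_wpDl ?nm_ge0.
set x := T^-1 *:: (nm q *:: cone - q).
have nx : nm x <= nm q / T.
  rewrite nmZr ger0_norm ?invr_ge0 ?(ltW T0) // mulrC ler_pM2r ?invr_gt0 //.
  by apply: pos_nm_sub.
have nx1 : 1 - nm x >= e / T.
  have : 1 = nm q / T + e / T by rewrite -mulrDl divff // gt_eqF.
  by lra.
have [|j [e1 e2 nj cj]] := @inv_one_sub x.
  by have : 0 < e / T by [rewrite divr_gt0]; lra.
have ex : cone - x = T^-1 *:: (q + e *:: cone).
  by rewrite /x /T; star_field.
exists (T^-1 *:: j); have E1 : (q + e *:: cone) ** (T^-1 *:: j) = cone.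
  by rewrite cmulZr -cmulZl -ex.
have E2 : (T^-1 *:: j) ** (q + e *:: cone) = cone by rewrite cmulZl -cmulZr -ex.
split=> //.
- have E3 : (T^-1 *:: j)^# ** (q + e *:: cone) = cone.
    have sq : sa (q + e *:: cone) by apply: saD; [exact: pos_sa|apply/saZ/sa1].
    by rewrite -[X in _ ** X]sq -cstarM E1 cstar1.
  by rewrite /sa -[LHS]cmula1 -E1 cmulA E3 cmul1a.
- rewrite nmZr ger0_norm ?invr_ge0 ?(ltW T0) //.
  have : nm j <= T / e.
    apply: le_trans nj _; rewrite -[T / e]invrK invf_div.
    rewrite lef_pV2 // posrE ?divr_gt0 //; apply: lt_le_trans nx1; exact: divr_gt0.
  move=> h; rewrite mulrC ler_pdivrMr // mulrC; by rewrite mulrC in h *.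
- by move=> w hw; apply/commZ/cj/commZ/commD; [apply/commZ/comm1|apply/commN].
Qed.

(* Testing the hypothesis on [a = (q + e)^(-1/2)]. *)
Lemma leA_of_nm p q : pos p -> pos q ->
  (forall a, nm (a^# ** p ** a) <= nm (a^# ** q ** a)) -> leA p q.
Proof.
move=> pp pq h; apply: pos_eps => e e0.
have [i [si e1 e2 _ ci]] := inv_pos pq e0.
have pe : pos (q + e *:: cone) by apply: posD => //; apply/pos_R/ltW.
have [s [/pos_sa ss es cs]] := pos_sqrt pe.
have sq : comm s q.
  have : comm s (q + e *:: cone) by rewrite es /comm cmulA.
  move=> c; have := commD c (commN (commZ (real_complex _ e) (comm1 s))).
  by rewrite addrK.
have si' : comm s i by apply: ci.
set a := s ** i; have ra : sa a by apply: saM.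
have sa1' : s ** a = cone by rewrite /a cmulA -es.
have as1 : a ** s = cone by rewrite /a -cmulA -si' cmulA -es.
move: a ra sa1' as1 => a ra sa1' as1.
have n1 : nm (a^# ** q ** a) <= 1.
  apply: nm_le_R => //; first exact: pos_conj.
  have -> : 1 *:: cone - a^# ** q ** a = e *:: (a^# ** a).
    transitivity (a^# ** (q + e *:: cone) ** a - a^# ** q ** a); last by star_ring.
    by rewrite es ra !cmulA as1 cmul1a sa1' scale1r.
  by apply: posZ; [exact: ltW|exact: pos_star_mul].
have := pos_nm_subr (pos_conj a pp) (le_trans (h a) n1).
move=> /(pos_conj s); rewrite ss.
have -> : s ** (1 *:: cone - a^# ** p ** a) ** s = s ** s - (s ** a^#) ** p ** (a ** s).
  by star_ring.
by rewrite ra sa1' as1 cmul1a cmula1 -es addrAC.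
Qed.

(** [u = h + i sqrt (1 - h^2)]. This reduces multiplication by arbitrary elements to multiplication
    by unitaries in [L_mull]. *)
Lemma unitary_re h : sa h -> nm h <= 1 ->
  exists u : A, [/\ u^# ** u = cone, u ** u^# = cone & h = 2^-1 *:: (u + u^#)].
Proof.
move=> sh nh.
have [|v [pv ev cv]] := @pos_sqrt (1 *:: cone - h ** h).
  apply: pos_nm_subr; first by exists h.
  by rewrite nm_sqr //; have := nm_ge0 h; nra.
have sv := pos_sa pv.
have hv : h ** v = v ** h.
  apply: cv; rewrite /comm; star_ring.
exists (h + 'i%C *: v).
have -> : (h + 'i%C *: v)^# = h - 'i%C *: v.
  by rewrite -[X in _ = X - _]sh -[X in _ = _ - _ *: X]sv; star_ring.
have e1 : v ** v = cone - h ** h by rewrite -ev scale1r.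
split.
- transitivity (h ** h + v ** v + 'i%C *: (h ** v - v ** h)); first by star_ring.
  by rewrite hv subrr scaler0 addr0 e1 addrC subrK.
- transitivity (h ** h + v ** v - 'i%C *: (h ** v - v ** h)); first by star_ring.
  by rewrite hv subrr scaler0 subr0 e1 addrC subrK.
- by star_field.
Qed.

Lemma nm_unitary (u : A) : u^# ** u = cone -> nm u <= 1.
Proof.
move=> hu; have := nm_star_mul u; rewrite hu; have := nm1_le1 A; have := nm_ge0 u.
by move=> *; nra.
Qed.

End CStarPositive.

(** * Roots of unity and unitary elements *)

Section RootsOfUnity.
Variable R : realType.

Lemma de_moivre (a : R) n :
  (cos a +i* sin a)%C ^+ n = (cos (a *+ n) +i* sin (a *+ n))%C.
Proof.
elim: n => [|n IH]; first by rewrite expr0 mulr0n cos0 sin0.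
by rewrite exprSr IH mulrSr cosD sinD; congr (_ +i* _)%C; rewrite addrC.
Qed.

(** [exp (2 i pi / n)] works: if its order [m] were below [n], then [cos (2 pi m / n) = 1] would
    force [sin (pi m / n) = 0], although [0 < pi m / n < pi]. *)
Lemma prim_root_exists n : (0 < n)%N -> exists z : R[i], n.-primitive_root z.
Proof.
move=> n0; have n0R : (0 : R) < n%:R by rewrite ltr0n.
have [h h0 hn] : exists2 h : R, 0 < h & h *+ n = pi.
  by exists (pi / n%:R); rewrite ?divr_gt0 ?pi_gt0 // -[_ *+ n]mulr_natr divfK ?gt_eqF.
pose z : R[i] := (cos (h *+ 2) +i* sin (h *+ 2))%C.
have zn : z ^+ n = 1.
  by rewrite /z de_moivre mulrnAC hn cos2pi sin2pi.
have [m pm mn] := prim_order_exists n0 zn; exists z.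
have := dvdn_leq n0 mn; rewrite leq_eqVlt => /orP[/eqP <- //|lt_mn].
have := prim_expr_order pm; rewrite /z de_moivre mulrnAC => -[+ _].
move=> e; rewrite cos_mulr2n in e.
have hm0 : 0 < h *+ m.
  by rewrite -mulr_natr; apply: mulr_gt0; rewrite ?ltr0n ?(prim_order_gt0 pm).
have hm1 : h *+ m < pi.
  by rewrite -hn -subr_gt0 -mulrnBr ?(ltnW lt_mn) // pmulrn_lgt0 // subn_gt0.
have s0 : 0 < sin (h *+ m) by apply: sin_gt0_pi; apply/andP.
have : sin (h *+ m) ^+ 2 = 0 by rewrite sin2cos2; lra.
by move/eqP; rewrite sqrf_eq0 gt_eqF.
Qed.

Lemma unity_root_conj n (w : R[i]) : (0 < n)%N -> w ^+ n = 1 -> w * w^* = 1.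
Proof.
move=> n0 wn; rewrite -normCK; have : `|w| ^+ n = 1 by rewrite -normrX wn normr1.
by move/eqP; rewrite pexpr_eq1 // => /eqP ->; rewrite expr1n.
Qed.

Lemma unity_root_orth n (w : R[i]) a b : n.-primitive_root w -> (a < n)%N -> (b < n)%N ->
  \sum_(j < n) (w ^+ j) ^+ a * ((w ^+ j)^*) ^+ b = (n * (a == b))%:R.
Proof.
move=> pw an bn; have n0 := prim_order_gt0 pw.
have ww : w * w^* = 1 := unity_root_conj n0 (prim_expr_order pw).
set ze := w ^+ a * (w^*) ^+ b.
under eq_bigr => j _.
  rewrite rmorphXn /= -!exprM !(mulnC j) !exprM -exprMn -/ze; over.
have [ab'|ab] := eqVneq a b.
  have z1 : (w ^+ b * w^* ^+ b) = 1 by rewrite -exprMn ww expr1n.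
  rewrite muln1; transitivity (\sum_(j < n) (1 : R[i])).
    by apply: eq_bigr => j _; rewrite /ze ab' z1 expr1n.
  by rewrite sumr_const card_ord.
rewrite muln0; have wn := prim_expr_order pw.
have zn : ze ^+ n = 1.
  by rewrite /ze exprMn -!exprM !(mulnC _ n) !exprM -rmorphXn /= wn conjC1 !expr1n mulr1.
have z1 : ze != 1.
  apply: contra_neq ab => z1; apply/eqP; rewrite -(modn_small an) -(modn_small bn).
  rewrite -(eq_prim_root_expr pw); apply/eqP.
  by rewrite -[LHS]mulr1 -(expr1n _ b) -ww exprMn (mulrC (w ^+ b)) mulrA -/ze z1 mul1r.
have := subrX1 ze n; rewrite zn subrr => /esym/eqP; rewrite mulf_eq0 subr_eq0 (negPf z1) /=.
by move/eqP.
Qed.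

End RootsOfUnity.

Section Unitary.
Variables (R : realType) (A : cstarAlgType R).
Implicit Types (u v a : A).

Fixpoint cpow u n : A := if n is n'.+1 then u ** cpow u n' else cone.

Definition unitary u := u^# ** u = cone /\ u ** u^# = cone.

Lemma cpowD u m n : cpow u (m + n) = cpow u m ** cpow u n.
Proof. by elim: m => [|m IH]; rewrite ?cmul1a // addSn /= IH cmulA. Qed.

Lemma cpowZ (c : R[i]) u n : cpow (c *: u) n = c ^+ n *: cpow u n.
Proof.
elim: n => [|n IH]; first by rewrite scale1r.
by rewrite /= IH cmulZl cmulZr scalerA exprS.
Qed.

Lemma cpow_unitary u n : u^# ** u = cone -> (cpow u n)^# ** cpow u n = cone.
Proof.
move=> hu; elim: n => [|n IH] /=; first by rewrite cstar1 cmul1a.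
by rewrite cstarM -cmulA (cmulA u^#) hu cmul1a.
Qed.

Lemma comm_cpow a u n : comm a u -> comm a (cpow u n).
Proof. by move=> h; elim: n => [|n IH] /=; [exact: comm1|apply: commM]. Qed.

Lemma comm_sum a (I : Type) (s : seq I) (F : I -> A) :
  (forall i, comm a (F i)) -> comm a (\sum_(i <- s) F i).
Proof.
move=> h; rewrite /comm cmul_sumr cmul_suml; apply: eq_bigr => i _; exact: h.
Qed.

Lemma comm_star a b : comm a b^# -> comm a^# b.
Proof. by rewrite /comm => /(congr1 cstar); rewrite !cstarM cstarK => ->. Qed.

(** [F ** (v - cone)] telescopes to [(v^N - 1)/N], so [F] concentrates at the spectral value 1 of
    [v]. Up to a scalar, [F^# F] is the Fejer kernel evaluated at [v]. *)
Lemma fejer v N : unitary v -> (0 < N)%N ->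
  let F := N%:R^-1 *:: \sum_(k < N) cpow v k in
  [/\ nm F <= 1, nm (F ** (v - cone)) <= 2 / N%:R & comm F^# F].
Proof.
move=> [v1 v2] N0 F; have N0' : 0 < N%:R :> R by rewrite ltr0n.
have Ni : 0 <= N%:R^-1 :> R by rewrite invr_ge0 ltW.
have nv n : nm (cpow v n) <= 1 by apply/nm_unitary/cpow_unitary.
split.
- rewrite nmZr ger0_norm // ler_pdivrMl // mulr1; apply: le_trans (nm_sum _ _ _) _.
  apply: (@le_trans _ _ (\sum_(k < N) 1)); first by apply: ler_sum => k _.
  by rewrite sumr_const card_ord.
- have -> : F ** (v - cone) = N%:R^-1 *:: (cpow v N - cone).
    rewrite cmulZl; congr (_ *: _); elim: N {N0 F N0' Ni} => [|N IH].
      by rewrite big_ord0 cmul0l subrr.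
    rewrite big_ord_recr /= cmulDl IH.
    have -> : v ** cpow v N = cpow v N ** v.
      by apply: comm_cpow.
    by star_ring.
  rewrite nmZr ger0_norm // mulrC ler_pM2r ?invr_gt0 //.
  by apply: le_trans (nmB _ _) _; have := nv N; have := nm1_le1 A; lra.
- have cvv k l : comm (cpow v k)^# (cpow v l).
    apply: comm_cpow; apply: comm_star; apply: comm_sym; apply: comm_cpow.
    by rewrite /comm v1 v2.
  rewrite /F cstarZr cstar_sum; apply: commZ; apply: comm_sum => l.
  apply: comm_sym; apply: commZ; apply: comm_sum => k; apply: comm_sym; exact: cvv.
Qed.

(* Parseval's identity for [theta |-> \sum_t theta^(deg t) u^(deg t)] sampled at
   the n-th roots of unity. *)
Lemma parseval n (w : R[i]) (T : finType) (deg : T -> nat) u :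
  n.-primitive_root w -> (forall t, deg t < n)%N -> u^# ** u = cone ->
  let P j := \sum_(t : T) (w ^+ j)^* ^+ deg t *: cpow u (deg t) in
  \sum_(j < n) (P j)^# ** P j = (n * \sum_(s : T) \sum_(t : T) (deg s == deg t))%:R *: cone.
Proof.
move=> pw hd hu P.
transitivity (\sum_(j < n) \sum_(s : T) \sum_(t : T)
    ((w ^+ j) ^+ deg s * (w ^+ j)^* ^+ deg t) *: ((cpow u (deg s))^# ** cpow u (deg t))).
  apply: eq_bigr => j _; rewrite cstar_sum cmul_suml; apply: eq_bigr => s _.
  rewrite cmul_sumr; apply: eq_bigr => t _.
  rewrite cstarZ cmulZl cmulZr scalerA; congr (_ * _ *: _).
  by rewrite rmorphXn /= conjCK.
rewrite exchange_big /= big_distrr /= natr_sum scaler_suml; apply: eq_bigr => s _.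
rewrite exchange_big /= big_distrr /= natr_sum scaler_suml; apply: eq_bigr => t _.
rewrite -scaler_suml (unity_root_orth pw) //.
by have [->|] := eqVneq (deg s) (deg t); rewrite ?cpow_unitary // muln0 !scale0r.
Qed.

(** Cauchy-Schwarz for the sizes of the fibres of [deg], read off from the scalar Parseval identity
    by keeping only the term [j = 0], where the sum is [#|T|]. *)
Lemma card_coincidences n (T : finType) (deg : T -> nat) :
  (0 < n)%N -> (forall t, deg t < n)%N ->
  (#|T| ^ 2 <= n * \sum_(s : T) \sum_(t : T) (deg s == deg t))%N.
Proof.
move=> n0 hd; have [w pw] := prim_root_exists R n0.
pose P j : R[i] := \sum_(t : T) (w ^+ j)^* ^+ deg t.
have e : \sum_(j < n) `|P j| ^+ 2 = (n * \sum_(s : T) \sum_(t : T) (deg s == deg t))%:R.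
  transitivity (\sum_(j < n) \sum_(s : T) \sum_(t : T)
      ((w ^+ j) ^+ deg s * (w ^+ j)^* ^+ deg t)).
    apply: eq_bigr => j _; rewrite normCK mulrC rmorph_sum /= big_distrl /=.
    apply: eq_bigr => s _; rewrite big_distrr /=; apply: eq_bigr => t _.
    by rewrite rmorphXn /= conjCK.
  rewrite exchange_big /= big_distrr /= natr_sum; apply: eq_bigr => s _.
  rewrite exchange_big /= big_distrr /= natr_sum; apply: eq_bigr => t _.
  by rewrite (unity_root_orth pw).
rewrite -(ler_nat R[i]) -e (bigD1 (Ordinal n0)) //= natrX.
have -> : P 0%N = #|T|%:R.
  rewrite /P; under eq_bigr => t _ do rewrite expr0 rmorph1 expr1n.
  by rewrite sumr_const.
by rewrite normr_nat lerDl sumr_ge0 // => j _; rewrite exprn_ge0.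
Qed.

End Unitary.

(** * Contractive generalized limits are module maps *)

Section GeneralizedLimit.
Variables (R : realType) (A : cstarAlgType R).
Implicit Types (a b c z : A) (u v x : nat -> A) (r t : R).

Definition bdd u := exists C : R, forall n, nm (u n) <= C.

(** A projection of norm one from the bounded sequences onto the constants. The second clause asks
    only for an eventual bound, so that [L] kills null sequences ([L_null]). *)
Definition gen_limit (L : (nat -> A) -> A) : Prop :=
  [/\ forall (k : R[i]) u v, bdd u -> bdd v -> L (fun n => k *: u n + v n) = k *: L u + L v,
      forall u (C : R), bdd u -> (exists N, forall n, (N <= n)%N -> nm (u n) <= C) ->
        nm (L u) <= C &
      forall a, L (fun=> a) = a].

Lemma bddD u v : bdd u -> bdd v -> bdd (fun n => u n + v n).
Proof.
by move=> [C hC] [D hD]; exists (C + D) => n; apply: le_trans (nmD _ _) _; apply: lerD.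
Qed.

Lemma bdd_cst a : bdd (fun=> a). Proof. by exists (nm a). Qed.

Lemma bddM u v : bdd u -> bdd v -> bdd (fun n => u n ** v n).
Proof.
move=> [C hC] [D hD]; exists (C * D) => n; apply: le_trans (nmM _ _) _.
by apply: ler_pM; rewrite ?nm_ge0.
Qed.

Lemma bddZ (k : R[i]) u : bdd u -> bdd (fun n => k *: u n).
Proof.
move=> [C hC]; exists (complex.Re `|k| * C) => n; rewrite nmZ ler_wpM2l //.
by have := normr_ge0 k; rewrite lecE => /andP[].
Qed.

Lemma bdd_star u : bdd u -> bdd (fun n => (u n)^#).
Proof. by move=> [C hC]; exists C => n; rewrite nm_star. Qed.

Variables (L : (nat -> A) -> A) (hL : gen_limit L).

Lemma LD u v : bdd u -> bdd v -> L (fun n => u n + v n) = L u + L v.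
Proof.
move=> bu bv; case: hL => h _ _; rewrite -[X in X + _](scale1r (L u)) -h //; congr L.
by apply/funext => n; rewrite scale1r.
Qed.

Lemma L_cst a : L (fun=> a) = a. Proof. by case: hL. Qed.

Lemma LZ (k : R[i]) u : bdd u -> L (fun n => k *: u n) = k *: L u.
Proof.
move=> bu; case: hL => h _ _; rewrite -[RHS]addr0 -[X in _ + X]L_cst -h //; last exact: bdd_cst.
by congr L; apply/funext => n; rewrite addr0.
Qed.

Lemma L_le u C : (forall n, nm (u n) <= C) -> nm (L u) <= C.
Proof. by move=> h; case: hL => _ h2 _; apply: h2; [exists C|exists 0%N]. Qed.

Lemma L_null u : bdd u -> cvA u 0 -> L u = 0.
Proof.
move=> bu hu; case: hL => _ h2 _; apply/nm_eq0/eqP; rewrite eq_le nm_ge0 andbT.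
apply/ler_addgt0Pr => e /hu[N HN]; rewrite add0r; apply: h2 => //.
by exists N => n /HN; rewrite subr0.
Qed.

Lemma L_eq u v : u =1 v -> L u = L v. Proof. by move=> /funext ->. Qed.

Lemma L_sum (I : Type) (s : seq I) (f : I -> nat -> A) :
  (forall i, bdd (f i)) -> L (fun n => \sum_(i <- s) f i n) = \sum_(i <- s) L (f i).
Proof.
move=> hf; have hb (s' : seq I) : bdd (fun n => \sum_(i <- s') f i n).
  elim: s' => [|i s' IH].
    by exists 0 => n; rewrite big_nil nm0.
  have [C hC] := bddD (hf i) IH; exists C => n; by rewrite big_cons.
elim: s => [|i s IH]; first by rewrite big_nil -[RHS]L_cst; apply: L_eq => n; rewrite big_nil.
by rewrite big_cons -IH -LD //; apply: L_eq => n; rewrite big_cons.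
Qed.

(* If [L u = p + i q] with [u] self-adjoint, then [|q + t|^2 <= |u|^2 + t^2] for
   all real [t], which forces [q = 0]. *)
Lemma L_sa u : bdd u -> (forall n, sa (u n)) -> sa (L u).
Proof.
move=> bu su; case: (bu) => C0 hC0.
set C := 1 + C0 ^+ 2; have C_gt0 : 0 < C by rewrite ltr_pwDl // sqr_ge0.
set k := L u; set q := - 2^-1 *:: ('i%C *: (k - k^#)).
have sq : sa q by rewrite /sa /q; star_ring.
have hq t : nm (q + t *:: cone) ^+ 2 <= C + t ^+ 2.
  apply: (@le_trans _ _ (nm (k + 'i%C *: (t *:: cone)) ^+ 2)).
    rewrite ler_pXn2r // ?nnegrE ?nm_ge0 //.
    set w := k + _; have -> : q + t *:: cone = - 2^-1 *:: ('i%C *: (w - w^#)).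
      by rewrite /q /w; star_field.
    rewrite nmZr nmZi normrN ger0_norm ?invr_ge0 //.
    by have := nmB w w^#; rewrite nm_star; lra.
  have -> : k + 'i%C *: (t *:: cone) = L (fun n => u n + 'i%C *: (t *:: cone)).
    by rewrite LD ?L_cst //; apply: bdd_cst.
  have h n : nm (u n + 'i%C *: (t *:: cone)) ^+ 2 <= C + t ^+ 2.
    rewrite -nm_star_mul.
    have -> : (u n + 'i%C *: (t *:: cone))^# ** (u n + 'i%C *: (t *:: cone)) =
        u n ** u n + t ^+ 2 *:: cone.
      transitivity ((u n)^# ** u n + t *:: ('i%C *: ((u n)^# - u n)) + t ^+ 2 *:: cone).
        by star_ring.
      by rewrite su subrr !scaler0 addr0.
    apply: le_trans (nmD _ _) _; apply: lerD.
      rewrite nm_sqr // /C; have := hC0 n; have := nm_ge0 (u n); nra.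
    by apply: le_trans (nmR _ _) _; rewrite ger0_norm // sqr_ge0.
  have hs : 0 <= C + t ^+ 2 by rewrite addr_ge0 ?sqr_ge0 // ltW.
  rewrite -(sqr_sqrtr hs) ler_pXn2r // ?nnegrE ?nm_ge0 ?sqrtr_ge0 //.
  apply: L_le => n; rewrite -(ler_pXn2r (n := 2)) // ?nnegrE ?nm_ge0 ?sqrtr_ge0 //.
  by rewrite sqr_sqrtr.
have pq t : pos (C *:: cone - (2 * t) *:: q).
  have sqt : sa (q + t *:: cone) by apply: saD => //; apply/saZ/sa1.
  have p1 : pos ((q + t *:: cone) ** (q + t *:: cone)) by exists (q + t *:: cone).
  have := pos_nm_subr p1 (t := C + t ^+ 2); rewrite nm_sqr // => /(_ (hq t)).
  have p2 : pos (q ** q) by exists q.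
  move=> /posD /(_ p2); congr pos; star_ring.
have q0 : q = 0.
  apply/nm_eq0/eqP; rewrite eq_le nm_ge0 andbT; apply/ler_addgt0Pr => e e0; rewrite add0r.
  (* At [t = C/(2e)] and at its opposite, [pq] scaled by [e/C] reads [e - q >= 0] and
     [e + q >= 0]. *)
  have ek : 0 <= e / C by rewrite divr_ge0 // ltW.
  apply: nm_sa_le => //; first exact: ltW.
    rewrite /leA; have := posZ ek (pq (C / (2 * e))); congr pos.
    by star_ring_with ltac:(first [ring | field; rewrite ?gt_eqF //]).
  rewrite /leA; have := posZ ek (pq (- (C / (2 * e)))); congr pos.
  by star_ring_with ltac:(first [ring | field; rewrite ?gt_eqF //]).
rewrite /sa; apply/eqP; rewrite eq_sym -subr_eq0; apply/eqP.
have -> : k - k^# = (- 2) *:: (- 'i%C *: q) by rewrite /q scaleNr; star_field.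
by rewrite q0 !scaler0.
Qed.

Lemma L_star u : bdd u -> L (fun n => (u n)^#) = (L u)^#.
Proof.
move=> bu; have bs := bdd_star bu.
pose u1 n := 2^-1 *:: (u n + (u n)^#).
pose u2 n := - 2^-1 *:: ('i%C *: (u n - (u n)^#)).
have b1 : bdd u1 by apply/bddZ/bddD.
have b2 : bdd u2.
  by do 2!apply: bddZ; apply: bddD => //; have [C hC] := bs; exists C => n; rewrite nmN.
have s1 n : sa (u1 n) by rewrite /sa /u1; star_ring.
have s2 n : sa (u2 n) by rewrite /sa /u2; star_ring.
have e1 n : u n = u1 n + 'i%C *: u2 n by rewrite /u1 /u2; star_field.
have e2 n : (u n)^# = u1 n + (- 'i%C) *: u2 n by rewrite /u1 /u2 scaleNr; star_field.
move: u1 u2 b1 b2 s1 s2 e1 e2 => u1 u2 b1 b2 s1 s2 e1 e2.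
rewrite (L_eq e2) (L_eq e1) !LD ?LZ //; try exact: bddZ.
rewrite -[in LHS](L_sa b1 s1) -[in LHS](L_sa b2 s2) scaleNr.
by star_ring.
Qed.

(* Compares [|z + m d|] for [d = F^* F z] with the norms of [D x_n + m d] as
   [m] tends to infinity. *)
Lemma peak_estimate (D F : A) x (C kap : R) :
  (forall n, nm (x n) <= C) -> nm F <= 1 -> 0 < kap -> nm (F ** D) ^+ 2 <= kap ->
  nm (F^# ** F ** L (fun n => D ** x n)) ^+ 2 <= kap * C ^+ 2.
Proof.
move=> hx nF k0 hk; set z := L _.
have C0 : 0 <= C by apply: le_trans (hx 0%N); exact: nm_ge0.
have bx : bdd x by exists C.
set d := F^# ** F ** z; set S := z^# ** F^# ** F ** z; set S2 := d^# ** d.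
set K := nm D ^+ 2; have K0 : 0 <= K by exact: sqr_ge0.
have pS : pos S.
  have -> : S = (F ** z)^# ** (F ** z) by rewrite /S; star_ring.
  exact: pos_star_mul.
have pS2 : pos S2 by exact: pos_star_mul.
have S2S : leA S2 S.
  rewrite /leA; have -> : S - S2 = (F ** z)^# ** (1 *:: cone - (F^#)^# ** F^#) ** (F ** z).
    by rewrite /S /S2 /d; star_ring.
  apply: pos_conj; apply: pos_nm_subr; first exact: pos_star_mul.
  by rewrite nm_star_mul nm_star; have := nm_ge0 F; nra.
have key m : 0 < m -> m ^+ 2 * nm S2 <= (1 + m) * ((K + m * kap) * C ^+ 2).
  move=> m0; set X := m *:: S + m ^+ 2 *:: S2; set t := (K + m * kap) * C ^+ 2.
  have t0 : 0 <= t.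
    by apply: mulr_ge0; [rewrite addr_ge0 // mulr_ge0 // ltW|exact: sqr_ge0].
  have pX : pos X by apply: posD; apply: posZ => //; [exact: ltW|exact: sqr_ge0].
  have up : nm (z + m *:: d) ^+ 2 <= t + nm X.
    have h n : nm (D ** x n + m *:: d) ^+ 2 <= t + nm X.
      set y := x n; have hy : nm y <= C by exact: hx.
      rewrite -nm_star_mul.
      (* The cross terms of the square are at most [m (kap y^# y + kap^-1 d^# D D^# d)], by [i5],
         and [d^# D D^# d = (F z)^# (F D) (F D)^# (F z) <= kap S], by [i4]. With [|D y| <= |D| C]
         and [|y| <= C] the total is [t + X]. *)
      have le1 : leA ((D ** y + m *:: d)^# ** (D ** y + m *:: d)) (t *:: cone + X).
        have i1 : pos ((nm D * C) ^+ 2 *:: cone - (D ** y)^# ** (D ** y)).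
          apply: pos_nm_subr; first exact: pos_star_mul.
          rewrite nm_star_mul ler_pXn2r // ?nnegrE ?nm_ge0 ?mulr_ge0 ?nm_ge0 //.
          by apply: le_trans (nmM _ _) _; rewrite ler_wpM2l ?nm_ge0.
        have i2 : pos (C ^+ 2 *:: cone - y^# ** y).
          apply: pos_nm_subr; first exact: pos_star_mul.
          by rewrite nm_star_mul ler_pXn2r // ?nnegrE ?nm_ge0.
        have i3 : pos (kap *:: cone - ((F ** D)^#)^# ** (F ** D)^#).
          apply: pos_nm_subr; first exact: pos_star_mul.
          by rewrite nm_star_mul nm_star.
        have i4 := pos_conj (F ** z) i3.
        have i5 := pos_star_mul (kap *:: y - D^# ** d).
        have ki : 0 <= kap^-1 by rewrite invr_ge0 ltW.
        have := posD i1 (posZ (ltW m0) (posD (posZ (ltW k0) i2)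
          (posZ ki (posD i5 i4)))).
        rewrite /leA; congr pos; rewrite /t /X /S /S2 /d /K.
        by star_ring_with ltac:(first [ring | field; rewrite ?gt_eqF //]).
      apply: le_trans (nm_le (pos_star_mul _) le1) _.
      apply: le_trans (nmD _ _) _; rewrite lerD2r.
      by apply: le_trans (nmR _ _) _; rewrite ger0_norm.
    have hs : 0 <= t + nm X by rewrite addr_ge0 ?nm_ge0.
    have -> : z + m *:: d = L (fun n => D ** x n + m *:: d).
      rewrite LD ?L_cst //; [|exact: bdd_cst].
      by apply: bddM => //; exact: bdd_cst.
    rewrite -(sqr_sqrtr hs) ler_pXn2r // ?nnegrE ?nm_ge0 ?sqrtr_ge0 //.
    apply: L_le => n; rewrite -(ler_pXn2r (n := 2)) // ?nnegrE ?nm_ge0 ?sqrtr_ge0 //.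
    by rewrite sqr_sqrtr.
  have m1 : 0 < 1 + m by rewrite ltr_pwDl // ltW.
  (* As [z^# d = S], the square is [z^# z + 2 m S + m^2 S2]. Subtracting [(1 + 1/(1 + m)) X] leaves
     [z^# z + m^2/(1 + m) (S - S2)], which is positive. The excess [X/(1 + m)] survives comparison
     with [up] and bounds [X]. *)
  have low : (1 + (1 + m)^-1) * nm X <= nm (z + m *:: d) ^+ 2.
    have c0 : 0 <= 1 + (1 + m)^-1 by rewrite addr_ge0 // invr_ge0 ltW.
    rewrite -nm_star_mul -(ger0_norm c0) -nmZr.
    apply: nm_le; first exact: posZ.
    have c1 : 0 <= m ^+ 2 / (1 + m) by rewrite divr_ge0 ?sqr_ge0 // ltW.
    have := posD (pos_star_mul z) (posZ c1 S2S).
    rewrite /leA; congr pos; rewrite /X /S2 /S /d.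
    by star_ring_with ltac:(first [ring | field; rewrite ?gt_eqF //]).
  have hX : nm X <= (1 + m) * t.
    have : (1 + m)^-1 * nm X <= t by lra.
    by rewrite mulrC ler_pdivrMr // mulrC.
  apply: le_trans hX; rewrite -[m ^+ 2]ger0_norm ?sqr_ge0 // -nmZr.
  apply: nm_le; first by apply: posZ => //; exact: sqr_ge0.
  by rewrite /leA /X addrK; apply: posZ => //; exact: ltW.
rewrite -nm_star_mul -/S2 leNgt; apply/negP => lt.
(* For [m >= 1], [(1 + m) (K + m kap) <= m^2 kap + m (2 K + kap)], so [key] would give [m del <= c];
   at [m = 1 + c/del] the left side is [del + c]. *)
set del := nm S2 - kap * C ^+ 2; have d0 : 0 < del by rewrite subr_gt0.
set c := (2 * K + kap) * C ^+ 2.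
have c0 : 0 <= c.
  by rewrite mulr_ge0 ?sqr_ge0 //; move: K0 k0; move: (K) => k; lra.
set m := 1 + c / del; have m1 : 1 <= m by rewrite lerDl divr_ge0 // ltW.
have := key m (lt_le_trans ltr01 m1).
have em : m * del = del + c by rewrite /m mulrDl mul1r divfK // gt_eqF.
have KC : 0 <= K * C ^+ 2 by rewrite mulr_ge0 ?sqr_ge0.
move: em; rewrite /del /c; move: (nm S2) lt d0 m1 KC => s2 lt d0 m1 KC em h.
have e3 : m ^+ 2 * s2 - m ^+ 2 * kap * C ^+ 2 = m * (s2 - kap * C ^+ 2 + (2 * K + kap) * C ^+ 2).
  by rewrite -em; ring.
have md : 0 < m * (s2 - kap * C ^+ 2) by apply: mulr_gt0; [apply: lt_le_trans m1|rewrite subr_gt0].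
have mk : 1 * (K * C ^+ 2) <= m * (K * C ^+ 2) by rewrite ler_wpM2r.
move: h e3 md mk; clear; move: (C ^+ 2) => q; lra.
Qed.

(** Subtracting [L x] reduces the claim to [z = L (u y) = 0] for [L y = 0]. For each n-th root of
    unity, [peak_estimate] gives [|G j z|^2 <= 4 C^2 / N^2]. Since the squares of the [G j] sum to a
    scalar at least 1, adding up the [n = 2 N] estimates yields [|z|^2 <= 8 C^2 / N] for all [N]. *)
Lemma L_unitary (u : A) x : unitary u -> bdd x -> L (fun n => u ** x n) = u ** L x.
Proof.
move=> hu bx; pose y n := x n - L x.
have by_ : bdd y by apply: bddD => //; exact: bdd_cst.
have Ly : L y = 0 by rewrite LD ?L_cst ?subrr //; exact: bdd_cst.
set z := L (fun n => u ** y n).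
suff z0 : z = 0.
  apply/eqP; rewrite -subr_eq0; apply/eqP; rewrite -z0 /z -[u ** L x]L_cst -scaleN1r -LZ; last exact: bdd_cst.
  rewrite -LD; last 2 first.
  - by apply: bddM => //; exact: bdd_cst.
  - by apply: bddZ; exact: bdd_cst.
  by apply: L_eq => n; rewrite scaleN1r /y; star_ring.
have [C hC] := by_.
have key N : (0 < N)%N -> nm z ^+ 2 <= 8 * C ^+ 2 / N%:R.
  (* The exponents [k + l] occurring in the square of [F j] stay below [2 N], as orthogonality of
     the n-th roots of unity requires. *)
  move=> N0; set n := (N + N)%N; have n0 : (0 < n)%N by rewrite addn_gt0 N0.
  have N0' : 0 < N%:R :> R by rewrite ltr0n.
  have [w pw] := prim_root_exists R n0.
  have wj j : w ^+ j * (w ^+ j)^* = 1.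
    apply: (unity_root_conj n0); rewrite -exprM mulnC exprM (prim_expr_order pw).
    by rewrite expr1n.
  pose v j := (w ^+ j)^* *: u.
  have uv j : unitary (v j).
    have [u1 u2] := hu.
    by rewrite /unitary /v cstarZ !cmulZl !cmulZr !scalerA conjCK wj mulrC wj u1 u2 !scale1r.
  pose F j := N%:R^-1 *:: \sum_(k < N) cpow (v j) k.
  pose G j := (F j)^# ** F j.
  have est j : nm (G j ** z) ^+ 2 <= 4 / N%:R ^+ 2 * C ^+ 2.
    have [nF nD _] := fejer (uv j) N0; rewrite -/(F j) in nF nD.
    (* The shift by [w ^+ j] is free because [L y = 0]; it produces the factor that [F j] nearly
       annihilates. *)
    have -> : z = L (fun n => (u - w ^+ j *: cone) ** y n).
      rewrite (@L_eq _ (fun n => u ** y n + (- w ^+ j) *: y n)) => [|k].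
        rewrite LD ?LZ ?Ly ?scaler0 ?addr0 //.
          by apply: bddM => //; exact: bdd_cst.
        exact: bddZ.
      by rewrite cmulDl cmulNl cmulZl cmul1a scaleNr.
    apply: peak_estimate => //; first by rewrite divr_gt0 // exprn_gt0.
    have -> : u - w ^+ j *: cone = w ^+ j *: (v j - cone).
      by rewrite /v scalerBr scalerA wj scale1r.
    rewrite cmulZr nmZ.
    have -> : complex.Re `|w ^+ j| = 1.
      have /eqP := wj j; rewrite -normCK sqrp_eq1 // => /eqP -> //.
    rewrite mul1r (_ : 4 / N%:R ^+ 2 = (2 / N%:R) ^+ 2); last by field; rewrite gt_eqF.
    by rewrite ler_pXn2r // nnegrE ?nm_ge0 // divr_ge0 // ltW.
  pose deg (t : 'I_N * 'I_N) := (t.1 + t.2)%N.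
  have hd (p : 'I_N * 'I_N) : (deg p < n)%N by rewrite /deg /n -addnS leq_add // ltnW.
  have pv := parseval pw hd hu.1.
  have cnt := @card_coincidences R _ _ deg n0 hd.
  rewrite card_prod card_ord in cnt.
  set m := (n * _)%N in pv cnt.
  have FF j : F j ** F j = (N%:R ^- 2) *:: \sum_(t : 'I_N * 'I_N) (w ^+ j)^* ^+ deg t *: cpow u (deg t).
    rewrite /F cmulZl cmulZr scalerA -rmorphM -invfM -expr2; congr (_ *: _).
    rewrite cmul_suml; under eq_bigr => k _ do rewrite cmul_sumr.
    rewrite pair_big; apply: eq_bigr => t _ /=.
    by rewrite /v -cpowD cpowZ.
  (* [F j] is normal, so the square of [G j] equals [(F j F j)^# (F j F j)], and Parseval applies to
     [F j F j], a sum over pairs of degree [k + l]. *)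
  have sumG : \sum_(j < n) (G j ** z)^# ** (G j ** z) = (N%:R ^- 4 * m%:R) *:: (z^# ** z).
    transitivity (z^# ** (\sum_(j < n) (F j ** F j)^# ** (F j ** F j)) ** z).
      rewrite cmul_sumr cmul_suml; apply: eq_bigr => j _.
      have [_ _ cF] := fejer (uv j) N0; rewrite -/(F j) in cF.
      rewrite /G !cstarM cstarK !cmulA; congr (_ ** _ ** _).
      rewrite -!cmulA; congr (_ ** (_ ** _)).
      by rewrite cF.
    under eq_bigr => j _ do rewrite FF cstarZr cmulZl cmulZr scalerA -rmorphM.
    rewrite -scaler_sumr pv cmulZr cmulZl cmulZr cmula1 cmulZl scalerA; congr (_ *: _).
    rewrite -[m%:R](rmorph_nat (real_complex R)) -rmorphM; congr (_ %:C)%C.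
    by rewrite -invfM -exprD.
  have m0 : 1 <= N%:R ^- 4 * m%:R :> R.
    rewrite mulrC ler_pdivlMr ?exprn_gt0 // mul1r -natrX ler_nat.
    by rewrite (_ : (N ^ 4 = (N * N) ^ 2)%N) // expnMn -expnD.
  have h1 : nm z ^+ 2 <= \sum_(j < n) nm (G j ** z) ^+ 2.
    apply: (@le_trans _ _ (nm (\sum_(j < n) (G j ** z)^# ** (G j ** z)))).
      rewrite sumG nmZr nm_star_mul ger0_norm ?(le_trans ler01 m0) //.
      by rewrite ler_peMl // sqr_ge0.
    apply: le_trans (nm_sum _ _ _) _; apply: ler_sum => j _.
    by rewrite nm_star_mul.
  apply: le_trans h1 _; apply: (@le_trans _ _ (\sum_(j < n) 4 / N%:R ^+ 2 * C ^+ 2)).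
    by apply: ler_sum => j _; exact: est.
  rewrite sumr_const card_ord -[leLHS]mulr_natr /n natrD le_eqVlt; apply/orP; left; apply/eqP.
  by field; rewrite gt_eqF.
apply/nm_eq0/eqP; rewrite -sqrf_eq0 eq_le sqr_ge0 andbT leNgt; apply/negP => z0.
have := key (Num.truncn (8 * C ^+ 2 / nm z ^+ 2)).+1 isT.
rewrite ler_pdivlMr ?ltr0n // leNgt => /negP; apply.
by rewrite -ltr_pdivrMl // mulrC truncnS_gt.
Qed.

(** Every element is a linear combination of unitaries: split it into self-adjoint parts, scale
    these to norm at most 1 and apply [unitary_re]. *)
Lemma L_mull a x : bdd x -> L (fun n => a ** x n) = a ** L x.
Proof.
move=> bx.
have bc b : bdd (fun n => b ** x n) by apply: bddM => //; exact: bdd_cst.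
have hsa h : sa h -> L (fun n => h ** x n) = h ** L x.
  move=> sh; set T := nm h + 1; have T0 : 0 < T by rewrite ltr_wpDl ?nm_ge0.
  have [||u [u1 u2 eh]] := @unitary_re _ _ (T^-1 *:: h).
  - exact: saZ.
  - rewrite nmZr ger0_norm ?invr_ge0 ?(ltW T0) // ler_pdivrMl // mulr1 /T.
    by have := nm_ge0 h; lra.
  have {}eh : h = (T / 2) *:: u + (T / 2) *:: u^#.
    rewrite -scalerDr; transitivity (T *:: (T^-1 *:: h)); first by star_field.
    by rewrite eh; star_field.
  rewrite eh cmulDl !cmulZl (@L_eq _ (fun n => (T / 2) *:: (u ** x n) + (T / 2) *:: (u^# ** x n))).
    rewrite LD ?LZ; do ?[by apply: bddZ|by apply: bc].
    by rewrite !L_unitary // /unitary ?cstarK.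
  by move=> n; rewrite cmulDl !cmulZl.
have -> : a = 2^-1 *:: (a + a^#) + 'i%C *: (- 2^-1 *:: ('i%C *: (a - a^#))) by star_field.
set p := 2^-1 *:: (a + a^#); set q := - 2^-1 *:: _.
have sp : sa p by rewrite /sa /p; star_ring.
have sq : sa q by rewrite /sa /q; star_ring.
rewrite (@L_eq _ (fun n => p ** x n + 'i%C *: (q ** x n))).
  by rewrite LD ?LZ ?hsa ?cmulDl ?cmulZl //; apply: bddZ; apply: bc.
by move=> n; rewrite cmulDl; congr (_ + _); rewrite cmulZl.
Qed.

Lemma L_mulr a x : bdd x -> L (fun n => x n ** a) = L x ** a.
Proof.
move=> bx; rewrite -[RHS]cstarK cstarM -L_star // -L_mull; last exact: bdd_star.
rewrite -L_star; last by apply: bddM; [exact: bdd_cst|exact: bdd_star].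
by apply: L_eq => n; rewrite cstarM !cstarK.
Qed.

End GeneralizedLimit.

(** * Generalized limits in dual spaces *)

Section UltraLimit.
Variables (R : realType) (U : set_system nat) (UU : UltraFilter U).
Hypothesis Uinf : forall N, U [set n | (N <= n)%N].
Implicit Types (c d : nat -> R[i]) (z k : R[i]).

Definition cabs z : R := complex.Re `|z|.

Lemma cabsE z : `|z| = (cabs z)%:C%C.
Proof. by rewrite /cabs RRe_real ?normr_real. Qed.

Lemma cabs_ge0 z : 0 <= cabs z.
Proof. by have := normr_ge0 z; rewrite cabsE lecR. Qed.

Lemma cabsD z k : cabs (z + k) <= cabs z + cabs k.
Proof. by have := ler_normD z k; rewrite !cabsE -rmorphD lecR. Qed.

Lemma cabsM z k : cabs (z * k) = cabs z * cabs k.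
Proof. by apply: complexI; rewrite -cabsE normrM !cabsE -rmorphM. Qed.

Lemma cabsBC z k : cabs (z - k) = cabs (k - z).
Proof. by rewrite /cabs distrC. Qed.

Lemma cabs_eq0 z : cabs z = 0 -> z = 0.
Proof. by move=> h; apply/eqP; rewrite -normr_eq0 cabsE h. Qed.

Lemma cabs_Re z : `|complex.Re z| <= cabs z.
Proof. by have := normc_ge_Re z; rewrite cabsE lecR. Qed.

Lemma cabs_Im z : `|complex.Im z| <= cabs z.
Proof.
rewrite /cabs normc_def /= -[leLHS]sqrtr_sqr ler_wsqrtr //.
by rewrite lerDr sqr_ge0.
Qed.

Lemma cabs_ReIm z : cabs z <= `|complex.Re z| + `|complex.Im z|.
Proof.
rewrite -[leRHS]ger0_norm ?addr_ge0 // -[leRHS]sqrtr_sqr.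
rewrite /cabs normc_def /= ler_wsqrtr // !sqrrD.
by rewrite !real_normK ?num_real // addrAC lerDl mulrn_wge0 // mulr_ge0.
Qed.

Lemma U_setI (P Q : set nat) : U P -> U Q -> U (P `&` Q).
Proof. exact: filterI. Qed.

Lemma U_ex (P : set nat) : U P -> exists n, P n.
Proof. by move=> /filter_ex[n Pn]; exists n. Qed.

Lemma U_all (P : set nat) : (forall n, P n) -> U P.
Proof. by move=> h; apply: filterS (Uinf 0) => n _; apply: h. Qed.

Definition ucvg c z := forall e : R, 0 < e -> U [set n | cabs (c n - z) <= e].

(** The limit is the supremum of the levels [t] with [t <= r n] on a member of [U]; as [sup S + e]
    is not such a level, the ultrafilter contains the complementary set. *)
Lemma ultra_real_cvg (r : nat -> R) (C : R) : (forall n, `|r n| <= C) ->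
  exists l, forall e, 0 < e -> U [set n | `|r n - l| <= e].
Proof.
move=> hC; pose S := [set t | U [set n | t <= r n]].
have hs : has_sup S.
  split.
    exists (- C); apply: U_all => n /=; have := hC n; rewrite ler_norml; by case/andP.
  exists C => t /= /U_ex[n /= h]; apply: le_trans h _.
  by have := hC n; rewrite ler_norml; case/andP.
exists (sup S) => e e0.
have [t St ht] := sup_adherent e0 hs.
have nS : ~ S (sup S + e).
  move=> h; have := sup_upper_bound hs h; rewrite -subr_ge0 opprD addrA subrr add0r.
  by rewrite oppr_ge0 leNgt e0.
have [//|h2] := in_ultra_setVsetC [set n | sup S + e <= r n] UU.
apply: filterS (U_setI St h2) => n [/= h1 /negP]; rewrite -ltNge => h3.
by rewrite ler_norml; apply/andP; split; lra.
Qed.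

Lemma ucvg_ex c (C : R) : (forall n, cabs (c n) <= C) -> exists z, ucvg c z.
Proof.
move=> hC.
have [|a ha] := @ultra_real_cvg (fun n => complex.Re (c n)) C.
  by move=> n; apply: le_trans (cabs_Re _) _.
have [|b hb] := @ultra_real_cvg (fun n => complex.Im (c n)) C.
  by move=> n; apply: le_trans (cabs_Im _) _.
exists (a +i* b)%C => e e0; have e2 : 0 < e / 2 by rewrite divr_gt0.
apply: filterS (U_setI (ha _ e2) (hb _ e2)) => n [/= h1 h2].
apply: le_trans (cabs_ReIm _) _; move: h1 h2; case: (c n) => x y /=; lra.
Qed.

Lemma ucvg_unique c z k : ucvg c z -> ucvg c k -> z = k.
Proof.
move=> hz hk; apply/eqP; rewrite -subr_eq0; apply/eqP/cabs_eq0/eqP.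
rewrite eq_le cabs_ge0 andbT; apply/ler_addgt0Pr => e e0; rewrite add0r.
have e2 : 0 < e / 2 by rewrite divr_gt0.
have [n [/= h1 h2]] := U_ex (U_setI (hz _ e2) (hk _ e2)).
have -> : z - k = (z - c n) + (c n - k) by rewrite addrA subrK.
by apply: le_trans (cabsD _ _) _; rewrite cabsBC; lra.
Qed.

Lemma ucvg_cst z : ucvg (fun=> z) z.
Proof. by move=> e e0; apply: U_all => n /=; rewrite subrr /cabs normr0 ltW. Qed.

Lemma ucvg_lin k c d z t : ucvg c z -> ucvg d t -> ucvg (fun n => k * c n + d n) (k * z + t).
Proof.
move=> hz ht e e0; have e2 : 0 < e / 2 by rewrite divr_gt0.
have k0 : 0 < cabs k + 1 by rewrite ltr_wpDl ?cabs_ge0.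
have ek : 0 < e / 2 / (cabs k + 1) by rewrite divr_gt0.
apply: filterS (U_setI (hz _ ek) (ht _ e2)) => n [/= h1 h2].
have -> : k * c n + d n - (k * z + t) = k * (c n - z) + (d n - t) by ring.
apply: le_trans (cabsD _ _) _; rewrite cabsM.
suff : cabs k * cabs (c n - z) <= e / 2 by lra.
move: h1; rewrite ler_pdivlMr //; have := cabs_ge0 (c n - z); have := cabs_ge0 k; nra.
Qed.

Lemma ucvg_le c z (C : R) : ucvg c z ->
  (exists N, forall n, (N <= n)%N -> cabs (c n) <= C) -> cabs z <= C.
Proof.
move=> hz [N hN]; apply/ler_addgt0Pr => e e0.
have [n [/= h1 h2]] := U_ex (U_setI (hz _ e0) (Uinf N)).
rewrite -(subrK (c n) z); apply: le_trans (cabsD _ _) _.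
by rewrite cabsBC; have := hN n h2; lra.
Qed.

End UltraLimit.

(** Banach-Alaoglu along an ultrafilter finer than [\oo]: the pointwise limit of the functionals
    [phi (u n)] is bounded, hence represented by an element of [A], and the norm identity for [phi]
    makes the assignment contractive. *)
Lemma wstar_gen_limit (R : realType) (A : cstarAlgType R) :
  is_Wstar_algebra A -> exists L : (nat -> A) -> A, gen_limit L.
Proof.
move=> [V [phi [philin phinorm phisurj]]].
have [U [UU hU]] := ultraFilterLemma (_ : ProperFilter (\oo : set_system nat)).
have Uinf N : U [set n | (N <= n)%N] by apply: hU; exists N.
pose nv (v : V) : R := complex.Re `|v|.
have nvE v : `|v| = (nv v)%:C%C by rewrite /nv RRe_real ?normr_real.
have nv0 v : 0 <= nv v by have := normr_ge0 v; rewrite nvE lecR.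
have phile a v : cabs (phi a v) <= nm a * nv v.
  by case: (phinorm a) => _ /(_ v) h _; move: h; rewrite cabsE nmE nvE -rmorphM lecR.
have nmle a (C : R) : 0 <= C -> (forall v, cabs (phi a v) <= C * nv v) -> nm a <= C.
  move=> C0 h; case: (phinorm a) => _ _ hd.
  suff : `|a| <= C%:C%C by rewrite nmE lecR.
  apply: hd; first by rewrite lecR.
  by move=> v; rewrite cabsE nvE -rmorphM lecR.
have phi_inj a b : (forall v, phi a v = phi b v) -> a = b.
  move=> h; apply/eqP; rewrite -subr_eq0; apply/eqP/nm_eq0/eqP; rewrite eq_le nm_ge0 andbT.
  apply: nmle => // v; rewrite mul0r -scaleN1r addrC philin h mulN1r addNr.
  by rewrite /cabs normr0.
have lim_ex u v : bdd u -> exists z, ucvg U (fun n => phi (u n) v) z.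
  move=> [C hC]; apply: (@ucvg_ex R U UU Uinf _ (C * nv v)) => n; apply: le_trans (phile _ _) _.
  by rewrite ler_wpM2r.
have L_ex u : bdd u -> exists a, forall v, ucvg U (fun n => phi (u n) v) (phi a v).
  move=> bu; have [f hf] := choice (fun v => lim_ex u v bu).
  have flin : linear (f : V -> R[i]^o).
    move=> k v w; apply: (ucvg_unique UU (hf _)).
    have := ucvg_lin UU k (hf v) (hf w).
    by congr ucvg; apply/funext => n; rewrite linearP.
  pose F : {linear V -> R[i]^o} := HB.pack f (GRing.isLinear.Build _ _ _ _ _ flin).
  have Fc : continuous F.
    have [C hC] := bu.
    have fb v : cabs (f v) <= C * nv v.
      apply: (ucvg_le UU Uinf (hf v)); exists 0%N => n _; apply: le_trans (phile _ _) _.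
      by rewrite ler_wpM2r.
    apply: bounded_linear_continuous.
    have C0 : 0 <= C by apply: le_trans (hC 0%N); exact: nm_ge0.
    exists (C%:C%C); split; first by rewrite complex_real.
    move=> M CM; near=> v.
    have v1 : nv v <= 1.
      have : `|v| <= 1 by near: v; apply: nbhs0_le.
      by rewrite nvE lecR.
    apply: ltW; apply: le_lt_trans CM; rewrite /= cabsE lecR.
    by apply: le_trans (fb v) _; rewrite ler_piMr.
  by have [a ha] := phisurj F Fc; exists a => v; rewrite ha; exact: hf.
(* By [L_ex] the default [0] can occur only at unbounded sequences, on which [gen_limit] imposes
   nothing. *)
pose L u := xget 0 [set a | forall v, ucvg U (fun n => phi (u n) v) (phi a v)].
have LP u : bdd u -> forall v, ucvg U (fun n => phi (u n) v) (phi (L u) v).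
  move=> /L_ex h.
  exact: (@xgetPex _ 0 [set a | forall v, ucvg U (fun n => phi (u n) v) (phi a v)] h).
exists L; split.
- move=> k u v bu bv.
  have buv : bdd (fun n => k *: u n + v n) by apply: bddD => //; apply: bddZ.
  apply: phi_inj => w; apply: (ucvg_unique UU (LP _ buv w)); rewrite philin.
  have := ucvg_lin UU k (LP _ bu w) (LP _ bv w).
  by congr ucvg; apply/funext => n; rewrite philin.
- move=> u C bu [N hN].
  have C0 : 0 <= C by apply: le_trans (hN N (leqnn _)); exact: nm_ge0.
  apply: nmle => // v; apply: (ucvg_le UU Uinf (LP _ bu v)); exists N => n /hN h.
  by apply: le_trans (phile _ _) _; rewrite ler_wpM2r.
- move=> a; apply: phi_inj => v; apply: (ucvg_unique UU (LP _ (bdd_cst a) v)).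
  exact: ucvg_cst.
Unshelve. all: by end_near.
Qed.

(** * The Hilbert module H_A *)

Lemma cvA_sum (R : realType) (A : cstarAlgType R) (I : Type) (s : seq I)
    (f : nat -> I -> A) (F : I -> A) :
  (forall i, cvA (f^~ i) (F i)) -> cvA (fun n => \sum_(i <- s) f n i) (\sum_(i <- s) F i).
Proof.
move=> h; elim: s => [|i s IH].
  by apply: (@cvA_eq _ _ (fun=> 0)) => [n|]; rewrite big_nil //; exact: cvA_cst.
rewrite big_cons; apply: cvA_eq (cvAD (h i) IH) => n.
by rewrite big_cons.
Qed.

Lemma conjR (R : realType) (t : R) : (real_complex R t : R[i])^* = real_complex R t.
Proof. exact: conjc_real. Qed.

Section HilbertBasics.
Variables (R : realType) (A : cstarAlgType R).
Local Notation seqA := (nat -> A).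
Implicit Types (a b c : A) (x y z : seqA) (t : R) (k : R[i]).

(** At [t = al >= |a|], the inequality [b^# a b <= al b^# b] turns the hypothesis into
    [b^# b <= al c]. The perturbation [d] makes [al] invertible and disappears by [pos_eps]. With
    [a = <x, x>], [b = <x, y>], [c = <y, y>] the hypothesis is the positivity of
    [<x b - t y, x b - t y>], for finite sums and for [hdot] alike. *)
Lemma cauchy_schwarz_abstract a b c : pos a -> pos c ->
  (forall t, pos (b^# ** a ** b - (2 * t) *:: (b^# ** b) + t ^+ 2 *:: c)) ->
  leA (b^# ** b) (nm a *:: c).
Proof.
move=> pa pc h; apply: pos_eps => e e0.
set d := e / (nm c + 1); have c1 : 0 < nm c + 1 by rewrite ltr_wpDl ?nm_ge0.
have d0 : 0 < d by rewrite divr_gt0.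
set al := nm a + d; have al0 : 0 < al by rewrite ltr_wpDl ?nm_ge0.
have h1 : pos (b^# ** (al *:: cone) ** b - b^# ** a ** b).
  apply: leA_conj; apply: leA_trans (leA_nm pa) _; apply: leA_R.
  by rewrite lerDl ltW.
have ai : 0 <= al^-1 by rewrite invr_ge0 ltW.
have h2 : pos (al *:: c - b^# ** b).
  have := posZ ai (posD h1 (h al)); congr pos; star_field.
have h3 : pos (e *:: cone - d *:: c).
  have := posZ (ltW d0) (pos_nm_subr pc (t := nm c + 1) _).
  move=> /(_ ltac:(by rewrite lerDl)); congr pos.
  by rewrite /d; star_field.
have := posD h2 h3; congr pos; rewrite /al; star_ring.
Qed.

(** Windows starting at [m] rather than at 0 let the same estimates control tails, hence
    convergence. *)
Definition dotn x y m n : A := \sum_(m <= i < n) (x i)^# ** y i.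

Definition fn x m n : R := Num.sqrt (nm (dotn x x m n)).

Lemma pos_sum (I : Type) (s : seq I) (P : pred I) (F : I -> A) :
  (forall i, P i -> pos (F i)) -> pos (\sum_(i <- s | P i) F i).
Proof. by move=> h; elim/big_rec: _ => [|i z Pi]; [exact: pos0|apply/posD/h]. Qed.

Lemma pos_dotn x m n : pos (dotn x x m n).
Proof. by apply: pos_sum => i _; exact: pos_star_mul. Qed.

Lemma dotn_star x y m n : (dotn x y m n)^# = dotn y x m n.
Proof. by rewrite /dotn cstar_sum; apply: eq_bigr => i _; rewrite cstarM cstarK. Qed.

Lemma dotnDr x y z m n : dotn x (y + z) m n = dotn x y m n + dotn x z m n.
Proof. by rewrite /dotn -big_split; apply: eq_bigr => i _; exact: cmulDr. Qed.

Lemma dotnZr x y k m n : dotn x (k *: y) m n = k *: dotn x y m n.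
Proof. by rewrite /dotn scaler_sumr; apply: eq_bigr => i _; rewrite -cmulZr. Qed.

Lemma dotn_actr x y a m n : dotn x (hact y a) m n = dotn x y m n ** a.
Proof. by rewrite /dotn cmul_suml; apply: eq_bigr => i _; rewrite /hact cmulA. Qed.

Lemma dotnDl x y z m n : dotn (x + y) z m n = dotn x z m n + dotn y z m n.
Proof. by rewrite -dotn_star dotnDr cstarD !dotn_star. Qed.

Lemma dotnZl x y k m n : dotn (k *: x) y m n = k^* *: dotn x y m n.
Proof. by rewrite -dotn_star dotnZr cstarZ dotn_star. Qed.

Lemma dotn_actl x y a m n : dotn (hact x a) y m n = a^# ** dotn x y m n.
Proof. by rewrite -dotn_star dotn_actr cstarM dotn_star. Qed.

Lemma dotn_cat x y l m n : (l <= m)%N -> (m <= n)%N ->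
  dotn x y l n = dotn x y l m + dotn x y m n.
Proof. by move=> lm mn; rewrite /dotn (big_cat_nat lm mn). Qed.

Lemma fn_ge0 x m n : 0 <= fn x m n. Proof. exact: sqrtr_ge0. Qed.

Lemma fn_sqr x m n : fn x m n ^+ 2 = nm (dotn x x m n).
Proof. by rewrite sqr_sqrtr // nm_ge0. Qed.

Lemma cauchy_schwarz_dotn x y m n :
  leA ((dotn x y m n)^# ** dotn x y m n) (nm (dotn x x m n) *:: dotn y y m n).
Proof.
apply: cauchy_schwarz_abstract; [exact: pos_dotn|exact: pos_dotn|move=> t].
set b := dotn x y m n.
have := pos_dotn (hact x b + (- t)%:C%C *: y) m n.
rewrite dotnDl !dotnDr !dotn_actl !dotn_actr !dotnZr !dotnZl ?dotn_actl ?dotn_actr.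
rewrite -(dotn_star x y) -/b !conjR.
by congr pos; star_ring.
Qed.

Lemma nm_dotn x y m n : nm (dotn x y m n) <= fn x m n * fn y m n.
Proof.
rewrite -(ler_pXn2r (n := 2)) // ?nnegrE ?nm_ge0 ?mulr_ge0 ?fn_ge0 //.
rewrite -nm_star_mul exprMn !fn_sqr.
apply: le_trans (nm_le (pos_star_mul _) (cauchy_schwarz_dotn _ _ _ _)) _.
by rewrite nmZr ger0_norm ?nm_ge0.
Qed.

Lemma fnD x y m n : fn (x + y) m n <= fn x m n + fn y m n.
Proof.
rewrite -(ler_pXn2r (n := 2)) // ?nnegrE ?fn_ge0 ?addr_ge0 ?fn_ge0 // fn_sqr.
rewrite dotnDl !dotnDr; do 3?apply: le_trans (nmD _ _) _.
apply: le_trans (lerD (nmD _ _) (nmD _ _)) _.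
have h1 := nm_dotn x y m n; have h2 := nm_dotn y x m n.
by rewrite -!fn_sqr; lra.
Qed.

Lemma fnZ k x m n : fn (k *: x) m n = cabs k * fn x m n.
Proof.
rewrite /fn dotnZl dotnZr scalerA nmZ -/(cabs _) cabsM /cabs norm_conjC -expr2.
by rewrite sqrtrM ?sqr_ge0 // sqrtr_sqr ger0_norm // cabs_ge0.
Qed.

Lemma fnN x m n : fn (- x) m n = fn x m n.
Proof. by rewrite -scaleN1r fnZ /cabs normrN1 mul1r. Qed.

Lemma fn_act x a m n : fn (hact x a) m n <= fn x m n * nm a.
Proof.
rewrite -(ler_pXn2r (n := 2)) // ?nnegrE ?fn_ge0 ?mulr_ge0 ?fn_ge0 ?nm_ge0 //.
rewrite fn_sqr exprMn fn_sqr dotn_actl dotn_actr.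
apply: le_trans (nmM _ _) _; rewrite nm_star.
have := nmM (dotn x x m n) a; have := nm_ge0 a; have := nm_ge0 (dotn x x m n ** a); nra.
Qed.

Lemma dotn_diff x y m n : (m <= n)%N -> dotn x y 0 n - dotn x y 0 m = dotn x y m n.
Proof. by move=> mn; rewrite (dotn_cat _ _ (leq0n m) mn) addrC addKr. Qed.

Lemma HAP x : HA x <-> exists l, cvA (dotn x x 0) l.
Proof.
split=> [/cvg_ex[l hl]|[l hl]]; last by apply/cvg_ex; exists l; apply/cvAP.
by exists l; apply/cvAP.
Qed.

(** Rewrites membership in terms of the seminorms [fn], so that closure under sums and convergence
    of [hdot] follow from the triangle and Cauchy-Schwarz inequalities. *)
Lemma HA_cauchy x : HA x <->
  (forall e, 0 < e -> exists N, forall m, (N <= m)%N -> forall n, fn x m n <= e).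
Proof.
rewrite HAP; split=> [[l hl] e e0|h].
  have e2 : 0 < e ^+ 2 / 2 by rewrite divr_gt0 // exprn_gt0.
  have [N HN] := hl _ e2; exists N => m Nm n.
  have [mn|nm'] := leqP m n; last first.
    by rewrite /fn /dotn big_geq ?(ltnW nm') // nm0 sqrtr0 ltW.
  rewrite -(ler_pXn2r (n := 2)) // ?nnegrE ?fn_ge0 ?(ltW e0) // fn_sqr.
  rewrite -(dotn_diff x x mn).
  have -> : dotn x x 0 n - dotn x x 0 m = (dotn x x 0 n - l) - (dotn x x 0 m - l).
    by rewrite opprB addrA subrK.
  apply: le_trans (nmB _ _) _; have := HN _ Nm; have := HN _ (leq_trans Nm mn); lra.
apply: cauchy_cvA => e e0.
have se : 0 < Num.sqrt e by rewrite sqrtr_gt0.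
have [N HN] := h _ se; exists N => m n Nm Nn.
wlog mn : m n Nm Nn / (n <= m)%N.
  by move=> hw; case/orP: (leq_total n m) => le; [|rewrite nmBC]; apply: hw.
rewrite (dotn_diff x x mn) -fn_sqr -(sqr_sqrtr (ltW e0)).
rewrite ler_pXn2r // ?nnegrE ?fn_ge0 ?(ltW se) //; exact: HN.
Qed.

Lemma hdot_cvg x y : HA x -> HA y -> cvA (dotn x y 0) (hdot x y).
Proof.
move=> /HA_cauchy hx /HA_cauchy hy.
have [l hl] : exists l, cvA (dotn x y 0) l.
  apply: cauchy_cvA => e e0.
  have [N HN] := hx _ (ltr01 : 0 < 1 :> R); have [M HM] := hy _ e0.
  exists (maxn N M) => m n; rewrite !geq_max => /andP[Nm Mm] /andP[Nn Mn].
  wlog mn : m n Nm Nn Mm Mn / (n <= m)%N.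
    by move=> hw; case/orP: (leq_total n m) => le; [|rewrite nmBC]; apply: hw.
  rewrite (dotn_diff x y mn); apply: le_trans (nm_dotn _ _ _ _) _.
  rewrite -[leRHS]mul1r; apply: ler_pM; rewrite ?fn_ge0 ?HN ?HM //.
have -> : hdot x y = l by apply/cvg_lim => //; apply/cvAP.
by [].
Qed.

Lemma HA0 : HA (0 : seqA).
Proof.
apply/HA_cauchy => e e0; exists 0%N => m _ n.
by rewrite /fn /dotn big1 ?nm0 ?sqrtr0 ?ltW // => i _; rewrite cmul0r.
Qed.

Lemma HAD x y : HA x -> HA y -> HA (x + y).
Proof.
move=> /HA_cauchy hx /HA_cauchy hy; apply/HA_cauchy => e e0.
have e2 : 0 < e / 2 by rewrite divr_gt0.
have [N HN] := hx _ e2; have [M HM] := hy _ e2.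
exists (maxn N M) => m; rewrite geq_max => /andP[/HN h1 /HM h2] n.
move: (h1 n) (h2 n) => {}h1 {}h2.
by apply: le_trans (fnD _ _ _ _) _; lra.
Qed.

Lemma HAZ k x : HA x -> HA (k *: x).
Proof.
move=> /HA_cauchy hx; apply/HA_cauchy => e e0.
have k0 : 0 < cabs k + 1 by rewrite ltr_wpDl ?cabs_ge0.
have [N HN] := hx _ (divr_gt0 e0 k0); exists N => m /HN h n; move: (h n).
rewrite fnZ ler_pdivlMr //; have := cabs_ge0 k; have := fn_ge0 x m n; nra.
Qed.

Arguments HAZ k {x} _.

Lemma HAN x : HA x -> HA (- x).
Proof. by rewrite -scaleN1r; apply: HAZ. Qed.

Lemma HAB x y : HA x -> HA y -> HA (x - y).
Proof. by move=> hx /HAN; apply: HAD. Qed.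

Lemma HA_act x a : HA x -> HA (hact x a).
Proof.
move=> /HA_cauchy hx; apply/HA_cauchy => e e0.
have k0 : 0 < nm a + 1 by rewrite ltr_wpDl ?nm_ge0.
have [N HN] := hx _ (divr_gt0 e0 k0); exists N => m /HN h n; move: (h n).
rewrite ler_pdivlMr // => {}h; apply: le_trans (fn_act _ _ _ _) _.
have := nm_ge0 a; have := fn_ge0 x m n; nra.
Qed.

Arguments HA_act {x} a _.

Lemma HA_sum (I : Type) (s : seq I) (F : I -> seqA) :
  (forall i, HA (F i)) -> HA (\sum_(i <- s) F i).
Proof. by move=> h; elim/big_rec: _ => [|i z _]; [exact: HA0|apply/HAD/h]. Qed.

Lemma hdot_star x y : HA x -> HA y -> (hdot x y)^# = hdot y x.
Proof.
move=> hx hy; apply: (cvA_unique (cvA_star (hdot_cvg hx hy))).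
by apply: cvA_eq (hdot_cvg hy hx) => n; rewrite dotn_star.
Qed.

Lemma hdotDr x y z : HA x -> HA y -> HA z -> hdot x (y + z) = hdot x y + hdot x z.
Proof.
move=> hx hy hz; apply: (cvA_unique (hdot_cvg hx (HAD hy hz))).
apply: cvA_eq (cvAD (hdot_cvg hx hy) (hdot_cvg hx hz)) => n; by rewrite dotnDr.
Qed.

Lemma hdotZr x y k : HA x -> HA y -> hdot x (k *: y) = k *: hdot x y.
Proof.
move=> hx hy; apply: (cvA_unique (hdot_cvg hx (HAZ k hy))).
apply: cvA_eq (cvAZ k (hdot_cvg hx hy)) => n; by rewrite dotnZr.
Qed.

Lemma hdot_actr x y a : HA x -> HA y -> hdot x (hact y a) = hdot x y ** a.
Proof.
move=> hx hy; apply: (cvA_unique (hdot_cvg hx (HA_act a hy))).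
apply: cvA_eq (cvAM (hdot_cvg hx hy) (cvA_cst a)) => n; by rewrite dotn_actr.
Qed.

Lemma hdotDl x y z : HA x -> HA y -> HA z -> hdot (x + y) z = hdot x z + hdot y z.
Proof.
move=> hx hy hz; have hxy := HAD hx hy.
by rewrite -(hdot_star hz hxy) hdotDr // cstarD !hdot_star.
Qed.

Lemma hdotZl x y k : HA x -> HA y -> hdot (k *: x) y = k^* *: hdot x y.
Proof.
move=> hx hy; have hkx := HAZ k hx.
by rewrite -(hdot_star hy hkx) hdotZr // cstarZ hdot_star.
Qed.

Lemma hdot_actl x y a : HA x -> HA y -> hdot (hact x a) y = a^# ** hdot x y.
Proof.
move=> hx hy; have ha := HA_act a hx.
by rewrite -(hdot_star hy ha) hdot_actr // cstarM hdot_star.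
Qed.

Lemma hdotNr x y : HA x -> HA y -> hdot x (- y) = - hdot x y.
Proof. by move=> hx hy; rewrite -scaleN1r hdotZr // scaleN1r. Qed.

Lemma hdotNl x y : HA x -> HA y -> hdot (- x) y = - hdot x y.
Proof. by move=> hx hy; rewrite -scaleN1r hdotZl // rmorphN rmorph1 scaleN1r. Qed.

Lemma hdotBr x y z : HA x -> HA y -> HA z -> hdot x (y - z) = hdot x y - hdot x z.
Proof. by move=> hx hy hz; rewrite hdotDr ?hdotNr //; exact: HAN. Qed.

Lemma hdot0r x : HA x -> hdot x 0 = 0.
Proof. by move=> hx; rewrite -(scale0r (0 : seqA)) hdotZr ?scale0r //; exact: HA0. Qed.

Lemma hdot_sumr (I : Type) (s : seq I) x (F : I -> seqA) : HA x ->
  (forall i, HA (F i)) -> hdot x (\sum_(i <- s) F i) = \sum_(i <- s) hdot x (F i).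
Proof.
move=> hx hF; elim: s => [|i s IH]; first by rewrite !big_nil hdot0r.
by rewrite !big_cons hdotDr ?IH //; exact: HA_sum.
Qed.

Lemma pos_hdot x : HA x -> pos (hdot x x).
Proof. by move=> hx; apply: pos_lim (hdot_cvg hx hx) => n; exact: pos_dotn. Qed.

Definition hn x : R := Num.sqrt (nm (hdot x x)).

Lemma hn_ge0 x : 0 <= hn x. Proof. exact: sqrtr_ge0. Qed.

Lemma hn_sqr x : hn x ^+ 2 = nm (hdot x x).
Proof. by rewrite sqr_sqrtr // nm_ge0. Qed.

Lemma hnormE x : hnorm x = (hn x)%:C%C.
Proof.
apply/eqP; rewrite /hnorm -(@eqrXn2 _ 2) ?sqrtC_ge0 ?normr_ge0 //; last by rewrite lecR hn_ge0.
by rewrite sqrtCK -rmorphXn /= hn_sqr nmE.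
Qed.

Lemma leA_dotn_hdot x m n : HA x -> leA (dotn x x m n) (hdot x x).
Proof.
move=> hx; have [mn|nm'] := leqP m n; last first.
  by rewrite /dotn big_geq ?(ltnW nm') // /leA subr0; exact: pos_hdot.
apply: (@leA_trans _ _ (dotn x x 0 n)).
  by rewrite /leA (dotn_cat _ _ (leq0n m) mn) addrK; exact: pos_dotn.
have h : cvA (fun i => dotn x x 0 (n + i)) (hdot x x).
  by move=> e /(hdot_cvg hx hx)[N HN]; exists N => i Nk; apply: HN; rewrite (leq_trans Nk) ?leq_addl.
apply: (@pos_lim _ _ (fun i => dotn x x 0 (n + i) - dotn x x 0 n)) => [i|].
  by rewrite dotn_diff ?leq_addr //; exact: pos_dotn.
by apply: cvAD => //; exact: cvA_cst.
Qed.

Lemma fn_le_hn x m n : HA x -> fn x m n <= hn x.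
Proof.
move=> hx; rewrite ler_wsqrtr //; apply: nm_le; first exact: pos_dotn.
exact: leA_dotn_hdot.
Qed.

Lemma hn_le x (c : R) : HA x -> (forall n, fn x 0 n <= c) -> hn x <= c.
Proof.
move=> hx h; have c0 : 0 <= c by apply: le_trans (h 0%N); exact: fn_ge0.
rewrite -(ler_pXn2r (n := 2)) // ?nnegrE ?hn_ge0 // hn_sqr.
apply: (cvA_nm (hdot_cvg hx hx)); exists 0%N => n _.
by rewrite -fn_sqr ler_pXn2r // nnegrE fn_ge0.
Qed.

Lemma hn0 : hn 0 = 0. Proof. by rewrite /hn hdot0r ?nm0 ?sqrtr0 //; exact: HA0. Qed.

Lemma hnD x y : HA x -> HA y -> hn (x + y) <= hn x + hn y.
Proof.
move=> hx hy; apply: hn_le; first exact: HAD.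
by move=> n; apply: le_trans (fnD _ _ _ _) _; apply: lerD; exact: fn_le_hn.
Qed.

Lemma hnZ k x : HA x -> hn (k *: x) = cabs k * hn x.
Proof.
move=> hx; rewrite /hn hdotZl ?hdotZr //; last exact: HAZ.
rewrite scalerA nmZ -/(cabs _) cabsM /cabs norm_conjC -expr2.
by rewrite sqrtrM ?sqr_ge0 // sqrtr_sqr ger0_norm // cabs_ge0.
Qed.

Lemma cabsR t : cabs t%:C%C = `|t|.
Proof. by rewrite /cabs normc_def /= expr0n /= addr0 sqrtr_sqr. Qed.

Lemma hnN x : HA x -> hn (- x) = hn x.
Proof. by move=> hx; rewrite -scaleN1r hnZ // /cabs normrN1 mul1r. Qed.

Lemma hnB x y : HA x -> HA y -> hn (x - y) <= hn x + hn y.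
Proof. by move=> hx hy; rewrite -(hnN hy); apply/hnD/HAN. Qed.

Lemma hnBC x y : HA x -> HA y -> hn (x - y) = hn (y - x).
Proof. by move=> hx hy; rewrite -opprB hnN //; exact: HAB. Qed.

Lemma hn_act x a : HA x -> hn (hact x a) <= hn x * nm a.
Proof.
move=> hx; apply: hn_le; first exact: HA_act.
move=> n; apply: le_trans (fn_act _ _ _ _) _.
by rewrite ler_wpM2r ?nm_ge0 // fn_le_hn.
Qed.

Lemma fn_coord x i : fn x i i.+1 = nm (x i).
Proof. by rewrite /fn /dotn big_nat1 nm_star_mul sqrtr_sqr ger0_norm ?nm_ge0. Qed.

Lemma nm_coord x i : HA x -> nm (x i) <= hn x.
Proof. by move=> hx; rewrite -fn_coord fn_le_hn. Qed.

Lemma hn_eq0 x : HA x -> hn x = 0 -> x = 0.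
Proof.
move=> hx h; apply/funext => i; apply/nm_eq0/eqP.
by rewrite eq_le nm_ge0 andbT -h nm_coord.
Qed.

Lemma cauchy_schwarz x y : HA x -> HA y ->
  leA ((hdot x y)^# ** hdot x y) (hn x ^+ 2 *:: hdot y y).
Proof.
move=> hx hy; rewrite hn_sqr.
apply: cauchy_schwarz_abstract; [exact: pos_hdot|exact: pos_hdot|move=> t].
set b := hdot x y.
have hb := HA_act b hx; have hty := HAZ (- t)%:C%C hy.
have := pos_hdot (HAD hb hty).
have hs : HA (hact x b + (- t)%:C%C *: y) by apply: HAD.
rewrite hdotDl // !hdotDr // !hdotZr // !hdotZl // !hdot_actl // !hdot_actr //.
rewrite -(hdot_star hx hy) -/b !conjR.
by congr pos; star_ring.
Qed.

Lemma nm_hdot x y : HA x -> HA y -> nm (hdot x y) <= hn x * hn y.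
Proof.
move=> hx hy; rewrite -(ler_pXn2r (n := 2)) // ?nnegrE ?nm_ge0 ?mulr_ge0 ?hn_ge0 //.
rewrite -nm_star_mul exprMn (hn_sqr y).
apply: le_trans (nm_le (pos_star_mul _) (cauchy_schwarz hx hy)) _.
by rewrite nmZr ger0_norm ?sqr_ge0.
Qed.

Lemma hdot_eq0 x : HA x -> hdot x x = 0 -> x = 0.
Proof. by move=> hx h; apply: hn_eq0 => //; rewrite /hn h nm0 sqrtr0. Qed.

Definition cvH (u : nat -> seqA) x :=
  forall e, 0 < e -> exists N, forall n, (N <= n)%N -> hn (u n - x) <= e.

(** Completeness of [H_A]: coordinates are contractive, so they converge, and a bound on every
    finite window passes to the coordinatewise limit. *)
Lemma cauchy_cvH (u : nat -> seqA) : (forall n, HA (u n)) ->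
  (forall e, 0 < e -> exists N, forall m n, (N <= m)%N -> (N <= n)%N ->
    hn (u m - u n) <= e) ->
  exists2 x, HA x & cvH u x.
Proof.
move=> hu hc.
have [x hx] : exists x : seqA, forall i, cvA (fun n => u n i) (x i).
  suff /choice[x hx] : forall i, exists l, cvA (fun n => u n i) l by exists x.
  move=> i; apply: cauchy_cvA => e /hc[N HN]; exists N => m n Nm Nn.
  by apply: le_trans (nm_coord i (HAB (hu m) (hu n))) _; exact: HN.
have dl j m n : cvA (fun l => dotn (u j - u l) (u j - u l) m n)
                    (dotn (u j - x) (u j - x) m n).
  have cv i : cvA (fun l => u j i - u l i) (u j i - x i).
    apply: cvAD; first exact: cvA_cst.
    apply: (@cvA_eq _ _ (fun l => -1 *: u l i)) => [l|]; first by rewrite scaleN1r.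
    by rewrite -(scaleN1r (x i)); exact: (cvAZ (-1) (hx i)).
  rewrite /dotn; apply: cvA_sum => i.
  exact: (cvAM (cvA_star (cv i)) (cv i)).
have fl j m n (e : R) : (exists N, forall l, (N <= l)%N -> hn (u j - u l) <= e) ->
    fn (u j - x) m n <= e.
  move=> [N HN]; have e0 : 0 <= e by apply: le_trans (HN N (leqnn _)); exact: hn_ge0.
  rewrite -(ler_pXn2r (n := 2)) // ?nnegrE ?fn_ge0 // fn_sqr.
  apply: (cvA_nm (dl j m n)); exists N => l /HN h; rewrite -fn_sqr.
  rewrite ler_pXn2r // ?nnegrE ?fn_ge0 //; apply: le_trans h.
  exact: fn_le_hn (HAB (hu j) (hu l)).
have hxA : HA x.
  apply/HA_cauchy => e e0; have e2 : 0 < e / 2 by rewrite divr_gt0.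
  have [N HN] := hc _ e2.
  have [M HM] := (HA_cauchy (u N)).1 (hu N) _ e2; exists M => m /HM h n.
  have -> : x = u N - (u N - x) by rewrite opprB addrC subrK.
  apply: le_trans (fnD _ _ _ _) _; rewrite fnN; have := h n.
  have := @fl N m n _ (ex_intro _ N (fun l => HN N l (leqnn N))); lra.
exists x => // e e0; have [N HN] := hc _ e0; exists N => n Nn.
apply: hn_le; first exact: HAB.
by move=> m; apply: fl; exists N => l; apply: HN.
Qed.

Lemma cvH_unique (u : nat -> seqA) x y : (forall n, HA (u n)) -> HA x -> HA y ->
  cvH u x -> cvH u y -> x = y.
Proof.
move=> hu hx hy cx cy; apply/eqP; rewrite -subr_eq0; apply/eqP.
apply: hn_eq0; first exact: HAB.
apply/eqP; rewrite eq_le hn_ge0 andbT; apply/ler_addgt0Pr => e e0; rewrite add0r.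
have e2 : 0 < e / 2 by rewrite divr_gt0.
have [N HN] := cx _ e2; have [M HM] := cy _ e2.
have h1 := HN _ (leq_maxl N M); have h2 := HM _ (leq_maxr N M).
set n := maxn N M in h1 h2.
have -> : x - y = (x - u n) + (u n - y) by rewrite addrA subrK.
apply: le_trans (hnD _ _) _; try exact: HAB.
by rewrite hnBC //; lra.
Qed.

Lemma hn_lim_le (u : nat -> seqA) x (c : R) : (forall n, HA (u n)) -> HA x -> cvH u x ->
  (exists N, forall n, (N <= n)%N -> hn (u n) <= c) -> hn x <= c.
Proof.
move=> hu hx cx [M HM]; apply/ler_addgt0Pr => e e0.
have [N HN] := cx _ e0.
have h1 := HN _ (leq_maxl N M); have h2 := HM _ (leq_maxr N M).
set n := maxn N M in h1 h2.
rewrite -(subrK (u n) x); apply: le_trans (hnD (HAB hx (hu n)) (hu n)) _.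
by rewrite hnBC //; lra.
Qed.

Lemma dominated_cvH (u : nat -> seqA) (r : nat -> R) (B : R) : (forall n, HA (u n)) ->
  (forall n, hn (u n.+1 - u n) <= r n.+1 - r n) -> (forall n, r n <= B) ->
  exists x, [/\ HA x, cvH u x & forall n, hn (x - u n) <= B - r n].
Proof.
move=> hu hd hB.
have hr n : r n <= r n.+1 by rewrite -subr_ge0 (le_trans _ (hd n)) // hn_ge0.
have key n (k : nat) : hn (u (n + k)%N - u n) <= r (n + k)%N - r n.
  elim: k => [|k IH]; first by rewrite addn0 subrr hn0 subrr.
  rewrite addnS -(subrK (u (n + k)%N) (u _.+1)) -addrA.
  apply: le_trans (hnD _ _) _; try exact: HAB.
  by have := hd (n + k)%N; move: IH; lra.
have key2 m n : hn (u m - u n) <= `|r m - r n|.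
  wlog mn : m n / (n <= m)%N.
    by move=> h; case/orP: (leq_total n m) => /h //; rewrite hnBC // distrC.
  by rewrite -(subnKC mn); apply: le_trans (key _ _) _; apply: ler_norm.
have [x hx cx] : exists2 x, HA x & cvH u x.
  apply: cauchy_cvH => // e /(bounded_incr_cauchy hr hB)[N HN].
  by exists N => m n /HN h /h; apply: le_trans (key2 _ _).
exists x; split=> // n; apply: (@hn_lim_le (fun j => u j - u n)) => //.
- by move=> j; exact: HAB.
- exact: HAB.
- by move=> e /cx[N HN]; exists N => j /HN; rewrite opprB addrA subrK.
exists n => j nj; rewrite -(subnKC nj); apply: le_trans (key _ _) _.
by have := hB (n + (j - n))%N; lra.
Qed.

End HilbertBasics.

Arguments HAZ {R A} k {x} _.
Arguments HA_act {R A x} a _.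

(** * Linear maps on H_A *)

Section Operators.
Variables (R : realType) (A : cstarAlgType R).
Local Notation seqA := (nat -> A).
Implicit Types (a b c : A) (x y z : seqA) (t : R) (k : R[i]) (F G D : seqA -> seqA).

(** The algebraic half of [bounded_Alinear], kept apart from [hbound] because the bound for the left
    inverse of a semi-Fredholm [F] only comes from [closed_graph]. *)
Definition hlinear F : Prop :=
  [/\ forall x, HA x -> HA (F x),
      forall k x y, HA x -> HA y -> F (k *: x + y) = k *: F x + F y &
      forall x a, HA x -> F (hact x a) = hact (F x) a].

Lemma hactD x y a : hact (x + y) a = hact x a + hact y a.
Proof. by apply/funext => i; exact: cmulDl. Qed.

Lemma hactZ k x a : hact (k *: x) a = k *: hact x a.
Proof. by apply/funext => i; exact: cmulZl. Qed.

Lemma hactDr x a b : hact x (a + b) = hact x a + hact x b.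
Proof. by apply/funext => i; exact: cmulDr. Qed.

Lemma hactZr k x a : hact x (k *: a) = k *: hact x a.
Proof. by apply/funext => i; exact: cmulZr. Qed.

Lemma hactM x a b : hact x (a ** b) = hact (hact x a) b.
Proof. by apply/funext => i; exact: cmulA. Qed.

Lemma hact1 x : hact x cone = x.
Proof. by apply/funext => i; exact: cmula1. Qed.

Lemma hact0 x : hact x 0 = 0.
Proof. by apply/funext => i; exact: cmul0r. Qed.

Lemma hact_suml (I : Type) (s : seq I) (f : I -> seqA) a :
  hact (\sum_(i <- s) f i) a = \sum_(i <- s) hact (f i) a.
Proof.
elim: s => [|i s IH]; last by rewrite !big_cons hactD IH.
by rewrite !big_nil; apply/funext => i; exact: cmul0l.
Qed.

Lemma hact_sumr (I : Type) (s : seq I) x (f : I -> A) :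
  hact x (\sum_(i <- s) f i) = \sum_(i <- s) hact x (f i).
Proof.
elim: s => [|i s IH]; last by rewrite !big_cons hactDr IH.
by rewrite !big_nil hact0.
Qed.

Section HLinear.
Variables (F : seqA -> seqA) (hF : hlinear F).

Lemma hlin_HA x : HA x -> HA (F x). Proof. by case: hF => h _ _; apply: h. Qed.

Lemma hlinD x y : HA x -> HA y -> F (x + y) = F x + F y.
Proof. by move=> hx hy; case: hF => _ h _; rewrite -[X in X + y]scale1r h // scale1r. Qed.

Lemma hlin0 : F 0 = 0.
Proof.
have := hlinD (@HA0 R A) (@HA0 R A); rewrite addr0 => /eqP.
by rewrite -subr_eq0 opprD addrA subrr add0r oppr_eq0 => /eqP.
Qed.

Lemma hlinZ k x : HA x -> F (k *: x) = k *: F x.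
Proof.
move=> hx; case: hF => _ h _.
by rewrite -[X in F X]addr0 h ?hlin0 ?addr0 //; exact: HA0.
Qed.

Lemma hlinN x : HA x -> F (- x) = - F x.
Proof. by move=> hx; rewrite -scaleN1r hlinZ // scaleN1r. Qed.

Lemma hlinB x y : HA x -> HA y -> F (x - y) = F x - F y.
Proof. by move=> hx hy; rewrite hlinD ?hlinN //; exact: HAN. Qed.

Lemma hlin_act x a : HA x -> F (hact x a) = hact (F x) a.
Proof. by case: hF => _ _ h /h. Qed.

Lemma hlin_sum (I : Type) (s : seq I) (f : I -> seqA) : (forall i, HA (f i)) ->
  F (\sum_(i <- s) f i) = \sum_(i <- s) F (f i).
Proof.
move=> hf; elim: s => [|i s IH]; first by rewrite !big_nil hlin0.
by rewrite !big_cons hlinD ?IH //; exact: HA_sum.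
Qed.

End HLinear.

Definition hbound F (m : R) := 0 <= m /\ forall x, HA x -> hn (F x) <= m * hn x.

Lemma bounded_hlinear F : bounded_Alinear (@HA R A) (@HA R A) F ->
  hlinear F /\ exists m, hbound F m.
Proof.
move=> [h1 h2 h3 [m m0 h4]]; split; first by split.
move: m0 h4; rewrite lecE /= => /andP[/eqP mi mr] h4.
exists (complex.Re m); split=> // x /h4; rewrite !hnormE lecE /= => /andP[_].
by move: mi; case: (m) => a b /= ->; rewrite mulr0 subr0.
Qed.

Lemma hlinear_bounded F m : hlinear F -> hbound F m ->
  bounded_Alinear (@HA R A) (@HA R A) F.
Proof.
move=> [h1 h2 h3] [m0 hm]; split=> //; exists m%:C%C; first by rewrite lecR.
by move=> x hx; rewrite !hnormE -rmorphM lecR; exact: hm.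
Qed.

Lemma hbound_cvH F m (u : nat -> seqA) x : hlinear F -> hbound F m ->
  (forall n, HA (u n)) -> HA x -> cvH u x -> cvH (fun n => F (u n)) (F x).
Proof.
move=> lF [m0 hm] hu hx cu e e0.
have m1 : 0 < m + 1 by rewrite ltr_wpDl.
have [N HN] := cu _ (divr_gt0 e0 m1); exists N => n /HN.
rewrite ler_pdivlMr // -hlinB // => h; apply: le_trans (hm _ (HAB (hu n) hx)) _.
have := hn_ge0 (u n - x); nra.
Qed.

Lemma closed_cvH (M : set seqA) (u : nat -> seqA) x : hclosed M -> HA x ->
  (forall n, M (u n)) -> M `<=` @HA R A -> cvH u x -> M x.
Proof.
move=> cM hx Mu MH cu; apply: cM => // e; rewrite ltcE /= => /andP[/eqP ei er].
have e2 : 0 < complex.Re e / 2 by rewrite divr_gt0.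
have [N HN] := cu _ e2; exists (u N) => //; rewrite hnormE ltcE /= ei eqxx /=.
rewrite hnBC //; last exact/MH/Mu.
by apply: le_lt_trans (HN N (leqnn _)) _; lra.
Qed.

Fixpoint solve_seq D z n : seqA := if n is n'.+1 then z + D (solve_seq D z n') else 0.

Lemma contraction_solve D (r : R) z : hlinear D -> 0 <= r -> r < 1 ->
  (forall x, HA x -> hn (D x) <= r * hn x) -> HA z ->
  exists2 u, HA u & u - D u = z.
Proof.
move=> lD r0 r1 hD hz; have r2 : 0 < 1 - r by rewrite subr_gt0.
have hu n : HA (solve_seq D z n).
  by elim: n => [|n IH] /=; [exact: HA0|apply: HAD => //; exact: hlin_HA].
pose d n := hn z * (1 - r ^+ n) / (1 - r).
have hd n : hn (solve_seq D z n.+1 - solve_seq D z n) <= d n.+1 - d n.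
  have -> : d n.+1 - d n = hn z * r ^+ n by rewrite /d exprS; field; rewrite gt_eqF.
  elim: n => [|n IH]; first by rewrite /= (hlin0 lD) addr0 subr0 expr0 mulr1.
  have -> : solve_seq D z n.+2 - solve_seq D z n.+1 =
      D (solve_seq D z n.+1 - solve_seq D z n).
    transitivity ((z + D (solve_seq D z n.+1)) - (z + D (solve_seq D z n))) => //.
    by rewrite (hlinB lD (hu n.+1) (hu n)) opprD addrACA subrr add0r.
  apply: le_trans (hD _ (HAB (hu _) (hu _))) _.
  by rewrite exprS mulrCA ler_wpM2l.
have hb n : d n <= hn z / (1 - r).
  rewrite /d ler_pM2r ?invr_gt0 // ler_piMr ?hn_ge0 // gerBl exprn_ge0 //.
have [u [Hu cu _]] := dominated_cvH hu hd hb; exists u => //.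
have Du := hlin_HA lD Hu.
have e : u = z + D u; last by rewrite {1}e addrK.
apply: (@cvH_unique _ _ (fun n => solve_seq D z n.+1)) => //.
- exact: HAD.
- by move=> e /cu[N HN]; exists N => n Nn; apply/HN/leqW.
move=> e e0; have [N HN] := cu _ e0; exists N => n /HN h /=.
rewrite opprD addrACA subrr add0r -(hlinB lD) //.
apply: le_trans (hD _ (HAB (hu _) Hu)) _; have := hn_ge0 (solve_seq D z n - u); nra.
Qed.

(* Baire category argument, the first half of the closed graph theorem. *)
Lemma sublevel_dense G : hlinear G ->
  exists n x0 r, [/\ HA x0, 0 < r & forall x, HA x -> hn (x - x0) <= r ->
    forall e, 0 < e -> exists s, [/\ HA s, hn (G s) <= n%:R & hn (x - s) <= e]].
Proof.
move=> lG; apply: contrapT => no.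
(* From the ball [p.2] and the level [p.1], [q] is a ball centred in it whose double misses the
   sublevel set. As radii at least halve, the limit of the centres lies in every doubled ball, so
   its image would exceed every level. *)
have step (p : nat * (seqA * R)) : exists q : seqA * R, HA p.2.1 -> 0 < p.2.2 ->
    [/\ HA q.1, hn (q.1 - p.2.1) <= p.2.2, 0 < q.2, q.2 <= p.2.2 / 2 &
        forall s, HA s -> hn (G s) <= p.1%:R -> 2 * q.2 < hn (q.1 - s)].
  case: p => n [x0 r] /=; apply: contrapT => nq; apply: no; exists n, x0, r.
  have [h0 r0] : HA x0 /\ 0 < r.
    split; apply: contrapT => h; apply: nq; exists (x0, r); by move=> ? ?; exfalso; apply: h.
  split=> // x hx xr e e0; apply: contrapT => ns; apply: nq.
  exists (x, Num.min (r / 2) (e / 2)) => _ _ /=; split=> //.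
  - by rewrite lt_min !divr_gt0.
  - by rewrite ge_min lexx.
  move=> s hs Gs; rewrite ltNge; apply/negP => h; apply: ns; exists s; split=> //.
  apply: le_trans h _; have : Num.min (r / 2) (e / 2) <= e / 2 by rewrite ge_min lexx orbT.
  by lra.
have [f hf] := choice step.
pose q := fix q n : seqA * R := if n is n'.+1 then f (n', q n') else (0, 1).
have hq n : HA (q n).1 /\ 0 < (q n).2.
  elim: n => [|n [h1 h2]] /=; first by split => //; exact: HA0.
  by have [? _ ? _ _] := hf (n, q n) h1 h2.
have hu n : HA (q n).1 by case: (hq n).
have hr n : 0 < (q n).2 by case: (hq n).
pose r n := 2 * (1 - (q n).2).
have hd n : hn ((q n.+1).1 - (q n).1) <= r n.+1 - r n.
  have [_ h1 _ h2 _] := hf (n, q n) (hu n) (hr n).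
  by rewrite /r; apply: le_trans h1 _; rewrite /= in h2 *; lra.
have hB n : r n <= 2 by have := hr n; rewrite /r; lra.
have [x [hx cx dx]] := dominated_cvH hu hd hB.
set n := (Num.truncn (hn (G x))).+1.
have [_ _ _ _ h] := hf (n, q n) (hu n) (hr n).
have Gn : hn (G x) <= n%:R by apply: ltW; exact: truncnS_gt.
have := h x hx Gn; rewrite ltNge => /negP; apply.
rewrite hnBC //; last exact: (hu n.+1).
by have := dx n.+1; rewrite /r /=; lra.
Qed.

(** For [ap], move [x] to length [r], approximate both [x0 + t x] and [x0], and subtract: the images
    cost [2 n], whence [C = 2 n / r]. Correcting the residual of [x] repeatedly, with norms halved
    each time, gives a series whose image has norm at most [2 C |x|]; closedness identifies the sum
    of the images with [G x]. *)
Lemma closed_graph G : hlinear G ->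
  (forall (u : nat -> seqA) x y, (forall n, HA (u n)) -> HA x -> HA y ->
    cvH u x -> cvH (fun n => G (u n)) y -> G x = y) ->
  exists m, hbound G m.
Proof.
move=> lG hG; have [n [x0 [r [h0 r0 dn]]]] := sublevel_dense lG.
set C := 2 * n%:R / r; have C0 : 0 <= C by rewrite divr_ge0 ?mulr_ge0 // ltW.
have ap x e : HA x -> 0 < e -> exists s, [/\ HA s, hn (G s) <= C * hn x & hn (x - s) <= e].
  move=> hx e0; have [x00|xn0] := eqVneq (hn x) 0.
    exists 0; rewrite (hlin0 lG) hn0 x00 mulr0 subr0 x00; split=> //; first exact: HA0.
    exact: ltW.
  have xp : 0 < hn x by rewrite lt_neqAle eq_sym xn0 hn_ge0.
  pose t := r / hn x; have t0 : 0 < t by rewrite divr_gt0.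
  have et : 0 < t * e / 2 by rewrite divr_gt0 // mulr_gt0.
  have htx : HA (t%:C%C *: x) by exact: HAZ.
  have [||s1 [hs1 G1 d1]] := dn (x0 + t%:C%C *: x) _ _ _ et.
  - exact: HAD.
  - by rewrite addrC addKr hnZ // cabsR ger0_norm ?(ltW t0) // /t divfK.
  have [|s2 [hs2 G2 d2]] := dn x0 h0 _ _ et.
    by rewrite subrr hn0 ltW.
  have hs : HA (s1 - s2) by exact: HAB.
  have ti : `|t^-1| = t^-1 by rewrite ger0_norm // invr_ge0 ltW.
  exists (t^-1%:C%C *: (s1 - s2)); split; first exact: HAZ.
  - rewrite (hlinZ lG) // hnZ ?cabsR ?ti; last exact: hlin_HA.
    rewrite (hlinB lG) // ler_pdivrMl //.
    apply: le_trans (hnB (hlin_HA lG hs1) (hlin_HA lG hs2)) _.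
    have -> : t * (C * hn x) = 2 * n%:R by rewrite /t /C; field; rewrite xn0 gt_eqF.
    by lra.
  - have -> : x - t^-1%:C%C *: (s1 - s2) = t^-1%:C%C *: (t%:C%C *: x - (s1 - s2)).
      by rewrite [in RHS]scalerBr scalerA -rmorphM mulVf ?gt_eqF // scale1r.
    rewrite hnZ ?cabsR ?ti; last exact: HAB.
    rewrite ler_pdivrMl //.
    have -> : t%:C%C *: x - (s1 - s2) = (x0 + t%:C%C *: x - s1) - (x0 - s2).
      rewrite !opprB [x0 + _]addrC -!addrA; congr (_ + _).
      by rewrite addrCA [x0 + _]addrC subrK addrC.
    apply: le_trans (hnB _ _) _; [by apply: HAB => //; exact: HAD|exact: HAB|].
    by rewrite -/t in d1 d2; lra.
exists (2 * C); split; first by rewrite mulr_ge0.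
move=> x hx; have [x00|xn0] := eqVneq (hn x) 0.
  by rewrite (hn_eq0 hx x00) (hlin0 lG) hn0 mulr0.
have xp : 0 < hn x by rewrite lt_neqAle eq_sym xn0 hn_ge0.
set h := hn x in xp *.
have step (p : nat * seqA) : exists s, HA p.2 ->
    [/\ HA s, hn (G s) <= C * hn p.2 & hn (p.2 - s) <= h / 2 ^+ p.1.+1].
  have [hp|hp] := pselect (HA p.2); last by exists 0.
  have e0 : 0 < h / 2 ^+ p.1.+1 by rewrite divr_gt0 // exprn_gt0.
  by have [s hs] := ap p.2 _ hp e0; exists s.
have [f hf] := choice step.
pose q := fix q n : seqA := if n is n'.+1 then q n' - f (n', q n') else x.
have hq i : HA (q i).
  by elim: i => [|i IH] //=; apply: HAB => //; case: (hf (i, q i) IH).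
have nq i : hn (q i) <= h / 2 ^+ i.
  case: i => [|i]; first by rewrite expr0 divr1.
  by case: (hf (i, q i) (hq i)).
pose u i := x - q i.
have hu i : HA (u i) by exact: HAB.
have us i : u i.+1 - u i = f (i, q i).
  by rewrite /u [q i.+1]/= opprB addrA addrAC [X in X - _]addrC addrK.
have hfi i : HA (f (i, q i)) by case: (hf (i, q i) (hq i)).
have cu : cvH u x.
  move=> e e0; have ch : 0 < h / e by rewrite divr_gt0.
  exists (Num.truncn (h / e)).+1 => i hi.
  rewrite /u addrC addrA addNr add0r hnN //; apply: le_trans (nq i) _.
  rewrite ler_pdivrMr ?exprn_gt0 // mulrC -ler_pdivrMr //.
  apply: ltW; apply: lt_trans (truncnS_gt _) _; rewrite -natrX ltr_nat.
  by apply: leq_ltn_trans hi _; exact: ltn_expl.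
pose d i := 2 * C * h * (1 - 2 ^- i).
have hGu i : HA (G (u i)) by exact: hlin_HA.
have hd i : hn (G (u i.+1) - G (u i)) <= d i.+1 - d i.
  rewrite -(hlinB lG) // us.
  case: (hf (i, q i) (hq i)) => _ hg _; apply: le_trans hg _ => /=.
  have -> : d i.+1 - d i = C * (h / 2 ^+ i).
    by rewrite /d exprS; field; rewrite expf_neq0.
  by rewrite ler_wpM2l.
have hB i : d i <= 2 * C * h.
  rewrite /d ler_piMr //; exact: (mulr_ge0 (mulr_ge0 (ler0n _ 2) C0) (ltW xp)).
have [g [hg cg dg]] := dominated_cvH hGu hd hB.
rewrite (hG u x g) //; have := dg 0%N.
by rewrite /u /= subrr (hlin0 lG) subr0 /d expr0 invr1 subrr mulr0 subr0.
Qed.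

End Operators.

(** * Kernels of maps out of A^p *)

Section FiniteKernel.
Variables (R : realType) (A : cstarAlgType R).
Local Notation seqA := (nat -> A).
Variables (p : nat) (tau : 'I_p -> seqA) (htau : forall i, HA (tau i)).
Implicit Types (c d : 'I_p -> A).

Definition comb (t : 'I_p -> seqA) c : seqA := \sum_i hact (t i) (c i).

Lemma HA_comb c : HA (comb tau c).
Proof. by apply: HA_sum => i; exact: HA_act. Qed.

Arguments HA_comb : clear implicits.

Definition gram c i : A := \sum_j hdot (tau i) (tau j) ** c j.

Definition cdot c d : A := \sum_i (c i)^# ** d i.

Lemma hdot_comb_r i c : hdot (tau i) (comb tau c) = gram c i.
Proof.
rewrite hdot_sumr //; last by move=> j; exact: HA_act.
by apply: eq_bigr => j _; rewrite hdot_actr.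
Qed.

Lemma hdot_comb c d : hdot (comb tau c) (comb tau d) = cdot c (gram d).
Proof.
have hc := HA_comb c; have hd := HA_comb d.
rewrite -(hdot_star hd hc) hdot_sumr //; last by move=> j; exact: HA_act.
rewrite cstar_sum; apply: eq_bigr => j _.
by rewrite hdot_actr // cstarM hdot_star // hdot_comb_r.
Qed.

(** A bound for the Gram matrix, by [cdot_gram_le]; the step [rho = 1/(beta + 1)] is then small
    enough for [1 - rho gram] to be a contraction. *)
Definition beta : R := \sum_i hn (tau i) ^+ 2.

Definition rho : R := (beta + 1)^-1.

Lemma beta_ge0 : 0 <= beta.
Proof. by apply: sumr_ge0 => i _; exact: sqr_ge0. Qed.

Lemma rho_gt0 : 0 < rho.
Proof. by rewrite invr_gt0 ltr_wpDl // beta_ge0. Qed.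

(** [gram c i] is the inner product of [tau i] with [comb tau c], so Cauchy-Schwarz bounds each
    summand; for the Gram matrix [B] this says [B^2 <= beta B]. *)
Lemma cdot_gram_le c : leA (cdot (gram c) (gram c)) (beta *:: cdot c (gram c)).
Proof.
rewrite -[cdot c (gram c)]hdot_comb /beta rmorph_sum scaler_suml /= /leA /cdot -sumrB.
apply: pos_sum => i _; rewrite -hdot_comb_r.
by apply: cauchy_schwarz => //; exact: HA_comb.
Qed.

Definition relax c i : A := c i - rho *:: gram c i.

Lemma relax_le c : leA (cdot (relax c) (relax c)) (cdot c c).
Proof.
set S := cdot c (gram c).
have pS : pos S by rewrite /S -hdot_comb; apply/pos_hdot/HA_comb.
have S2 : \sum_i (gram c i)^# ** c i = S.
  rewrite -(pos_sa pS) /S /cdot cstar_sum; apply: eq_bigr => i _.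
  by rewrite cstarM cstarK.
have e : cdot c c - cdot (relax c) (relax c) =
    (2 * rho) *:: S - rho ^+ 2 *:: cdot (gram c) (gram c).
  transitivity (rho *:: S + rho *:: (\sum_i (gram c i)^# ** c i)
      - rho ^+ 2 *:: cdot (gram c) (gram c)); last by rewrite S2; star_ring.
  rewrite /S /cdot -sumrB !scaler_sumr -big_split /= -sumrB; apply: eq_bigr => i _.
  by rewrite /relax; star_ring.
rewrite /leA e; have r0 := rho_gt0; have b0 := beta_ge0.
have h1 := posZ (sqr_ge0 rho) (cdot_gram_le c).
have rb : rho * beta <= 1 by rewrite /rho mulrC ler_pdivrMr ?mul1r ?lerDl // ltr_wpDl.
have c0 : 0 <= 2 * rho - rho ^+ 2 * beta by nra.
by have := posD h1 (posZ c0 pS); congr pos; rewrite /S; star_ring.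
Qed.

Lemma relax_linear c d a : relax (fun i => c i ** a + d i) =1
  (fun i => relax c i ** a + relax d i).
Proof.
move=> i; have -> : relax c i ** a + relax d i =
   (c i ** a + d i) - rho *:: (gram c i ** a + gram d i) by rewrite /relax; star_ring.
rewrite /relax; congr (_ - _ *: _).
rewrite /gram cmul_suml -big_split; apply: eq_bigr => j _ /=.
by rewrite cmulDr cmulA.
Qed.

Definition iter_relax n c : 'I_p -> A := iter n relax c.

Lemma iter_relax_le n c i : nm (iter_relax n c i) ^+ 2 <= nm (cdot c c).
Proof.
have h : leA (cdot (iter_relax n c) (iter_relax n c)) (cdot c c).
  elim: n => [|n IH]; first exact: leA_refl.
  exact: leA_trans (relax_le _) IH.
rewrite -nm_star_mul; apply: nm_le; first exact: pos_star_mul.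
apply: leA_trans h; rewrite /leA /cdot (bigD1 i) //= [X in pos X]addrC addKr.
by apply: pos_sum => j _; exact: pos_star_mul.
Qed.

Definition mean n c i : A := n.+1%:R^-1 *:: \sum_(k < n.+1) iter_relax k c i.

Lemma gram_sum (I : Type) (s : seq I) (f : I -> 'I_p -> A) i :
  gram (fun j => \sum_(k <- s) f k j) i = \sum_(k <- s) gram (f k) i.
Proof.
rewrite /gram exchange_big /=; apply: eq_bigr => j _; exact: cmul_sumr.
Qed.

Lemma gramZ t c i : gram (fun j => t *: c j) i = t *: gram c i.
Proof. by rewrite /gram scaler_sumr; apply: eq_bigr => j _; rewrite cmulZr. Qed.

(** [rho gram = 1 - relax], so the sum of iterates telescopes; the iterates being bounded, the Gram
    image of the means is [O(1/n)]. *)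
Lemma gram_mean n c i :
  gram (mean n c) i = (rho * n.+1%:R)^-1 *:: (c i - iter_relax n.+1 c i).
Proof.
have r0 : rho != 0 by rewrite gt_eqF // rho_gt0.
have n0 : n.+1%:R != 0 :> R by rewrite pnatr_eq0.
rewrite /mean gramZ gram_sum invfM mulrC rmorphM -scalerA; congr (_ *: _).
have -> : c i - iter_relax n.+1 c i = rho *:: (\sum_(k < n.+1) gram (iter_relax k c) i).
  elim: n {n0} => [|n IH].
    by rewrite big_ord1 /iter_relax /= /relax opprB addrC subrK.
  rewrite big_ord_recr scalerDr -IH /=.
  have -> : relax (relax (iter_relax n c)) i =
      relax (iter_relax n c) i - rho *:: gram (relax (iter_relax n c)) i by [].
  by rewrite opprD opprK addrA.
by rewrite scalerA -rmorphM mulVf // scale1r.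
Qed.

Lemma nm_mean n c i : nm (mean n c i) <= Num.sqrt (nm (cdot c c)).
Proof.
rewrite /mean nmZr ger0_norm ?invr_ge0 // ler_pdivrMl ?ltr0n //.
apply: le_trans (nm_sum _ _ _) _.
apply: (@le_trans _ _ (\sum_(k < n.+1) Num.sqrt (nm (cdot c c)))).
  apply: ler_sum => k _; rewrite -(ler_pXn2r (n := 2)) // ?nnegrE ?nm_ge0 ?sqrtr_ge0 //.
  by rewrite sqr_sqrtr ?nm_ge0 //; exact: iter_relax_le.
by rewrite sumr_const card_ord mulr_natl.
Qed.

Definition unitv (l i : 'I_p) : A := if i == l then cone else 0.

Lemma unitv_sum c i : \sum_l unitv l i ** c l = c i.
Proof.
rewrite (bigD1 i) //= /unitv eqxx cmul1a big1 ?addr0 // => l li.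
by rewrite eq_sym (negPf li) cmul0l.
Qed.

Lemma iter_relax_sum n c i : \sum_l iter_relax n (unitv l) i ** c l = iter_relax n c i.
Proof.
elim: n i => [|n IH] i; first exact: unitv_sum.
have key (s : seq 'I_p) (f : 'I_p -> 'I_p -> A) j :
    relax (fun k => \sum_(l <- s) f l k ** c l) j = \sum_(l <- s) relax (f l) j ** c l.
  elim: s => [|l s IHs].
    rewrite big_nil /relax /gram big_nil big1 ?scaler0 ?subr0 // => k _.
    by rewrite big_nil cmul0r.
  rewrite big_cons -IHs -relax_linear; congr (relax _ j).
  by apply/funext => k; rewrite big_cons.
have -> : iter_relax n.+1 c i = relax (iter_relax n c) i by [].
have -> : iter_relax n c = (fun k => \sum_l iter_relax n (unitv l) k ** c l).
  by apply/funext => k; rewrite IH.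
by rewrite key.
Qed.

(* The mean ergodic theorem for the contraction [relax = 1 - rho gram]: its Cesaro
   means cluster at the projection onto the kernel of [gram]. *)
Lemma finite_kernel (L : (nat -> A) -> A) : gen_limit L ->
  exists E : 'I_p -> 'I_p -> A, (forall l, comb tau (E l) = 0) /\
    forall c, comb tau c = 0 -> forall i, c i = \sum_l E l i ** c l.
Proof.
move=> hL; exists (fun l i => L (fun n => mean n (unitv l) i)).
have bm l i : bdd (fun n => mean n (unitv l) i).
  by exists (Num.sqrt (nm (cdot (unitv l) (unitv l)))) => n; exact: nm_mean.
split=> [l|c hc i].
  apply: hdot_eq0; first exact: HA_comb.
  rewrite hdot_comb /cdot big1 // => i _.
  (* [L] passes through left multiplication by the Gram entries ([L_mull]), and the Gram images of
     the means form a null sequence. *)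
  suff -> : gram (fun i => L (fun n => mean n (unitv l) i)) i = 0 by rewrite cmul0r.
  have -> : gram (fun i => L (fun n => mean n (unitv l) i)) i =
      L (fun n => gram (mean n (unitv l)) i).
    rewrite /gram L_sum //; last by move=> j; apply: bddM => //; exact: bdd_cst.
    by apply: eq_bigr => j _; rewrite L_mull.
  set C := Num.sqrt (nm (cdot (unitv l) (unitv l))).
  have est n : nm (gram (mean n (unitv l)) i) <= (rho * n.+1%:R)^-1 * (2 * C).
    have rn : 0 <= (rho * n.+1%:R)^-1 by rewrite invr_ge0 mulr_ge0 // ltW // rho_gt0.
    rewrite gram_mean nmZr ger0_norm // ler_wpM2l //.
    have hC k : nm (iter_relax k (unitv l) i) <= C.
      rewrite -(ler_pXn2r (n := 2)) // ?nnegrE ?nm_ge0 ?sqrtr_ge0 //.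
      by rewrite sqr_sqrtr ?nm_ge0 //; exact: iter_relax_le.
    by apply: le_trans (nmB _ _) _; have := hC 0%N; have := hC n.+1; rewrite /=; lra.
  have C0 : 0 <= C by exact: sqrtr_ge0.
  apply: L_null => //.
    exists (rho^-1 * (2 * C)) => n; apply: le_trans (est n) _.
    rewrite ler_wpM2r ?mulr_ge0 // lef_pV2 ?posrE ?mulr_gt0 ?rho_gt0 //.
    by rewrite ler_peMr ?(ltW rho_gt0) // ler1n.
  move=> e e0; exists (Num.truncn (rho^-1 * (2 * C) / e)) => n hn'; rewrite subr0.
  apply: le_trans (est n) _; rewrite invfM -mulrA mulrCA ler_pdivrMl ?ltr0n //.
  rewrite -ler_pdivrMr //; apply: ltW; apply: lt_le_trans (truncnS_gt _) _.
  by rewrite ler_nat ltnS.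
(* A kernel element is fixed by [relax], hence by every mean. Expanding it in unit vectors and
   applying [L] needs compatibility with right multiplication ([L_mulr]). *)
have gc j : gram c j = 0 by rewrite -hdot_comb_r hc hdot0r.
have ic n j : iter_relax n c j = c j.
  elim: n j => [|n IH] j //.
  have -> : iter_relax n.+1 c j = relax (iter_relax n c) j by [].
  have -> : iter_relax n c = c by apply/funext => i'; exact: IH.
  by rewrite /relax gc scaler0 subr0.
have em n : \sum_l mean n (unitv l) i ** c l = c i.
  rewrite /mean; under eq_bigr => l _ do rewrite cmulZl cmul_suml.
  rewrite -scaler_sumr exchange_big /=.
  under eq_bigr => k _ do rewrite iter_relax_sum ic.
  rewrite sumr_const card_ord -[c i *+ _]scaler_nat scalerA -(rmorph_nat (real_complex R) n.+1).
  by rewrite -rmorphM mulVf ?pnatr_eq0 // scale1r.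
rewrite -[LHS](L_cst hL) -(@L_eq _ _ L _ _ em) L_sum //.
  by apply: eq_bigr => l _; rewrite L_mulr.
by move=> l; apply: bddM => //; exact: bdd_cst.
Qed.

End FiniteKernel.

Arguments HA_comb {R A p tau} htau c.

(** * Kernels of compact perturbations of a semi-Fredholm operator *)

Section Forward.
Variables (R : realType) (A : cstarAlgType R).
Local Notation seqA := (nat -> A).
Implicit Types (x y z : seqA).

(** The kernel of [T] is the image under [comb t] of the kernel of the map sending [c] to
    [T (comb t c)], which the columns of [E] generate. The [t i] themselves need not lie in the
    kernel. *)
Lemma hker_fg (L : (nat -> A) -> A) (T : seqA -> seqA) p (t : 'I_p -> seqA) :
  gen_limit L -> hlinear T -> (forall i, HA (t i)) ->
  (forall x, hker T x -> exists c, x = comb t c) -> finitely_generated (hker T).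
Proof.
move=> hL lT ht hsp.
have hTt i : HA (T (t i)) by exact: hlin_HA.
have [E [hE1 hE2]] := finite_kernel hTt hL.
have Tc c : T (comb t c) = comb (fun i => T (t i)) c.
  rewrite /comb (hlin_sum lT); last by move=> i; exact: HA_act.
  by apply: eq_bigr => i _; rewrite (hlin_act lT).
pose s l := comb t (E l).
have hs l : hker T (s l) by split; [exact: HA_comb|rewrite /s Tc].
exists p, s; split=> //; apply/seteqP; split=> x /=.
  move=> hx; have [c ec] := hsp x hx.
  exists (fun=> 0), c; rewrite ec.
  have hc : comb (fun i => T (t i)) c = 0 by rewrite -Tc -ec; case: hx.
  have -> : comb t c = \sum_i \sum_l hact (hact (t i) (E l i)) (c l).
    apply: eq_bigr => i _; rewrite {1}(hE2 c hc i) hact_sumr.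
    by apply: eq_bigr => l _; rewrite hactM.
  rewrite exchange_big /=; apply: eq_bigr => l _.
  by rewrite scale0r add0r /s /comb hact_suml.
move=> [k [a ->]].
have hsA l : HA (s l) by case: (hs l).
have hst l : HA (k l *: s l + hact (s l) (a l)).
  by apply: HAD; [exact: HAZ|exact: HA_act].
split; first exact: HA_sum.
rewrite (hlin_sum lT) // big1 // => l _; have [_ Ts] := hs l.
rewrite (hlinD lT) ?(hlinZ lT) ?(hlin_act lT) ?Ts ?scaler0 ?add0r //.
- by apply/funext => i; exact: cmul0l.
- exact: HAZ.
- exact: HA_act.
Qed.

Lemma submod_sub (M : set seqA) x y : closed_submodule M -> M x -> M y -> M (x - y).
Proof. by case=> _ _ h _ _ Mx My; rewrite addrC -scaleN1r; apply: h. Qed.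

Lemma submod_lin (M : set seqA) (k : R[i]) x y : closed_submodule M -> M x -> M y -> M (k *: x + y).
Proof. by case=> _ _ h _ _; apply: h. Qed.

Lemma submod_HA (M : set seqA) x : closed_submodule M -> M x -> HA x.
Proof. by case=> h _ _ _ _ /h. Qed.

(* [G] is the inverse of [F : M1 -> M2] precomposed with the projection onto M2. *)
Lemma fredholm_left_inverse (F : seqA -> seqA) (M1 N1 M2 N2 : set seqA) :
  hlinear F -> (exists m, hbound F m) ->
  closed_submodule M1 -> closed_submodule N2 ->
  direct_sum M2 N2 -> module_iso M1 M2 F ->
  (forall x, N1 x -> N2 (F x)) -> closed_submodule N1 ->
  exists G, [/\ hlinear G, exists m, hbound G m &
    forall m n, M1 m -> N1 n -> G (F (m + n)) = m].
Proof.
move=> lF [mF bF] c1 c2 [d2 s2] [[F12 _ _ _] [_ Finj Fsurj]] hN cN1.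
have ex z : exists m, HA z -> M1 m /\ N2 (z - F m).
  have [hz|hz] := pselect (HA z); last by exists 0.
  move: (hz); rewrite s2 => -[_ [n [/Fsurj[m Mm <-] Nn ez]]].
  by exists m => _; split=> //; rewrite ez addrC addKr.
have [G hG] := choice ex.
(* Linearity, closedness of the graph and the left inverse property of [G] all follow from this
   uniqueness, which is [M2] and [N2] meeting only in 0 together with injectivity of [F] on [M1]. *)
have uniq z m : HA z -> M1 m -> N2 (z - F m) -> G z = m.
  move=> hz Mm Nm; have [MG NG] := hG z hz.
  apply: Finj; rewrite ?inE //.
  apply/eqP; rewrite -subr_eq0; apply/eqP.
  have : (M2 `&` N2) (F (G z) - F m).
    split.
      have -> : F (G z) - F m = F (G z - m).
        by rewrite (hlinB lF) //; [exact: submod_HA MG|exact: submod_HA Mm].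
      by apply: F12; exact: submod_sub.
    have -> : F (G z) - F m = (z - F m) - (z - F (G z)).
      by rewrite opprB [RHS]addrC addrA subrK.
    exact: submod_sub.
  by rewrite d2.
have GM z : HA z -> M1 (G z) by move=> /hG[].
have GN z : HA z -> N2 (z - F (G z)) by move=> /hG[].
have GH z : HA z -> HA (G z) by move=> /GM; exact: submod_HA.
have lG : hlinear G.
  split=> // [k x y hx hy|x a hx].
    apply: uniq; first by apply: HAD => //; exact: HAZ.
      by apply: submod_lin => //; apply: GM.
    rewrite (hlinD lF) ?(hlinZ lF) //; try by [apply: GH|apply: HAZ; apply: GH].
    rewrite opprD addrACA -scalerBr; apply: submod_lin => //; exact: GN.
  have [_ _ _ ac1 _] := c1; have [_ _ _ ac2 _] := c2.
  apply: uniq; [exact: HA_act|by apply: ac1; apply: GM|].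
  rewrite (hlin_act lF); last exact: GH.
  have -> : hact x a - hact (F (G x)) a = hact (x - F (G x)) a.
    by apply/funext => i; rewrite /hact !fctE cmulDl cmulNl.
  by apply: ac2; apply: GN.
have bG : exists m, hbound G m.
  apply: closed_graph => // u x y hu hx hy cu cy.
  have My : M1 y.
    have [M1H _ _ _ cl1] := c1.
    by apply: (closed_cvH cl1 hy _ M1H cy) => n; exact: GM.
  apply: uniq => //; have [N2H _ _ _ cl2] := c2.
  have hFy := hlin_HA lF hy.
  apply: (@closed_cvH _ _ _ (fun n => u n - F (G (u n))) _ cl2) => //.
  - exact: HAB.
  - by move=> n; exact: GN.
  have cF := hbound_cvH lF bF (fun n => GH _ (hu n)) hy cy.
  move=> e e0; have e2 : 0 < e / 2 by rewrite divr_gt0.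
  have [N HN] := cu _ e2; have [M HM] := cF _ e2.
  exists (maxn N M) => n; rewrite geq_max => /andP[/HN h1 /HM h2].
  have -> : u n - F (G (u n)) - (x - F y) = (u n - x) - (F (G (u n)) - F y).
    by rewrite !opprD !opprK addrACA.
  have hFG : HA (F (G (u n))) by apply: hlin_HA => //; apply: GH.
  apply: le_trans (hnB _ _) _; [exact: HAB|exact: HAB|lra].
exists G; split=> // m n Mm Nn.
have hm := submod_HA c1 Mm; have hn' := submod_HA cN1 Nn.
apply: uniq => //; first by apply: hlin_HA => //; exact: HAD.
by rewrite (hlinD lF) // addrC addKr; exact: hN.
Qed.

Lemma adjointable_hlinear (F : seqA -> seqA) : adjointable F ->
  hlinear F /\ exists m, hbound F m.
Proof. by case=> /bounded_hlinear. Qed.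

Lemma hlinear_sub (F K : seqA -> seqA) : hlinear F -> hlinear K -> hlinear (F \- K).
Proof.
move=> lF lK; split=> [x hx|k x y hx hy|x a hx] /=.
- by apply: HAB; exact: hlin_HA.
- have [_ F2 _] := lF; have [_ K2 _] := lK.
  by rewrite F2 // K2 // opprD addrACA -scalerBr.
- rewrite (hlin_act lF) // (hlin_act lK) //.
  by apply/funext => i; rewrite /hact !fctE cmulDl cmulNl.
Qed.

Lemma upper_semi_Fredholm_ker (F K : seqA -> seqA) :
  is_Wstar_algebra A -> upper_semi_Fredholm F -> compact_adjointable K ->
  finitely_generated (hker (F \- K)).
Proof.
move=> /wstar_gen_limit[L hL] [/adjointable_hlinear[lF bF]].
move=> [M1 [N1 [M2 [N2 [[c1 cN1 c2 cN2] [d1 d2] [_ FN] iso [q [sN [hsN eN]]]]]]]].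
move=> [/adjointable_hlinear[lK bK] apK].
have [G [lG [mG [mG0 bG]] GF]] := fredholm_left_inverse lF bF c1 cN2 d2 iso FN cN1.
(* Makes [G (K - T)] of norm at most [mG * e <= 1/2]; the [+ 1] covers [mG = 0]. *)
pose e : R := (2 * (mG + 1))^-1.
have mG1 : 0 < mG + 1 by rewrite ltr_wpDl.
have e0 : 0 < e by rewrite invr_gt0 mulr_gt0.
have [|n [k [xs [ys [hxs hys hT]]]]] := apK e%:C%C; first by rewrite ltcR.
pose T z := \sum_(i < n) k i *: rank_one (xs i) (ys i) z.
have hro i z : HA (rank_one (xs i) (ys i) z) by apply: HA_act.
have lT : hlinear T.
  split=> [z hz|c x y hx hy|x a hx].
  - by apply: HA_sum => i; exact: HAZ.
  - rewrite /T scaler_sumr -big_split; apply: eq_bigr => i _ /=.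
    rewrite /rank_one hdotDr //; last exact: HAZ.
    by rewrite hdotZr // hactDr hactZr scalerDr !scalerA mulrC.
  - rewrite /T hact_suml; apply: eq_bigr => i _.
    by rewrite /rank_one hdot_actr // hactZ hactM.
have lKT := hlinear_sub lK lT.
pose D z := G (K z - T z).
have lD : hlinear D.
  split=> [z hz|c x y hx hy|x a hx]; rewrite /D -/((K \- T) _).
  - by apply: hlin_HA => //; exact: (hlin_HA lKT).
  - have [_ h _] := lKT; rewrite h //; have [_ h' _] := lG; apply: h'; exact: (hlin_HA lKT).
  - by rewrite (hlin_act lKT) // (hlin_act lG) //; exact: (hlin_HA lKT).
have bD z : HA z -> hn (D z) <= 2^-1 * hn z.
  move=> hz; apply: le_trans (bG _ (hlin_HA lKT hz)) _.
  have := hT z hz; rewrite !hnormE -rmorphM lecR -/(T z) => h.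
  apply: (@le_trans _ _ (mG * (e * hn z))); first by rewrite ler_wpM2l.
  rewrite mulrA ler_wpM2r ?hn_ge0 // /e invfM mulrCA ler_piMr ?invr_ge0 //.
  by rewrite ler_pdivrMr // mul1r lerDl.
have [h2 h21] : 0 <= 2^-1 :> R /\ 2^-1 < 1 :> R.
  by split; [rewrite invr_ge0|rewrite invf_lt1 // ltr1n].
have solve z : exists u, HA z -> HA u /\ u - D u = z.
  have [hz|hz] := pselect (HA z); last by exists 0.
  by have [u hu eu] := contraction_solve lD h2 h21 bD hz; exists u.
have [U hU] := choice solve.
have injD x : HA x -> x - D x = 0 -> x = 0.
  move=> hx /eqP; rewrite subr_eq0 => /eqP ex; apply: hn_eq0 => //.
  have := bD x hx; rewrite -ex; have := hn_ge0 x; lra.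
have hGx i : HA (G (xs i)) by exact: hlin_HA.
have hsNA j : HA (sN j) by exact: submod_HA cN1 _.
(* Since [x - D x = G (T x) + y] with [y] in [N1], the images under [U = (1 - D)^(-1)] of the
   [G (xs i)] and of the generators of [N1] suffice. *)
pose t (l : 'I_(n + q)) :=
  match fintype.split l with inl i => U (G (xs i)) | inr j => U (sN j) end.
have ht l : HA (t l).
  by rewrite /t; case: (fintype.split l) => i; [case: (hU _ (hGx i))|case: (hU _ (hsNA i))].
apply: (hker_fg hL (hlinear_sub lF lK) ht) => x [hx /= Fx].
have {}Fx : F x = K x by apply/eqP; rewrite -subr_eq0; apply/eqP.
have [_ s1] := d1.
move: (hx); rewrite s1 => -[m [y [Mm Ny ex]]].
move: (Ny); rewrite eN /= => -[cy [ay ey]].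
have em : m = D x + G (T x).
  rewrite /D -(hlinD lG) ?subrK; [|exact: (hlin_HA lKT)|exact: (hlin_HA lT)].
  by rewrite -Fx ex GF.
pose c (l : 'I_(n + q)) := match fintype.split l with
  | inl i => k i *: hdot (ys i) x | inr j => cy j *: cone + ay j end.
exists c; have hc : HA (comb t c) by exact: HA_comb.
(* [x] and [comb t c] are compared through their images under the injective map [1 - D]. *)
apply/eqP; rewrite -subr_eq0; apply/eqP; apply: injD; first exact: HAB.
rewrite (hlinB lD) //.
have -> : x - comb t c - (D x - D (comb t c)) = (x - D x) - (comb t c - D (comb t c)).
  by rewrite !opprD !opprK addrACA.
apply/eqP; rewrite subr_eq0; apply/eqP.
have -> : x - D x = G (T x) + y 
  by rewrite [X in X - _]ex em -[X in X - _]addrA [LHS]addrC addKr.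
have -> : comb t c - D (comb t c) = \sum_l hact (t l - D (t l)) (c l).
  rewrite /comb (hlin_sum lD) -?sumrB; last by move=> i; exact: HA_act.
  apply: eq_bigr => i _; rewrite (hlin_act lD) //.
  by apply/funext => j; rewrite /hact !fctE cmulDl cmulNl.
rewrite big_split_ord /=; congr (_ + _).
  rewrite /T (hlin_sum lG); last by move=> i; exact: HAZ.
  apply: eq_bigr => i _; rewrite /t /c (unsplitK (inl i)).
  have [_ ->] := hU _ (hGx i).
  by rewrite (hlinZ lG) // /rank_one (hlin_act lG) // hactZr.
rewrite ey; apply: eq_bigr => j _; rewrite /t /c (unsplitK (inr j)).
by have [_ ->] := hU _ (hsNA j); rewrite hactDr hactZr hact1.
Qed.

End Forward.

(** * Maps bounded below on a tail *)

Section Tail.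
Variables (R : realType) (A : cstarAlgType R).
Local Notation seqA := (nat -> A).
Implicit Types (a b c : A) (x y z : seqA) (t : R) (k : R[i]) (T : seqA -> seqA).

Definition tail n x : seqA := fun i => if (n <= i)%N then x i else 0.

Lemma dotn_tail x n m p : leA (dotn (tail n x) (tail n x) m p) (dotn x x m p).
Proof.
rewrite /leA /dotn -sumrB; apply: pos_sum => i _; rewrite /tail.
case: ifP => _; first by rewrite subrr; exact: pos0.
by rewrite cmul0r subr0; exact: pos_star_mul.
Qed.

Lemma fn_tail x n m p : fn (tail n x) m p <= fn x m p.
Proof. by rewrite ler_wsqrtr //; apply: nm_le (dotn_tail _ _ _ _); exact: pos_dotn. Qed.

Lemma HA_tail n x : HA x -> HA (tail n x).
Proof.
move=> /HA_cauchy h; apply/HA_cauchy => e /h[N HN]; exists N => m /HN hm p.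
by apply: le_trans (fn_tail _ _ _ _) _.
Qed.

Arguments HA_tail n {x} _.

Lemma hn_tail n x : HA x -> hn (tail n x) <= hn x.
Proof.
move=> hx; apply: hn_le; first exact: HA_tail.
by move=> m; apply: le_trans (fn_tail _ _ _ _) _; exact: fn_le_hn.
Qed.

Lemma hlinear_tail n : hlinear (tail n).
Proof.
split=> [x|k x y _ _|x a _]; first exact: HA_tail.
  apply/funext => i; rewrite /tail !fctE; case: ifP => // _.
  by rewrite scaler0 addr0.
by apply/funext => i; rewrite /tail /hact; case: ifP => // _; rewrite cmul0l.
Qed.

Lemma hdot_tail n x y : HA x -> HA y -> hdot (tail n x) y = hdot x (tail n y).
Proof.
move=> hx hy; apply: (cvA_unique (hdot_cvg (HA_tail n hx) hy)).
apply: cvA_eq (hdot_cvg hx (HA_tail n hy)) => m; apply: eq_bigr => i _.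
by rewrite /tail; case: ifP => // _; rewrite cstar0 cmul0l cmul0r.
Qed.

Definition tailsp n : set seqA := [set x | HA x /\ forall i, (i < n)%N -> x i = 0].

Lemma tail_id n x : tailsp n x -> tail n x = x.
Proof. by move=> [_ h]; apply/funext => i; rewrite /tail; case: leqP => // /h. Qed.

Lemma tailsp_tail n x : HA x -> tailsp n (tail n x).
Proof.
by move=> hx; split=> [|i]; [exact: HA_tail|rewrite /tail; case: leqP].
Qed.

Lemma tail_lim x e : HA x -> 0 < e -> exists N, forall n, (N <= n)%N -> hn (tail n x) <= e.
Proof.
move=> hx e0; have [N HN] := (HA_cauchy x).1 hx _ e0; exists N => n Nn.
apply: hn_le; first exact: HA_tail.
move=> p; apply: le_trans (HN n Nn p); rewrite ler_wsqrtr //; apply: nm_le; first exact: pos_dotn.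
have [np|pn] := leqP n p; last first.
  rewrite [X in leA X _]/dotn big_nat big1; last first.
    move=> i /andP[_ ip]; rewrite /tail leqNgt (leq_trans ip (ltnW pn)) /= cmul0r //.
  by rewrite /leA subr0; exact: pos_dotn.
rewrite (dotn_cat _ _ (leq0n n) np) [X in leA (X + _) _]/dotn big_nat big1; last first.
  by move=> i /andP[_ ip]; rewrite /tail leqNgt ip /= cmul0r.
by rewrite add0r; exact: dotn_tail.
Qed.

(** The norm bound holds at every [hact x a], and [leA_of_nm] upgrades these scalar inequalities to
    one in [A], as the contraction estimate in [normal_equation] requires. *)
Lemma hdot_sqr_le T m x : hlinear T -> hbound T m -> HA x ->
  leA (hdot (T x) (T x)) (m ^+ 2 *:: hdot x x).
Proof.
move=> lT [m0 bT] hx; have hT := hlin_HA lT hx.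
apply: leA_of_nm; [exact: pos_hdot|by apply: posZ; [exact: sqr_ge0|exact: pos_hdot]|].
move=> a; have ha := HA_act a hx; have hTa := HA_act a hT.
have -> : a^# ** (m ^+ 2 *:: hdot x x) ** a = m ^+ 2 *:: (a^# ** hdot x x ** a).
  by star_ring.
rewrite nmZr ger0_norm ?sqr_ge0 //.
rewrite -cmulA -hdot_actr // -hdot_actl // -cmulA -hdot_actr // -hdot_actl //.
rewrite -!hn_sqr -(hlin_act lT) // -exprMn.
by rewrite ler_pXn2r // ?nnegrE ?mulr_ge0 ?hn_ge0 //; exact: bT.
Qed.

Lemma hdot_sqr_ge T n (c : R) x : hlinear T -> 0 <= c ->
  (forall y, tailsp n y -> c * hn y <= hn (T y)) -> tailsp n x ->
  leA (c ^+ 2 *:: hdot x x) (hdot (T x) (T x)).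
Proof.
move=> lT c0 bT [hx x0]; have hT := hlin_HA lT hx.
apply: leA_of_nm; [by apply: posZ; [exact: sqr_ge0|exact: pos_hdot]|exact: pos_hdot|].
move=> a; have ha := HA_act a hx; have hTa := HA_act a hT.
have -> : a^# ** (c ^+ 2 *:: hdot x x) ** a = c ^+ 2 *:: (a^# ** hdot x x ** a).
  by star_ring.
rewrite nmZr ger0_norm ?sqr_ge0 //.
rewrite -cmulA -hdot_actr // -hdot_actl // -cmulA -hdot_actr // -hdot_actl //.
rewrite -!hn_sqr -(hlin_act lT) // -exprMn.
rewrite ler_pXn2r // ?nnegrE ?mulr_ge0 ?hn_ge0 //; apply: bT.
by split=> // i /x0; rewrite /hact => ->; rewrite cmul0l.
Qed.

Lemma hclosedP (M : set seqA) :
  (forall x, HA x -> (forall e : R, 0 < e -> exists2 y, M y & hn (x - y) <= e) -> M x) ->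
  hclosed M.
Proof.
move=> h x hx ap; apply: h => // e e0.
have [|y My] := ap e%:C%C; first by rewrite ltcR.
by rewrite hnormE ltcR => /ltW; exists y.
Qed.

Lemma small_eq0 (s : R) : 0 <= s -> (forall e, 0 < e -> s <= e) -> s = 0.
Proof.
move=> s0 h; apply/eqP; rewrite eq_le s0 andbT; apply/ler_addgt0Pr => e e0.
by rewrite add0r; exact: h.
Qed.

Lemma closed_submodule_ker T : hlinear T -> (exists m, hbound T m) ->
  closed_submodule [set x | HA x /\ T x = 0].
Proof.
move=> lT [m [m0 bT]]; split.
- by move=> x [].
- by split; [exact: HA0|exact: hlin0].
- move=> k x y [hx Tx] [hy Ty]; split; first by apply: HAD => //; exact: HAZ.
  by case: lT => _ h _; rewrite h // Tx Ty scaler0 addr0.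
- move=> x a [hx Tx]; split; first exact: HA_act.
  by rewrite (hlin_act lT) // Tx; apply/funext => i; exact: cmul0l.
apply: hclosedP => x hx ap; split=> //; have hT := hlin_HA lT hx.
apply: hn_eq0 => //; apply: small_eq0 => [|e e0]; first exact: hn_ge0.
have m1 : 0 < m + 1 by rewrite ltr_wpDl.
have [y [hy Ty]] := ap _ (divr_gt0 e0 m1); rewrite ler_pdivlMr // => d.
rewrite -[T x]subr0 -Ty -(hlinB lT) //; apply: le_trans (bT _ (HAB hx hy)) _.
by have := hn_ge0 (x - y); nra.
Qed.

Lemma closed_submodule_tailsp n : closed_submodule (tailsp n).
Proof.
split.
- by move=> x [].
- by split=> //; exact: HA0.
- move=> k x y [hx x0] [hy y0]; split; first by apply: HAD => //; exact: HAZ.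
  by move=> i ni; rewrite !fctE x0 // y0 // scaler0 addr0.
- move=> x a [hx x0]; split; first exact: HA_act.
  by move=> i ni; rewrite /hact x0 // cmul0l.
apply: hclosedP => x hx ap; split=> // i ni; apply: nm_eq0.
apply: small_eq0 => [|e e0]; first exact: nm_ge0.
have [y [hy y0] d] := ap e e0; apply: le_trans d.
by have := nm_coord i (HAB hx hy); rewrite !fctE y0 // subr0.
Qed.

Definition basis_vec (i : nat) : seqA := fun j => if j == i then cone else 0.

Lemma HA_basis i : HA (basis_vec i).
Proof.
apply/HA_cauchy => e e0; exists i.+1 => m im n.
rewrite /fn /dotn big_nat big1 ?nm0 ?sqrtr0 ?ltW // => j /andP[mj _].
by rewrite /basis_vec gtn_eqF ?cmul0r // (leq_trans im).
Qed.

Arguments HA_basis : clear implicits.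

Lemma basis_expand n x i : (i < n)%N -> (\sum_(j < n) hact (basis_vec j) (x j)) i = x i.
Proof.
move=> ni; rewrite fct_sumE (bigD1 (Ordinal ni)) //= /hact /basis_vec eqxx cmul1a.
rewrite big1 ?addr0 // => j ji; rewrite ifF ?cmul0l //.
by apply/negP => /eqP e; case/eqP: ji; apply: val_inj.
Qed.

Section BoundedBelow.
Variables (F Fs : seqA -> seqA) (mF mFs c : R) (n : nat).
Hypothesis lF : hlinear F.
Hypothesis lFs : hlinear Fs.
Hypothesis bF : hbound F mF.
Hypothesis bFs : hbound Fs mFs.
Hypothesis adj : forall x y, HA x -> HA y -> hdot (F x) y = hdot x (Fs y).
Hypothesis c0 : 0 < c.
Hypothesis below : forall y, tailsp n y -> c * hn y <= hn (F y).

(** The adjoint of the restriction of [F] to [tailsp n], by [adjW]. *)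
Let W y := tail n (Fs y).

Lemma hlinearW : hlinear W.
Proof.
split=> [x hx|k x y hx hy|x a hx]; rewrite /W.
- by apply: HA_tail; exact: hlin_HA.
- case: lFs => _ h _; rewrite h //; case: (hlinear_tail n) => _ h' _; apply: h'; exact: hlin_HA.
- by rewrite (hlin_act lFs) // (hlin_act (hlinear_tail n)) //; exact: hlin_HA.
Qed.

Lemma hboundW : hbound W mFs.
Proof.
case: bFs => m0 h; split=> // x hx; apply: le_trans (h _ hx).
by apply: hn_tail; exact: hlin_HA.
Qed.

Lemma tailspW y : HA y -> tailsp n (W y).
Proof. by move=> hy; apply: tailsp_tail; exact: hlin_HA. Qed.

Lemma adjW x y : tailsp n x -> HA y -> hdot (F x) y = hdot x (W y).
Proof.
move=> tx hy; have [hx _] := tx.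
rewrite adj // /W -hdot_tail ?tail_id //; exact: hlin_HA.
Qed.

(** Step size with [tau * mFs ^+ 2 <= 1] and [tau * c ^+ 2 <= 1]. *)
Let tau := (mFs ^+ 2 + c ^+ 2 + 1)^-1.

(* The normal equation [W F u = W y] is solved by the contraction [1 - tau W F]. *)
Lemma normal_equation y : HA y -> exists2 u, tailsp n u & W (F u) = W y.
Proof.
move=> hy.
have d0 : 0 < mFs ^+ 2 + c ^+ 2 + 1 by rewrite ltr_wpDl // addr_ge0 ?sqr_ge0.
have t0 : 0 < tau by rewrite invr_gt0.
have tm : tau * mFs ^+ 2 <= 1.
  rewrite /tau mulrC ler_pdivrMr // mul1r -addrA lerDl addr_ge0 ?sqr_ge0 //.
have tc : tau * c ^+ 2 <= 1.
  rewrite /tau mulrC ler_pdivrMr // mul1r addrAC lerDr addr_ge0 ?sqr_ge0 //.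
have tc0 : 0 < tau * c ^+ 2 by rewrite mulr_gt0 // exprn_gt0.
pose r := Num.sqrt (1 - tau * c ^+ 2).
have r1 : r < 1 by rewrite -sqrtr1 ltr_sqrt // ltrBlDr ltrDl.
(* Inserting [tail n] makes [D] a contraction of all of [H_A], to which [contraction_solve] applies;
   since [D] and [W] take values in [tailsp n], the solution lies there. *)
pose D x := tail n x - tau%:C%C *: W (F (tail n x)).
have lt := hlinear_tail n.
have lW := hlinearW.
have hWF x : HA x -> HA (W (F (tail n x))).
  by move=> hx; do 2![apply: hlin_HA => //]; exact: HA_tail.
have lD : hlinear D.
  split=> [x hx|k x z hx hz|x a hx]; rewrite /D.
  - by apply: HAB; [exact: HA_tail|apply: HAZ; exact: hWF].
  - have hx' := HA_tail n hx; have hz' := HA_tail n hz.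
    have [_ t2 _] := lt; have [F1 F2 _] := lF; have [_ W2 _] := lW.
    rewrite t2 // F2 // W2; [|exact: F1|exact: F1].
    rewrite scalerBr scalerDr opprD addrACA.
    by rewrite !scalerA [k * _]mulrC.
  - have hx' := HA_tail n hx; have [F1 _ F3] := lF.
    rewrite (hlin_act lt) // F3 // (hlin_act lW); last exact: F1.
    rewrite -hactZ; apply/funext => i; rewrite /hact !fctE cmulDl cmulNl //.
have bD x : HA x -> hn (D x) <= r * hn x.
  move=> hx; apply: (@le_trans _ _ (r * hn (tail n x))); last first.
    by rewrite ler_wpM2l ?sqrtr_ge0 // hn_tail.
  have tz := tailsp_tail n hx; rewrite /D; move: (tail n x) tz => z tz.
  have [hz _] := tz; have hFz := hlin_HA lF hz; have hWz := hlin_HA lW hFz.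
  have hZ := HAZ tau%:C%C hWz; have hZN := HAN hZ.
  rewrite -(ler_pXn2r (n := 2)) // ?nnegrE ?hn_ge0 ?mulr_ge0 ?hn_ge0 ?sqrtr_ge0 //.
  have r20 : 0 <= 1 - tau * c ^+ 2 by rewrite subr_ge0.
  rewrite exprMn (sqr_sqrtr r20) !hn_sqr -[X in _ <= X * _]ger0_norm // -nmZr.
  apply: nm_le; first by apply: pos_hdot; exact: HAB.
  set q := hdot (F z) (F z).
  have e1 : hdot z (W (F z)) = q by rewrite -adjW.
  have pq : pos q by exact: pos_hdot.
  have e2 : hdot (W (F z)) z = q by rewrite -(hdot_star hz hWz) e1; exact: pos_sa.
  (* [<D z, D z> = <z, z> - 2 tau q + tau^2 <W F z, W F z>]. By [h1] the last term is at most
     [tau^2 mFs^2 q <= tau q], and by [h2] [q >= c^2 <z, z>], which leaves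
     [(1 - tau c^2) <z, z>]. *)
  have h1 := hdot_sqr_le lW hboundW hFz.
  have h2 := hdot_sqr_ge lF (ltW c0) below tz.
  have hs : hdot (z - tau%:C%C *: W (F z)) (z - tau%:C%C *: W (F z)) =
      hdot z z - (2 * tau) *:: q + tau ^+ 2 *:: hdot (W (F z)) (W (F z)).
    rewrite hdotDl // ?hdotDr // ?hdotNr // ?hdotNl // ?hdotNr // ?hdotZr // ?hdotZl //.
    rewrite ?hdotZr // conjR e1 e2; star_ring.
    exact: HAB.
  rewrite hs /leA.
  have tt : 0 <= tau - tau ^+ 2 * mFs ^+ 2.
    by have : tau * (tau * mFs ^+ 2) <= tau * 1; [rewrite ler_wpM2l // ltW|lra].
  have := posD (posD (posZ (ltW t0) h2) (posZ (sqr_ge0 tau) h1)) (posZ tt pq).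
  by congr pos; rewrite -/q; star_ring.
have hWy : HA (W y) by exact: hlin_HA.
have hz : HA (tau%:C%C *: W y) by exact: HAZ.
have [u hu eu] := contraction_solve lD (sqrtr_ge0 _) r1 bD hz.
have ctl := closed_submodule_tailsp n.
have tu : tailsp n u.
  have -> : u = D u + tau%:C%C *: W y by rewrite -eu addrC subrK.
  have [_ _ tlin _ _] := ctl.
  rewrite addrC; apply: tlin; first exact: tailspW.
  apply: submod_sub => //; first exact: tailsp_tail.
  have [_ t00 tlin2 _ _] := ctl; rewrite -[X in tailsp _ X]addr0; apply: tlin2 => //.
  by apply: tailspW; apply: hlin_HA => //; exact: HA_tail.
exists u => //; move: eu; rewrite /D tail_id // opprB addrC subrK.
move=> /(congr1 (fun v => tau^-1%:C%C *: v)).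
by rewrite !scalerA -rmorphM mulVf ?gt_eqF // !scale1r.
Qed.

Lemma injWF u : tailsp n u -> W (F u) = 0 -> u = 0.
Proof.
move=> tu h; have [hu _] := tu; apply: hn_eq0 => //.
have hFu := hlin_HA lF hu.
have F0 : F u = 0 by apply: hdot_eq0 => //; rewrite adjW // h hdot0r.
have := below tu; rewrite F0 hn0 => h1; apply/eqP; rewrite eq_le hn_ge0 andbT.
by rewrite -(ler_pM2l c0) mulr0.
Qed.

(** [M1] is the tail space, [M2] its image, [N2 = ker W] the orthogonal complement of [M2], and [N1]
    the preimage of [N2] under [F]. The normal equation splits [y] as [F u] in [M2] plus [y - F u]
    in [N2], and [x] likewise from [y = F x]. *)
Lemma bounded_below_Fredholm : adjointable F -> upper_semi_Fredholm F.
Proof.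
move=> aF; split=> //.
have lW := hlinearW; have bW := hboundW.
have lWF : hlinear (W \o F).
  split=> [x hx|k x z hx hz|x a hx] /=.
  - by do 2![apply: hlin_HA => //].
  - have [F1 F2 _] := lF; have [_ W2 _] := lW; rewrite F2 // W2 //; exact: F1.
  - by rewrite (hlin_act lF) // (hlin_act lW) //; exact: hlin_HA.
have bWF : exists m, hbound (W \o F) m.
  have [m0 h] := bF; have [w0 h'] := bW.
  exists (mFs * mF); split=> [|x hx]; first exact: mulr_ge0.
  rewrite /= -mulrA; apply: le_trans (h' _ (hlin_HA lF hx)) _.
  by rewrite ler_wpM2l // h.
have cN1 := closed_submodule_ker lWF bWF.
have cN2 : closed_submodule [set x | HA x /\ W x = 0].
  by apply: closed_submodule_ker => //; exists mFs.
have cM1 := closed_submodule_tailsp n.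
have M1H x : tailsp n x -> HA x by case.
have [M10 _ M1lin M1act _] := cM1.
have dM2 y : HA y -> exists u, [/\ tailsp n u, HA (y - F u) & W (y - F u) = 0].
  move=> hy; have [u tu eu] := normal_equation hy; exists u.
  have hFu : HA (F u) by apply: hlin_HA => //; exact: M1H.
  by split=> //; [exact: HAB|rewrite (hlinB lW) // eu subrr].
have cM2 : closed_submodule (F @` tailsp n).
  split.
  - by move=> _ [u tu <-]; apply: hlin_HA => //; exact: M1H.
  - by exists 0; [split=> //; exact: HA0|exact: hlin0].
  - move=> k _ _ [u tu <-] [v tv <-]; exists (k *: u + v); first exact: M1lin.
    by case: lF => _ h _; rewrite h //; exact: M1H.
  - move=> _ a [u tu <-]; exists (hact u a); first exact: M1act.
    by rewrite (hlin_act lF) //; exact: M1H.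
  (* The residual [w = y - F u] is orthogonal to [M2], so [<y - F v, w> = <w, w>] for every
     approximant [F v], and [|w| <= e]. *)
  apply: hclosedP => y hy ap; have [u [tu hd Wd]] := dM2 y hy.
  exists u => //; have hu := M1H _ tu; have hFu := hlin_HA lF hu.
  apply/esym/eqP; rewrite -subr_eq0; apply/eqP; apply: hn_eq0 => //.
  apply: small_eq0 => [|e e0]; first exact: hn_ge0.
  have [_ [v tv <-] dv] := ap e e0; have hv := M1H _ tv; have hFv := hlin_HA lF hv.
  set w := y - F u in hd Wd *.
  have tuv : tailsp n (u - v) by exact: submod_sub.
  have e1 : hdot (y - F v) w = hdot w w.
    have -> : y - F v = F (u - v) + w by rewrite (hlinB lF) // [RHS]addrC /w addrA subrK.
    have hFuv : HA (F (u - v)) by apply: hlin_HA => //; exact: HAB.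
    by rewrite hdotDl // adjW // Wd hdot0r ?add0r //; exact: HAB.
  have h1 : hn w ^+ 2 <= e * hn w.
    rewrite hn_sqr -e1; apply: le_trans (nm_hdot (HAB hy hFv) hd) _.
    by rewrite ler_wpM2r ?hn_ge0.
  have [->|w0] := eqVneq (hn w) 0; first exact: ltW.
  by move: h1; rewrite expr2 ler_pM2r // lt_neqAle eq_sym w0 hn_ge0.
exists (tailsp n), [set x | HA x /\ (W \o F) x = 0], (F @` tailsp n),
  [set x | HA x /\ W x = 0].
split=> //.
- split; split.
  + apply/seteqP; split=> [x [tx [_ /= Wx]]|_ ->].
      by rewrite /=; apply: injWF.
    by split; [split=> //; exact: HA0|split; [exact: HA0|exact: (hlin0 lWF)]].
  + apply/seteqP; split=> [x hx|_ [u [v [tu [hv _] ->]]]]; last first.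
      by apply: HAD => //; exact: M1H.
    have hFx := hlin_HA lF hx; have [u [tu hd Wd]] := dM2 _ hFx.
    have hu := M1H _ tu; exists u, (x - u); split=> //; last by rewrite addrC subrK.
    by split; [exact: HAB|rewrite /= (hlinB lF)].
  + apply/seteqP; split=> [x [[u tu <-] [_ Wx]]|_ ->].
      by rewrite /= (injWF tu Wx); exact: hlin0.
    split; first by exists 0; [split=> //; exact: HA0|exact: hlin0].
    by split; [exact: HA0|exact: hlin0].
  + apply/seteqP; split=> [y hy|_ [_ [v [[u tu <-] [hv _] ->]]]]; last first.
      by apply: HAD => //; apply: hlin_HA => //; exact: M1H.
    have [u [tu hd Wd]] := dM2 y hy.
    by exists (F u), (y - F u); split; [exists u|by []|rewrite addrC subrK].
- split=> [x tx|x [hx /= Wx]]; first by exists x.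
  by split=> //; exact: hlin_HA.
- split.
    have [_ F2 F3] := lF; split.
    + by move=> x tx; exists x.
    + by move=> k x y /M1H hx /M1H hy; exact: F2.
    + by move=> x a /M1H; exact: F3.
    have [m0 h] := bF; exists mF%:C%C; first by rewrite lecR.
    by move=> x /M1H hx; rewrite !hnormE -rmorphM lecR; exact: h.
  split=> [x tx|x y|//]; first by exists x.
  rewrite !inE => tx ty e; apply/eqP; rewrite -subr_eq0; apply/eqP.
  apply: injWF; first exact: submod_sub.
  by rewrite (hlinB lF) ?e ?subrr ?(hlin0 lW) //; exact: M1H.
(* [m i] is the component in [M1] of the i-th basis vector; the differences [s i] generate [N1]. *)
have sol (i : 'I_n) : exists m, tailsp n m /\ W (F m) = W (F (basis_vec i)).
  have [m tm em] := normal_equation (hlin_HA lF (HA_basis i)); by exists m.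
have [m hm] := choice sol.
have tm i : tailsp n (m i) by case: (hm i).
have hmA i : HA (m i) by exact: M1H.
have hb i := HA_basis i.
pose s (i : 'I_n) := basis_vec i - m i.
have hs i : HA (s i) by exact: HAB.
have hsW i : W (F (s i)) = 0.
  rewrite /s (hlinB lF) // (hlinB lW); try exact: hlin_HA.
  by case: (hm i) => _ ->; rewrite subrr.
exists n, s; split; first by move=> i; exact: (conj (hs i) (hsW i)).
apply/seteqP; split=> [x [hx Wx]|_ [k [a ->]]].
  exists (fun=> 0), (fun i => x i).
  under eq_bigr => i _ do rewrite scale0r add0r.
  apply/eqP; rewrite -subr_eq0; apply/eqP.
  have hS : HA (\sum_(i < n) hact (s i) (x i)) by apply: HA_sum => i; exact: HA_act.
  (* The first [n] coordinates of [x] and of the combination agree because the [m i] vanish there.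
     The difference thus lies both in the tail space and in [N1]. *)
  apply: injWF.
    split=> [|j jn]; first exact: HAB.
    have -> : \sum_(i < n) hact (s i) (x i) =
        \sum_(i < n) hact (basis_vec i) (x i) - \sum_(i < n) hact (m i) (x i).
      rewrite -sumrB; apply: eq_bigr => i _.
      by apply/funext => l; rewrite /s /hact !fctE cmulDl cmulNl.
    rewrite !fctE basis_expand // fct_sumE big1 ?subr0 ?subrr // => i _.
    by rewrite /hact; case: (tm i) => _ ->; rewrite ?cmul0l.
  have := hlinB lWF hx hS; rewrite /= => ->; move: Wx => /= ->.
  rewrite -[W (F _)]/((W \o F) _) (hlin_sum lWF); last by move=> i; exact: HA_act.
  rewrite big1 ?subr0 // => i _; rewrite (hlin_act lWF) //= hsW.
  by apply/funext => l; exact: cmul0l.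
have hst i : HA (k i *: s i + hact (s i) (a i)).
  by apply: HAD; [exact: HAZ|exact: HA_act].
split; first exact: HA_sum.
rewrite (hlin_sum lWF) // big1 // => i _.
rewrite (hlinD lWF (HAZ (k i) (hs i)) (HA_act (a i) (hs i))).
rewrite (hlinZ lWF (k i) (hs i)) (hlin_act lWF (a i) (hs i)) /= hsW scaler0 add0r.
by apply/funext => l; exact: cmul0l.
Qed.

End BoundedBelow.

End Tail.

Arguments HA_tail {R A} n {x} _.

(** * Series of rank one operators *)

Section RankOneSeries.
Variables (R : realType) (A : cstarAlgType R).
Local Notation seqA := (nat -> A).
Implicit Types (x y z : seqA) (u v : nat -> seqA).

Definition psum u v n z : seqA := \sum_(k < n) rank_one (u k) (v k) z.

Lemma HA_rank_one x y z : HA x -> HA (rank_one x y z).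
Proof. by move=> hx; exact: HA_act. Qed.

Lemma HA_psum u v n z : (forall k, HA (u k)) -> HA (psum u v n z).
Proof. by move=> hu; apply: HA_sum => k; exact: HA_rank_one. Qed.

Arguments HA_psum : clear implicits.

Lemma hlinear_psum u v n : (forall k, HA (u k)) -> (forall k, HA (v k)) ->
  hlinear (psum u v n).
Proof.
move=> hu hv; split=> [z _|c x y hx hy|x a hx]; first exact: HA_psum.
  rewrite /psum scaler_sumr -big_split; apply: eq_bigr => k _ /=.
  rewrite /rank_one hdotDr //; last exact: HAZ.
  by rewrite hdotZr // hactDr hactZr.
rewrite /psum hact_suml; apply: eq_bigr => k _.
by rewrite /rank_one hdot_actr // hactM.
Qed.

Lemma expr2V_le (e C : R) : 0 < e -> exists n, C * 2 ^- n <= e.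
Proof.
move=> e0; exists (Num.truncn (C / e)).+1.
rewrite ler_pdivrMr ?exprn_gt0 // mulrC -ler_pdivrMr //.
apply: ltW; apply: lt_trans (truncnS_gt _) _; rewrite -natrX ltr_nat.
exact: ltn_expl.
Qed.

Lemma expr2V_le_mono (m n : nat) : (m <= n)%N -> 2 ^- n <= 2 ^- m :> R.
Proof.
move=> mn; rewrite lef_pV2 ?posrE ?exprn_gt0 //.
by rewrite -!natrX ler_nat leq_exp2l.
Qed.

(** The series is summed pointwise in [z] with a geometric majorant, and linearity is inherited from
    the partial sums. *)
Lemma rank_series u v (C : R) : (forall k, HA (u k)) -> (forall k, HA (v k)) ->
  (forall k, hn (u k) * hn (v k) <= C * 2 ^- k) ->
  exists K, hlinear K /\
    forall z n, HA z -> hn (K z - psum u v n z) <= 2 * C * hn z * 2 ^- n.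
Proof.
move=> hu hv huv.
have ex z : exists w, HA z -> HA w /\
    forall n, hn (w - psum u v n z) <= 2 * C * hn z * 2 ^- n.
  have [hz|hz] := pselect (HA z); last by exists 0.
  pose d n := 2 * C * hn z * (1 - 2 ^- n).
  have C0 : 0 <= C.
    by have := huv 0%N; rewrite expr0 invr1 mulr1; apply: le_trans; rewrite mulr_ge0 ?hn_ge0.
  have hd n : hn (psum u v n.+1 z - psum u v n z) <= d n.+1 - d n.
    rewrite /psum big_ord_recr /= [X in hn X]addrC addKr.
    apply: le_trans (hn_act _ (hu n)) _.
    apply: (@le_trans _ _ (hn (u n) * (hn (v n) * hn z))).
      by rewrite ler_wpM2l ?hn_ge0 // nm_hdot.
    have -> : d n.+1 - d n = C * 2 ^- n * hn z.
      by rewrite /d exprS; field; rewrite expf_neq0.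
    by rewrite mulrA ler_wpM2r ?hn_ge0.
  have hB n : d n <= 2 * C * hn z.
    rewrite /d ler_piMr //; first by rewrite mulr_ge0 ?hn_ge0 // mulr_ge0.
  have [w [hw _ dw]] := dominated_cvH (fun n => HA_psum u v n z hu) hd hB.
  exists w => _; split=> // n; apply: le_trans (dw n) _; rewrite /d; lra.
have [K hK] := choice ex.
have KH z : HA z -> HA (K z) by move=> /hK[].
have Ke z n : HA z -> hn (K z - psum u v n z) <= 2 * C * hn z * 2 ^- n by move=> /hK[].
have Kc z : HA z -> cvH (fun n => psum u v n z) (K z).
  move=> hz e e0; have [N HN] := expr2V_le (2 * C * hn z) e0; exists N => n Nn.
  have C0 : 0 <= C.
    by have := huv 0%N; rewrite expr0 invr1 mulr1; apply: le_trans; rewrite mulr_ge0 ?hn_ge0.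
  rewrite hnBC; [|exact: HA_psum|exact: KH].
  apply: le_trans (Ke z n hz) _; apply: le_trans HN.
  by apply: ler_wpM2l; [rewrite !mulr_ge0 ?hn_ge0|exact: expr2V_le_mono].
exists K; split=> //.
have lS n := hlinear_psum n hu hv.
split=> // [c x y hx hy|x a hx].
  have hcx := HAZ c hx; have hz := HAD hcx hy; have hKx := KH _ hx; have hKy := KH _ hy.
  apply: (cvH_unique (fun n => HA_psum u v n _ hu) (KH _ hz) _ (Kc _ hz)).
    by apply: HAD => //; exact: HAZ.
  have k0 : 0 < cabs c + 1 by rewrite ltr_wpDl ?cabs_ge0.
  move=> e e0; have e2 : 0 < e / 2 by rewrite divr_gt0.
  have [N HN] := Kc _ hx _ (divr_gt0 e2 k0); have [M HM] := Kc _ hy _ e2.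
  exists (maxn N M) => n; rewrite geq_max => /andP[/HN h1 /HM h2].
  have [_ S2 _] := lS n; rewrite S2 // opprD addrACA -scalerBr.
  have hd1 : HA (psum u v n x - K x) by apply: HAB => //; exact: HA_psum.
  have hd2 : HA (psum u v n y - K y) by apply: HAB => //; exact: HA_psum.
  apply: le_trans (hnD (HAZ c hd1) hd2) _; rewrite hnZ //.
  move: h1; rewrite ler_pdivlMr // => h1.
  have := hn_ge0 (psum u v n x - K x); have := cabs_ge0 c; nra.
have hxa := HA_act a hx; have hKx := KH _ hx.
apply: (cvH_unique (fun n => HA_psum u v n _ hu) (KH _ hxa) _ (Kc _ hxa)).
  exact: HA_act.
have k0 : 0 < nm a + 1 by rewrite ltr_wpDl ?nm_ge0.
move=> e e0; have [N HN] := Kc _ hx _ (divr_gt0 e0 k0); exists N => n /HN.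
rewrite ler_pdivlMr // => h1; rewrite (hlin_act (lS n)) //.
have -> : hact (psum u v n x) a - hact (K x) a = hact (psum u v n x - K x) a.
  by apply/funext => i; rewrite /hact !fctE cmulDl cmulNl.
have hd1 : HA (psum u v n x - K x) by apply: HAB => //; exact: HA_psum.
apply: le_trans (hn_act a hd1) _.
by have := hn_ge0 (psum u v n x - K x); have := nm_ge0 a; nra.
Qed.

Lemma hdot_psum u v n x y : (forall k, HA (u k)) -> (forall k, HA (v k)) ->
  HA x -> HA y -> hdot (psum u v n x) y = hdot x (psum v u n y).
Proof.
move=> hu hv hx hy; have hS := HA_psum u v n x hu.
rewrite -(hdot_star hy hS) hdot_sumr //; last by move=> k; exact: HA_rank_one.
rewrite hdot_sumr //; last by move=> k; exact: HA_rank_one.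
rewrite cstar_sum; apply: eq_bigr => k _.
by rewrite /rank_one !hdot_actr // cstarM !hdot_star.
Qed.

(** Exchanging [u] and [v] gives the series of the adjoint; the error bound is uniform on bounded
    sets, so the partial sums approximate [K] in operator norm. *)
Lemma rank_series_compact u v (C : R) : (forall k, HA (u k)) -> (forall k, HA (v k)) ->
  (forall k, hn (u k) * hn (v k) <= C * 2 ^- k) ->
  exists K, [/\ compact_adjointable K, hlinear K &
    forall z n, HA z -> hn (K z - psum u v n z) <= 2 * C * hn z * 2 ^- n].
Proof.
move=> hu hv huv; have [K [lK eK]] := rank_series hu hv huv.
have hvu k : hn (v k) * hn (u k) <= C * 2 ^- k by rewrite mulrC.
have [K' [lK' eK']] := rank_series hv hu hvu.
have C0 : 0 <= C.
  by have := huv 0%N; rewrite expr0 invr1 mulr1; apply: le_trans; rewrite mulr_ge0 ?hn_ge0.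
have C2 : 0 <= 2 * C by rewrite mulr_ge0.
have bK : hbound K (2 * C).
  split=> // x hx; have := eK x 0%N hx.
  by rewrite /psum big_ord0 subr0 expr0 invr1 mulr1.
have bK' : hbound K' (2 * C).
  split=> // x hx; have := eK' x 0%N hx.
  by rewrite /psum big_ord0 subr0 expr0 invr1 mulr1.
exists K; split=> //; split.
  split; first exact: hlinear_bounded bK.
  exists K' => [|x y hx hy]; first exact: hlinear_bounded bK'.
  apply/eqP; rewrite -subr_eq0; apply/eqP/nm_eq0/small_eq0 => [|e e0]; first exact: nm_ge0.
  have [n hn'] := expr2V_le (2 * (2 * C * hn x * hn y)) e0.
  have hKx := hlin_HA lK hx; have hKy := hlin_HA lK' hy.
  have hS := HA_psum u v n x hu; have hS' := HA_psum v u n y hv.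
  have d1 := HAB hKx hS; have d2 := HAB hKy hS'.
  have -> : hdot (K x) y - hdot x (K' y) =
      hdot (K x - psum u v n x) y - hdot x (K' y - psum v u n y).
    rewrite hdotDl ?hdotNl //; last exact: HAN.
    rewrite hdotBr // hdot_psum // opprB addrA subrK //.
  apply: le_trans (nmB _ _) _; apply: le_trans hn'.
  have h1 := nm_hdot d1 hy; have h2 := nm_hdot hx d2.
  have h3 := eK x n hx; have h4 := eK' y n hy.
  have h5 : hn (K x - psum u v n x) * hn y <= 2 * C * hn x * 2 ^- n * hn y.
    by rewrite ler_wpM2r ?hn_ge0.
  have h6 : hn x * hn (K' y - psum v u n y) <= hn x * (2 * C * hn y * 2 ^- n).
    by rewrite ler_wpM2l ?hn_ge0.
  apply: le_trans (lerD (le_trans h1 h5) (le_trans h2 h6)) _.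
  by rewrite le_eqVlt; apply/orP; left; apply/eqP; ring.
move=> e; rewrite ltcE /= => /andP[/eqP ei er].
have [n hn'] := expr2V_le (2 * C) er.
exists n, (fun=> 1), (fun i => u i), (fun i => v i); split=> // z hz.
under eq_bigr => i _ do rewrite scale1r.
have ee : e = (complex.Re e)%:C%C by apply/eqP; rewrite eq_complex /= ei !eqxx.
rewrite !hnormE ee -rmorphM lecR; apply: le_trans (eK z n hz) _.
by rewrite mulrAC ler_wpM2r ?hn_ge0.
Qed.

End RankOneSeries.

(** * Operators bounded below on no tail *)

Section Backward.
Variables (R : realType) (A : cstarAlgType R).
Local Notation seqA := (nat -> A).
Implicit Types (x y z xi : seqA).

(* With [a = <xi, xi>] and [h = a - 1/2] take [x] to be the positive part of [h] and
   [f = (1/2 + |h|)^(-1)]; then [a x = (1/2 + |h|) x]. *)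
Lemma spectral_cut xi : HA xi -> hn xi = 1 ->
  exists f x : A, [/\ sa f, nm f <= 2, f ** hdot xi xi ** x = x & hn (hact xi x) = 1].
Proof.
move=> hxi n1; set a := hdot xi xi.
have pa : pos a by exact: pos_hdot.
have na : nm a = 1 by rewrite /a -hn_sqr n1 expr1n.
set h := a - 2^-1 *:: cone.
have sh : sa h by apply: saD; [exact: pos_sa|apply/saN/saZ/sa1].
have h20 : 0 <= 2^-1 :> R by rewrite invr_ge0.
have nh : nm h <= 2^-1.
  apply: nm_sa_le => //; rewrite /leA /h.
    have := pos_nm_subr pa (t := 1); rewrite na => /(_ (lexx _)); congr pos.
    by star_field.
  by move: pa; congr pos; star_field.
have [k [pk ek ck]] := pos_abs sh.
have hk : h ** k = k ** h by apply: ck.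
have nk : nm k <= 2^-1.
  rewrite -(ler_pXn2r (n := 2)) // ?nnegrE ?nm_ge0 // -nm_sqr; last exact: pos_sa.
  by rewrite ek nm_sqr // ler_pXn2r // nnegrE nm_ge0.
set x0 := 2^-1 *:: (k + h).
have ax : a ** x0 = (k + 2^-1 *:: cone) ** x0.
  have -> : a = h + 2^-1 *:: cone by rewrite /h subrK.
  transitivity (2^-1 *:: (2^-1 *:: (k + h) + h ** k + h ** h)); first by rewrite /x0; star_field.
  rewrite hk -ek; rewrite /x0; star_field.
have [|f [sf _ f2 nf _]] := inv_pos pk (e := 2^-1); first by rewrite invr_gt0.
have fax : f ** a ** x0 = x0 by rewrite -cmulA ax cmulA f2 cmul1a.
(* If the positive part of [h] vanished, then [a = 1/2 - k] with [k] positive and [|k| <= 1/2], so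
   [|a| <= 1/2], against [|a| = 1]. *)
have x0n : x0 != 0.
  apply/negP => /eqP x00; have kh : k = - h.
    transitivity (2 *:: x0 - h); first by rewrite /x0; star_field.
    by rewrite x00 scaler0 sub0r.
  have ea : a = 2^-1 *:: cone - k by rewrite kh /h; star_ring.
  by have := pos_nm_sub pk nk; rewrite -ea na; lra.
have hx0 := HA_act x0 hxi.
have nx : hn (hact xi x0) != 0.
  apply: contra_neq x0n => n0; have e0 := hn_eq0 hx0 n0.
  have : hdot xi (hact xi x0) = 0 by rewrite e0 hdot0r.
  by rewrite hdot_actr // -/a => a0; rewrite -fax -cmulA a0 cmul0r.
set s := (hn (hact xi x0))^-1.
exists f, (s%:C%C *: x0); split=> //; first by rewrite -[X in _ <= X]invrK.
  by rewrite cmulZr fax.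
by rewrite hactZr hnZ // cabsR ger0_norm ?invr_ge0 ?hn_ge0 // mulVf.
Qed.

Lemma hdot_disjoint x y : HA x -> HA y ->
  (forall i, x i = 0 \/ y i = 0) -> hdot x y = 0.
Proof.
move=> hx hy d; apply: (cvA_unique (hdot_cvg hx hy)).
apply: cvA_eq (cvA_cst 0) => n; rewrite /dotn big1 // => i _.
by case: (d i) => ->; rewrite ?cstar0 ?cmul0l ?cmul0r.
Qed.

(** A tail vector with [|F x| < eps/4 |x|] is truncated at an error of [d |x|] and normalised. As
    [d <= 1/2], at least half of the norm remains, and [d mF <= eps/4] gives
    [|F y| <= eps/2 |x| <= eps |y|]. *)
Lemma small_block (F : seqA -> seqA) mF n (eps : R) : hlinear F -> hbound F mF ->
  (forall c, 0 < c -> exists2 x, tailsp n x & hn (F x) < c * hn x) -> 0 < eps ->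
  exists N xi, [/\ (n < N)%N, tailsp n xi, forall i, (N <= i)%N -> xi i = 0,
    hn xi = 1 & hn (F xi) <= eps].
Proof.
move=> lF [m0 bF] hc e0.
have [x [hx x0] Fx] := hc (eps / 4) (divr_gt0 e0 (ltr0n _ 4)).
have xp : 0 < hn x.
  rewrite lt_neqAle hn_ge0 andbT eq_sym; apply/eqP => x00.
  by move: Fx; rewrite x00 mulr0 ltNge hn_ge0.
have m4 : 0 < 4 * (mF + 1) by rewrite mulr_gt0 // ltr_wpDl.
set d := Num.min 2^-1 (eps / (4 * (mF + 1))).
have d0 : 0 < d by rewrite lt_min invr_gt0 ltr0n divr_gt0.
have dh : d <= 2^-1 by rewrite ge_min lexx.
have de : d * (4 * (mF + 1)) <= eps by rewrite -ler_pdivlMr // ge_min lexx orbT.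
have [N0 HN] := tail_lim hx (mulr_gt0 d0 xp).
set N := maxn N0 n.+1; have ht := HA_tail N hx.
have nt : hn (tail N x) <= d * hn x by apply: HN; exact: leq_maxl.
set y := x - tail N x; have hy : HA y by exact: HAB.
have yl : hn x * (1 - d) <= hn y.
  have : hn x <= hn y + hn (tail N x) by rewrite -{1}(subrK (tail N x) x) hnD.
  by lra.
have yp : 0 < hn y by apply: lt_le_trans yl; rewrite mulr_gt0 //; lra.
have Fy : hn (F y) <= eps * hn y.
  rewrite (hlinB lF) //; apply: le_trans (hnB (hlin_HA lF hx) (hlin_HA lF ht)) _.
  have h1 := bF _ ht.
  have h2 : mF * hn (tail N x) <= mF * (d * hn x) by rewrite ler_wpM2l.
  have h3 : d * (4 * (mF + 1)) * hn x <= eps * hn x by rewrite ler_wpM2r // ltW.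
  have h4 : 0 <= d * hn x by rewrite mulr_ge0 // ltW.
  have h5 : eps * (hn x * 2^-1) <= eps * hn y.
    rewrite ler_wpM2l ?(ltW e0) //; apply: le_trans yl.
    by rewrite ler_wpM2l ?(ltW xp) //; lra.
  by lra.
have ty : tailsp n y.
  split=> // i ni; rewrite /y !fctE x0 // /tail; case: ifP => [Ni|_]; last by rewrite subr0.
  by rewrite x0 ?subr0.
exists N, ((hn y)^-1%:C%C *: y); split.
- by rewrite /N leq_max ltnSn orbT.
- split=> [|i ni]; first exact: HAZ.
  by rewrite !fctE; case: ty => _ ->; rewrite ?scaler0.
- by move=> i Ni; rewrite !fctE /y !fctE /tail Ni subrr scaler0.
- by rewrite hnZ // cabsR ger0_norm ?invr_ge0 ?hn_ge0 // mulVf // gt_eqF.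
- rewrite (hlinZ lF) // hnZ ?cabsR ?ger0_norm ?invr_ge0 ?hn_ge0 //; last exact: hlin_HA.
  by rewrite ler_pdivrMl // mulrC.
Qed.

(* If all [ker (F - K)] were finitely generated while [F] is bounded below on no
   tail, take blocks [xi_k] of norm 1 with [F xi_k] small, cut them to [y_k], and
   let [K] agree with [F] on the [y_k].  Pairing [y_k] with an element of a finitely
   generated module is [O (sigma_k)] for a fixed null sequence [sigma], which fails
   for a suitable lacunary series in the [y_k]. *)
Lemma ker_fg_upper_semi_Fredholm (F : seqA -> seqA) : adjointable F ->
  (forall K, compact_adjointable K -> finitely_generated (hker (F \- K))) ->
  upper_semi_Fredholm F.
Proof.
move=> aF hfg; have [lF [mF bF]] := adjointable_hlinear aF.
have [_ [Fs /bounded_hlinear[lFs [mFs bFs]] adj]] := aF.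
have [[n [c [c0 below]]]|no] :=
  pselect (exists n c, 0 < c /\ forall y, tailsp n y -> c * hn y <= hn (F y)).
  exact: (bounded_below_Fredholm lF lFs bF bFs adj c0 below).
exfalso.
have nob n c : 0 < c -> exists2 x, tailsp n x & hn (F x) < c * hn x.
  move=> c0; apply: contrapT => h; apply: no; exists n, c; split=> // y ty.
  by rewrite leNgt; apply/negP => lt; apply: h; exists y.
have step (p : nat * nat) : exists q : nat * seqA,
    [/\ (p.2 < q.1)%N, tailsp p.2 q.2, forall i, (q.1 <= i)%N -> q.2 i = 0,
        hn q.2 = 1 & hn (F q.2) <= 2 ^- p.1].
  have e0 : 0 < 2 ^- p.1 :> R by rewrite invr_gt0 exprn_gt0.
  by have [N [xi h]] := small_block lF bF (nob p.2) e0; exists (N, xi).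
have [f hf] := choice step.
pose N := fix N k : nat := if k is k'.+1 then (f (k', N k')).1 else 0%N.
pose xi k := (f (k, N k)).2.
have hxi k : [/\ (N k < N k.+1)%N, tailsp (N k) (xi k),
    forall i, (N k.+1 <= i)%N -> xi k i = 0, hn (xi k) = 1 & hn (F (xi k)) <= 2 ^- k].
  exact: (hf (k, N k)).
have Nlt j k : (j < k)%N -> (N j.+1 <= N k)%N.
  elim: k => // k IH; rewrite ltnS leq_eqVlt => /orP[/eqP -> //|/IH h].
  by apply: leq_trans h _; apply: ltnW; case: (hxi k).
have Nk k : (k <= N k)%N.
  by elim: k => // k IH; apply: leq_ltn_trans IH _; case: (hxi k).
have xiH k : HA (xi k) by case: (hxi k) => _ [].
have cut k : exists fx : A * A, [/\ sa fx.1, nm fx.1 <= 2,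
    fx.1 ** hdot (xi k) (xi k) ** fx.2 = fx.2 & hn (hact (xi k) fx.2) = 1].
  have n1 : hn (xi k) = 1 by case: (hxi k).
  by have [g [x h]] := spectral_cut (xiH k) n1; exists (g, x).
have [fx hfx] := choice cut.
pose y k := hact (xi k) (fx k).2.
have yH k : HA (y k) by exact: HA_act.
have y1 k : hn (y k) = 1 by case: (hfx k).
have ytail k : tailsp (N k) (y k).
  by have [_ _ _ act _] := closed_submodule_tailsp A (N k); apply: act; case: (hxi k).
have disj j k : j != k -> hdot (xi j) (y k) = 0.
  move=> jk; apply: hdot_disjoint => // i; rewrite /y /hact.
  have [_ [_ zj] Zj _ _] := hxi j; have [_ [_ zk] Zk _ _] := hxi k.
  move: jk; rewrite neq_ltn => /orP[] /Nlt lt.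
    have [iN|iN] := ltnP i (N k); first by right; rewrite zk // cmul0l.
    by left; apply: Zj; exact: leq_trans lt iN.
  have [iN|iN] := ltnP i (N j); first by left; exact: zj.
  by right; rewrite Zk ?cmul0l //; exact: leq_trans lt iN.
(* With [f], [x] the pair cutting [xi k], the operator [rank_one (u k) (xi k)] sends [y k] to [F (xi
   k) f <xi k, xi k> x = F (xi k) x = F (y k)]. It kills the other [y j], whose supports are
   disjoint from that of [xi k]. *)
pose u k := hact (F (xi k)) (fx k).1.
have hFxi k : HA (F (xi k)) by exact: hlin_HA.
have uH k : HA (u k) by exact: HA_act.
have huv k : hn (u k) * hn (xi k) <= 2 * 2 ^- k.
  have [_ _ _ -> Fk] := hxi k; have [_ nf _ _] := hfx k.
  rewrite mulr1; apply: le_trans (hn_act _ (hFxi k)) _.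
  by rewrite mulrC; apply: ler_pM; rewrite ?nm_ge0 ?hn_ge0.
have [K [cK lK eK]] := rank_series_compact uH xiH huv.
have Ky k : K (y k) = F (y k).
  have S n : (k < n)%N -> psum u xi n (y k) = F (y k).
    move=> kn; rewrite /psum (bigD1 (Ordinal kn)) //= big1 ?addr0; last first.
      move=> j jk; rewrite /rank_one disj ?hact0 //.
    rewrite /rank_one /u -hactM hdot_actr // cmulA.
    by have [_ _ -> _] := hfx k; rewrite /y (hlin_act lF).
  have hKy := hlin_HA lK (yH k); have hFy := hlin_HA lF (yH k).
  apply/eqP; rewrite -subr_eq0; apply/eqP; apply: hn_eq0; first exact: HAB.
  apply: small_eq0 => [|e e0]; first exact: hn_ge0.
  have [n hn'] := expr2V_le (2 * 2 * hn (y k)) e0.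
  rewrite -(S (maxn n k.+1)); last by rewrite leq_max ltnSn orbT.
  apply: le_trans (eK _ _ (yH k)) _; apply: le_trans hn'.
  by rewrite ler_wpM2l ?mulr_ge0 ?hn_ge0 // expr2V_le_mono // leq_maxl.
have [q [s [hs es]]] := hfg K cK.
have sH i : HA (s i) by case: (hs i).
(* It tends to 0 because [y k] sees only the part of each generator beyond [N k >= k]. *)
pose sigma k : R := \sum_i nm (hdot (y k) (s i)).
have sig0 e : 0 < e -> exists M, forall k, (M <= k)%N -> sigma k <= e.
  move=> e0; have q0 : 0 < q%:R + 1 :> R by rewrite ltr_wpDl.
  have ex i : exists M, forall k, (M <= k)%N -> nm (hdot (y k) (s i)) <= e / (q%:R + 1).
    have [M HM] := tail_lim (sH i) (divr_gt0 e0 q0); exists M => k Mk.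
    rewrite -(tail_id (ytail k)) hdot_tail //.
    apply: le_trans (nm_hdot (yH k) (HA_tail _ (sH i))) _.
    by rewrite y1 mul1r; apply: HM; exact: leq_trans (Nk k).
  have [M HM] := choice ex; exists (\max_i M i)%N => k Mk.
  apply: (@le_trans _ _ (\sum_(i < q) e / (q%:R + 1))).
    by apply: ler_sum => i _; apply: HM; apply: leq_trans Mk; exact: leq_bigmax.
  rewrite sumr_const card_ord -[leLHS]mulr_natr mulrAC ler_pdivrMr //.
  by rewrite ler_wpM2l ?(ltW e0) // lerDl.
(* Indices are thinned out until [sigma] is at most [4^-j], so that coefficients [2^-j] are still
   summable but decay more slowly. *)
have nxt (p : nat * nat) : exists k, (p.2 < k)%N /\ sigma k <= 4 ^- p.1.
  have e0 : 0 < 4 ^- p.1 :> R by rewrite invr_gt0 exprn_gt0.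
  have [M HM] := sig0 _ e0; exists (maxn M p.2.+1); split.
    by rewrite leq_max ltnSn orbT.
  by apply: HM; exact: leq_maxl.
have [g hg] := choice nxt.
pose kap := fix kap j : nat := if j is j'.+1 then g (j, kap j') else g (0%N, 0%N).
have kap_sig j : sigma (kap j) <= 4 ^- j.
  by case: j => [|j]; [case: (hg (0%N, 0%N))|case: (hg (j.+1, kap j))].
have kap_lt i j : (i < j)%N -> (kap i < kap j)%N.
  elim: j => // j IH; rewrite ltnS leq_eqVlt => /orP[/eqP ->|/IH h].
    by case: (hg (j.+1, kap j)).
  by apply: ltn_trans h _; case: (hg (j.+1, kap j)).
have kap_neq i j : i != j -> kap i != kap j.
  rewrite neq_ltn => /orP[] /kap_lt; first by move=> /ltn_eqF ->.
  by move=> /gtn_eqF ->.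
pose w j : seqA := (2 ^- j)%:C%C *: y (kap j).
have wH j : HA (w j) by exact: HAZ.
pose U n := \sum_(j < n) w j.
have UH n : HA (U n) by exact: HA_sum.
have hd n : hn (U n.+1 - U n) <= 2 * (1 - 2 ^- n.+1) - 2 * (1 - 2 ^- n).
  rewrite /U big_ord_recr /= [X in hn X]addrC addKr hnZ // cabsR y1 mulr1 ger0_norm ?invr_ge0 ?exprn_ge0 //.
  by rewrite le_eqVlt; apply/orP; left; apply/eqP; rewrite exprS; field; rewrite expf_neq0.
have hB n : 2 * (1 - 2 ^- n) <= 2 :> R.
  by have : 0 <= 2 ^- n :> R; [rewrite invr_ge0 exprn_ge0|lra].
have [X [XH cX dX]] := dominated_cvH UH hd hB.
have lT := hlinear_sub lF lK.
have aK : adjointable K by case: cK.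
have [_ [mK bK]] := adjointable_hlinear aK.
have kX : hker (F \- K) X.
  split=> //; have hTX := hlin_HA lT XH.
  have bT : hbound (F \- K) (mF + mK).
    have [f0 hF] := bF; have [k0 hK] := bK; split=> [|z hz]; first exact: addr_ge0.
    apply: le_trans (hnB (hlin_HA lF hz) (hlin_HA lK hz)) _.
    by rewrite mulrDl lerD ?hF ?hK.
  have TU n : (F \- K) (U n) = 0.
    rewrite (hlin_sum lT) // big1 // => j _; rewrite (hlinZ lT) //.
    by rewrite /= Ky subrr scaler0.
  have cT := hbound_cvH lT bT UH XH cX.
  apply: hn_eq0 => //; apply: small_eq0 => [|e /cT[M HM]]; first exact: hn_ge0.
  by have := HM M (leqnn M); rewrite TU sub0r hnN.
(* By disjointness only the j-th term of the series pairs with [y (kap j)], and [|<y, y>| = 1]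
   there. *)
have pair j : nm (hdot (y (kap j)) X) = 2 ^- j.
  have hyk := yH (kap j).
  have e1 : hdot (y (kap j)) X = (2 ^- j)%:C%C *: hdot (y (kap j)) (y (kap j)).
    apply/eqP; rewrite -subr_eq0; apply/eqP/nm_eq0/small_eq0 => [|e /cX[M HM]].
      exact: nm_ge0.
    set n := maxn M j.+1; have jn : (j < n)%N by rewrite leq_max ltnSn orbT.
    have -> : (2 ^- j)%:C%C *: hdot (y (kap j)) (y (kap j)) = hdot (y (kap j)) (U n).
      rewrite hdot_sumr // (bigD1 (Ordinal jn)) //= big1 ?addr0 ?hdotZr // => i ij.
      have ij' : nat_of_ord i != j by apply: contra ij => /eqP h; apply/eqP/val_inj.
      rewrite /w hdotZr // {1}/y hdot_actl // disj ?cmul0r ?scaler0 //.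
      by rewrite eq_sym kap_neq.
    rewrite -hdotBr //; apply: le_trans (nm_hdot hyk (HAB XH (UH n))) _.
    rewrite y1 mul1r hnBC //; apply: HM; exact: leq_maxl.
  by rewrite e1 nmZr ger0_norm ?invr_ge0 ?exprn_ge0 // -hn_sqr y1 expr1n mulr1.
move: kX; rewrite es /= => -[cc [aa eX]].
pose B : R := \sum_i (cabs (cc i) + nm (aa i)).
have B0 : 0 <= B by apply: sumr_ge0 => i _; rewrite addr_ge0 ?cabs_ge0 ?nm_ge0.
have bound k : nm (hdot (y k) X) <= B * sigma k.
  have hst i : HA (cc i *: s i + hact (s i) (aa i)).
    by apply: HAD; [exact: HAZ|exact: HA_act].
  rewrite eX hdot_sumr //; apply: le_trans (nm_sum _ _ _) _.
  rewrite /sigma big_distrr /=; apply: ler_sum => i _.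
  rewrite hdotDr //; [|exact: HAZ|exact: HA_act].
  rewrite hdotZr // hdot_actr //; apply: le_trans (nmD _ _) _; rewrite nmZ -/(cabs _).
  have h1 := nmM (hdot (y k) (s i)) (aa i).
  have h2 : cabs (cc i) + nm (aa i) <= B.
    by rewrite /B (bigD1 i) //= lerDl sumr_ge0 // => j _; rewrite addr_ge0 ?cabs_ge0 ?nm_ge0.
  have h3 := ler_wpM2r (nm_ge0 (hdot (y k) (s i))) h2.
  by lra.
(* The index [j.+1] gains the factor 1/2 that makes [B 4^-(j+1) < 2^-(j+1)] strict. *)
have [j hj] := expr2V_le B (ltr01 : 0 < 1 :> R).
have := bound (kap j.+1); rewrite pair leNgt => /negP; apply.
have p2 : 0 < 2 ^- j.+1 :> R by rewrite invr_gt0 exprn_gt0.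
apply: (@le_lt_trans _ _ (B * 4 ^- j.+1)); first by rewrite ler_wpM2l.
have -> : 4 ^- j.+1 = 2 ^- j.+1 * 2 ^- j.+1 :> R.
  by rewrite -invfM -exprMn; congr (_ ^- _); ring.
rewrite mulrA -[ltRHS]mul1r ltr_pM2r //.
have : B * 2 ^- j.+1 = B * 2 ^- j / 2 by rewrite exprS; field; rewrite expf_neq0.
by lra.
Qed.

End Backward.

Theorem theorem3p5 (R : realType) (A : cstarAlgType R)
    (hA : is_Wstar_algebra A) (F : (nat -> A) -> (nat -> A))
    (hF : adjointable F) :
  upper_semi_Fredholm F <->
  (forall K : (nat -> A) -> (nat -> A), compact_adjointable K ->
     finitely_generated (hker (F \- K))).
Proof.
split=> [hF' K cK|]; last exact: ker_fg_upper_semi_Fredholm.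
exact: upper_semi_Fredholm_ker.
Qed.
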